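(* Let $\mathbb{K}\in\{\mathbb{R},\mathbb{C},\mathbb{H}\}$, $\delta=\dim_{\mathbb{R}}\mathbb{K}$, $m\ge 2$, $p\in 2\mathbb{N}$, and set $\alpha=\frac{\delta(m-1)-2}{2}$, $\beta=\frac{\delta-2}{2}$. Let $\xi$ be the largest root of the Jacobi polynomial $P^{(\alpha+1,\beta+1)}_{p/2}(t)$ and $\varepsilon=(1-\xi)/2$. Then the number $n$ of nodes of every projective cubature formula of index $p$ on $S^{\delta m-1}\subset\mathbb{K}^m$ satisfies \[ n\ \ge\ \frac{\Gamma(\alpha+2)\Gamma(\beta+1)}{\Gamma(\alpha+\beta+2)\,F(-\beta,\alpha+1;\alpha+2;\varepsilon)}\left(\frac{1}{\varepsilon}\right)^{\delta(m-1)/2}, \] where $F={}_2F_1$ is the Gauss hypergeometric function.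
   Context: $\mathbb{H}$ denotes the quaternions; $\delta=1,2,4$ for $\mathbb{R},\mathbb{C},\mathbb{H}$. Identify $\mathbb{K}^m\cong\mathbb{R}^{\delta m}$ with standard inner product $(x,y)=\sum_i\bar x_iy_i$; $S=S^{\delta m-1}$ is its unit sphere and $\sigma$ the normalized rotation-invariant surface measure on $S$. $\Phi_{\mathbb{K}}(m,p)$ is the space of complex-valued functions on $S$ which are restrictions of homogeneous polynomials $\psi$ of degree $p$ on $\mathbb{R}^{\delta m}$ (complex coefficients) satisfying $\psi(w\lambda)=\psi(w)$ for all $w\in\mathbb{K}^m$ and $\lambda\in\mathbb{K}$ with $|\lambda|=1$. A projective cubature formula of index $p$ on $S$ with $n$ nodes consists of points $x_1,\dots,x_n\in S$ that are projectively distinct ($x_i\neq x_j\lambda$ for $i\ne j$, $|\lambda|=1$) and weights $\rho_1,\dots,\rho_n>0$ such that $\int_S\phi\,d\sigma=\sum_{i=1}^n\rho_i\phi(x_i)$ for all $\phi\in\Phi_{\mathbb{K}}(m,p)$. Jacobi polynomials $P_k^{(a,b)}$ are orthogonal on $(-1,1)$ with weight $(1-t)^a(1+t)^b$. *)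

(* Defs.v *)
From HB Require Import structures.
From mathcomp Require Import all_boot all_order all_algebra.
From mathcomp Require Import all_classical all_reals all_analysis.
Unset Printing Implicit Defensive.
Import Order.TTheory GRing.Theory Num.Theory.
Import numFieldNormedType.Exports.
Local Open Scope classical_set_scope.
Local Open Scope ring_scope.

Inductive kfield := KR | KC | KH.
Definition kdim (K : kfield) : nat := match K with KR => 1 | KC => 2 | KH => 4 end.

Section Defs.
Variable R : realType.

Record quat := Quat { q0 : R; q1 : R; q2 : R; q3 : R }.
Definition qmul (a b : quat) : quat := Quat
  (q0 a * q0 b - q1 a * q1 b - q2 a * q2 b - q3 a * q3 b)
  (q0 a * q1 b + q1 a * q0 b + q2 a * q3 b - q3 a * q2 b)
  (q0 a * q2 b - q1 a * q3 b + q2 a * q0 b + q3 a * q1 b)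
  (q0 a * q3 b + q1 a * q2 b - q2 a * q1 b + q3 a * q0 b).
Definition qcomp (a : quat) (r : nat) : R :=
  match r with 0 => q0 a | 1 => q1 a | 2 => q2 a | 3 => q3 a | _ => 0 end.

Definition in_K (K : kfield) (a : quat) : Prop :=
  forall r, (kdim K <= r)%N -> qcomp a r = 0.
Definition unit_K (K : kfield) (a : quat) : Prop :=
  in_K K a /\ q0 a ^+ 2 + q1 a ^+ 2 + q2 a ^+ 2 + q3 a ^+ 2 = 1.

Definition entry (K : kfield) (s : seq R) (j r : nat) : R :=
  if (r < kdim K)%N then nth 0 s (j * kdim K + r) else 0.
Definition kcoord (K : kfield) (s : seq R) (j : nat) : quat :=
  Quat (entry K s j 0) (entry K s j 1) (entry K s j 2) (entry K s j 3).

Definition rscale (K : kfield) (m : nat) (x : (kdim K * m).-tuple R) (l : quat)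
  : (kdim K * m).-tuple R :=
  [tuple qcomp (qmul (kcoord K x (i %/ kdim K)) l) (i %% kdim K)
     | i < kdim K * m].

Definition sphere (N : nat) : set (N.-tuple R) :=
  [set x | \sum_(i < N) tnth x i ^+ 2 = 1].

Definition rotate (N : nat) (Q : 'M[R]_N) (x : N.-tuple R) : N.-tuple R :=
  [tuple \sum_(j < N) Q i j * tnth x j | i < N].

Definition is_rotation (N : nat) (Q : 'M[R]_N) : Prop :=
  Q *m Q^T = 1%:M /\ \det Q = 1.

Definition normalized_rotation_invariant (N : nat)
   (sigma : probability (N.-tuple R) R) : Prop :=
  sigma (~` sphere N) = 0%E /\
  forall Q : 'M[R]_N, is_rotation N Q ->
    forall A, measurable A -> sigma (rotate N Q @^-1` A) = sigma A.

Definition homog_poly (N p : nat) (f : N.-tuple R -> R) : Prop :=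
  exists c : {ffun 'I_N -> 'I_p.+1} -> R,
    forall x, f x = \sum_(a : {ffun 'I_N -> 'I_p.+1} | (\sum_(i < N) (a i : nat) == p)%N)
                     c a * \prod_(i < N) tnth x i ^+ a i.

Definition Phi (K : kfield) (m p : nat)
   (psi : ((kdim K * m).-tuple R -> R) * ((kdim K * m).-tuple R -> R)) : Prop :=
  homog_poly (kdim K * m) p psi.1 /\ homog_poly (kdim K * m) p psi.2 /\
  forall w l, unit_K K l ->
    psi.1 (rscale K m w l) = psi.1 w /\ psi.2 (rscale K m w l) = psi.2 w.

Definition proj_cubature (K : kfield) (m p : nat)
   (sigma : probability ((kdim K * m).-tuple R) R)
   (n : nat) (x : 'I_n -> (kdim K * m).-tuple R) (rho : 'I_n -> R) : Prop :=
  [/\ forall i, sphere _ (x i),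
      forall i j, i != j -> forall l, unit_K K l -> x i != rscale K m (x j) l,
      forall i, 0 < rho i &
      forall psi, Phi K m p psi ->
        (\int[sigma]_(y in sphere _) (psi.1 y)%:E
           = (\sum_(i < n) rho i * psi.1 (x i))%:E)%E /\
        (\int[sigma]_(y in sphere _) (psi.2 y)%:E
           = (\sum_(i < n) rho i * psi.2 (x i))%:E)%E].

Definition gbinom (a : R) (j : nat) : R :=
  (\prod_(i < j) (a - i%:R)) / j`!%:R.

Definition jacobi (a b : R) (k : nat) : {poly R} :=
  \sum_(s < k.+1) (gbinom (k%:R + a) (k - s) * gbinom (k%:R + b) s) *:
     ((2^-1 *: ('X - 1)) ^+ s * (2^-1 *: ('X + 1)) ^+ (k - s)).

Definition pochhammer (a : R) (k : nat) : R := \prod_(i < k) (a + i%:R).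

Definition hyp2F1 (a b c z : R) : R :=
  limn (fun n => \sum_(0 <= k < n) (pochhammer a k * pochhammer b k
                      / (pochhammer c k * k`!%:R) * z ^+ k)).

Definition Gamma (x : R) : R :=
  \int[@lebesgue_measure R]_(t in `]0, +oo[) (t `^ (x - 1) * expR (- t)).

End Defs.

(* Main.v *)
(* Put [a = delta (m - 1) / 2], [b = delta / 2], [k = p / 2]. On functions of
   [s = |(x, y)|^2] the spherical Laplacian is a multiple of the Jacobi operator
   [L f = s (1 - s) f'' + (b - (a + b) s) f']; let [lam = (k + 1) (k + a + b)] be
   its eigenvalue of degree [k + 1], and [c = (1 + xi) / 2]. Since [c] is the largest root of
   the Jacobi polynomial of degree [k], there is [q >= 0] on [[c, 1]] with
   [L q + lam q = lam] and [q c = q' c = 0], so the truncation [g] of [q] to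
   [[c, 1]] solves [L g + lam g = lam 1_[c, 1]]. Let [F y = \sum_i rho_i g (|(x_i, y)|^2)].
   The cubature kills the components of [F] of degrees [1 .. k] and the others
   have eigenvalue at least [lam], hence [\int F (L F + lam F) <= lam (\int F)^2]. On
   the left, all terms are nonnegative and the diagonal ones add up to
   [lam (\sum_i rho_i^2) \int g >= lam / n \int g]. As [\int L g = 0], the mean
   of [g] is the measure of the cap [s >= c], so this measure is at least [1 / n].
   Since [g] is only [C^1], the inequality is proved for polynomials close to it.
   The cap measure is a quotient of two integrals over [s = sin^2 t], evaluated
   by the Gamma function and, expanding a power of [1 - s], by [2F1]. *)

Require Import Defs.
From HB Require Import structures.
From mathcomp Require Import all_boot all_order all_algebra.
From mathcomp Require Import all_classical all_reals all_analysis.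
From mathcomp Require Import measurable_realfun polyrcf.
From mathcomp Require Import ring lra.
Import Order.TTheory GRing.Theory Num.Theory.
Import numFieldNormedType.Exports.
Local Open Scope classical_set_scope.
Local Open Scope ring_scope.

(** * Jacobi polynomials and their largest root *)

(** The polynomial [q] is [1 - P / P(c)] with [P] an eigenpolynomial of [L] of degree [k + 1].
    Differentiating the eigenvalue equation raises both parameters by one, so [P'] can be taken to
    be the Jacobi polynomial of degree [k] whose largest root is [c]. In divergence form,
    [L f = w^-1 (s^b (1 - s)^a f')'] with [w = s^(b-1) (1 - s)^(a-1)]. The only information on
    [sigma] is its invariance under rotations. Green's formula is therefore derived from rotations
    of coordinate planes: a derivative along such rotations has mean zero, and the second
    derivatives sum to the Laplacian. The law of [|(x, y)|^2] is not computed by a change of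
    variables either: the mean over the sphere and a one-dimensional integral both kill the image of
    [L], which together with the constants spans all polynomials, so the two functionals are
    proportional. Because the off-diagonal terms are dropped by sign, the polynomials close to [g]
    must satisfy [G >= 0] and [L G + lam G >= 0] exactly on [[0, 1]]; adding a small constant
    achieves this. *)

Definition jacobi_op (R : realType) (a b : R) (f : {poly R}) : {poly R} :=
  'X * (1 - 'X) * f^`()^`() + (b%:P - (a + b) *: 'X) * f^`().

Lemma gbinomS (R : realType) (x : R) j :
  gbinom R x j.+1 * j.+1%:R = gbinom R x j * (x - j%:R).
Proof.
rewrite /gbinom big_ord_recr /= factS natrM.
have h1 : (j`!%:R : R) != 0 by rewrite pnatr_eq0 -lt0n fact_gt0.
have h2 : (j.+1%:R : R) != 0 by rewrite pnatr_eq0.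
by field; rewrite h1 addrC natr1 h2.
Qed.

Definition jacobi_term (R : realType) (j n : nat) : {poly R} :=
  ('X - 1) ^+ j * 'X ^+ n.

(** Drops in degree are absorbed by [1 = 'X - ('X - 1)], so everything stays among terms of total
    degree [n + j]. At index [0] the predecessor is a default value, but its coefficient
    vanishes. *)
Lemma jacobi_term_ode (R : realType) (a b : R) (j n : nat) :
  jacobi_op R (a + 1) (b + 1) (jacobi_term R j n) +
  ((n + j)%:R * ((n + j)%:R + a + b + 1)) *: jacobi_term R j n =
  (j%:R * (j%:R + a)) *: (jacobi_term R j n - jacobi_term R j.-1 n.+1) +
  (n%:R * (n%:R + b)) *: (jacobi_term R j n - jacobi_term R j.+1 n.-1).
Proof.
have dX1 : forall i, (('X - 1 : {poly R}) ^+ i)^`() = i%:R *: ('X - 1) ^+ i.-1.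
  by move=> i; rewrite deriv_exp derivB derivX -polyC1 derivC subr0 mul1r scaler_nat.
have dX : forall i, ('X^i : {poly R})^`() = i%:R *: 'X ^+ i.-1.
  by move=> i; rewrite derivXn scaler_nat.
have dT : forall i l, (jacobi_term R i l)^`() =
   i%:R *: jacobi_term R i.-1 l + l%:R *: jacobi_term R i l.-1.
  by move=> i l; rewrite /jacobi_term derivM dX1 dX scalerAl scalerAr.
rewrite /jacobi_op dT derivD !derivZ !dT /jacobi_term.
rewrite -!mul_polyC !(polyCD,polyCM,polyCB,natrD,polyC1,polyCN,polyC_natr).
move: a%:P b%:P => A B.
case: j => [|[|j]]; case: n => [|[|n]] /=;
rewrite ?exprS ?expr0 -?[j.+2%:R]natr1 -?[j.+1%:R]natr1 -?[n.+2%:R]natr1 -?[n.+1%:R]natr1;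
try set u := _ ^+ j; try set v := 'X ^+ n; ring.
Qed.

Definition jacobi01 (R : realType) (a b : R) (k : nat) : {poly R} :=
  jacobi R a b k \Po (2 *: 'X - 1).

Definition jacobi_coef (R : realType) (a b : R) (k j : nat) : R :=
  gbinom R (k%:R + a) (k - j) * gbinom R (k%:R + b) j.

Lemma jacobi01E (R : realType) (a b : R) k :
  jacobi01 R a b k =
  \sum_(j < k.+1) jacobi_coef R a b k j *: jacobi_term R j (k - j).
Proof.
have h : (2 : R) != 0 by rewrite pnatr_eq0.
rewrite /jacobi01 /jacobi linear_sum /=; apply: eq_bigr => j _.
have hu : (2^-1)%:P * 2 = 1 :> {poly R} by rewrite -(polyC_natr _ 2) -polyCM mulVf.
have e1 : 2^-1 *: ('X - 1 : {poly R}) \Po (2 *: 'X - 1) = 'X - 1.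
  rewrite comp_polyZ comp_polyB comp_polyX -[X in X \Po _]polyC1 comp_polyC polyC1.
  rewrite -!mul_polyC polyC_natr.
  transitivity ((2^-1)%:P * 2 * ('X - 1 : {poly R})); [ring|by rewrite hu mul1r].
have e2 : 2^-1 *: ('X + 1 : {poly R}) \Po (2 *: 'X - 1) = 'X.
  rewrite comp_polyZ comp_polyD comp_polyX -[X in X \Po _]polyC1 comp_polyC polyC1.
  rewrite -!mul_polyC polyC_natr.
  transitivity ((2^-1)%:P * 2 * ('X : {poly R})); [ring|by rewrite hu mul1r].
by rewrite comp_polyZ comp_polyM !rmorphXn /= e1 e2.
Qed.

Lemma horner_jacobi01 (R : realType) (a b : R) k x :
  (jacobi01 R a b k).[x] =
  \sum_(j < k.+1) jacobi_coef R a b k j * ((x - 1) ^+ j * x ^+ (k - j)).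
Proof.
rewrite jacobi01E horner_sum; apply: eq_bigr => j _.
by rewrite /jacobi_term !hornerE.
Qed.

(** The ratio of consecutive coefficients, written with exactly the two factors that occur in
    [jacobi_term_ode]. *)
Lemma jacobi_coefS (R : realType) (a b : R) k j : (j < k)%N ->
  jacobi_coef R a b k j.+1 * (j.+1%:R * (j.+1%:R + a)) =
  jacobi_coef R a b k j * ((k - j)%:R * ((k - j)%:R + b)).
Proof.
move=> jk; rewrite /jacobi_coef.
have -> : (k - j = (k - j.+1).+1)%N by rewrite subnSK.
set d := (k - j.+1)%N.
have kE : k%:R = d%:R + j%:R + 1 :> R.
  by rewrite /d natrB // -[j.+1%:R]natr1; ring.
have h1 := gbinomS R (k%:R + b) j.
have h2 := gbinomS R (k%:R + a) d.
have e1 : k%:R + a - d%:R = j.+1%:R + a by rewrite kE -natr1; ring.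
have e2 : k%:R + b - j%:R = d.+1%:R + b by rewrite kE -natr1; ring.
transitivity ((gbinom R (k%:R + a) d * (k%:R + a - d%:R)) *
  (gbinom R (k%:R + b) j.+1 * j.+1%:R)); first by rewrite e1; ring.
by rewrite -h2 h1 e2; ring.
Qed.

Lemma jacobi01_ode (R : realType) (a b : R) k :
  jacobi_op R (a + 1) (b + 1) (jacobi01 R a b k) +
  (k%:R * (k%:R + a + b + 1)) *: jacobi01 R a b k = 0.
Proof.
rewrite jacobi01E.
set e := jacobi_coef R a b k.
pose Op f := jacobi_op R (a + 1) (b + 1) f + (k%:R * (k%:R + a + b + 1)) *: f.
have OpD : forall f g : {poly R}, Op (f + g) = Op f + Op g.
  move=> f g; rewrite /Op /jacobi_op !derivD -!mul_polyC. by ring.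
have OpZ : forall (c : R) (f : {poly R}), Op (c *: f) = c *: Op f.
  move=> c f; rewrite /Op /jacobi_op !derivZ -!mul_polyC; ring.
have Op0 : Op 0 = 0 by have := OpZ 0 0; rewrite !scale0r.
rewrite -/(Op _) (big_morph Op OpD Op0).
under eq_bigr => j _.
  rewrite OpZ /Op.
  have kj : ((k - j) + j = k)%N by rewrite subnK // -ltnS.
  rewrite -[X in X%:R * _]kj -[X in _ * (X%:R + _ + _ + _)]kj jacobi_term_ode.
  rewrite scalerDr !scalerA.
  over.
(* The first half loses its term [j = 0] and the second its term [j = k]. After the shift both are
   indexed by the pairs [j], [j.+1], where [jacobi_coefS] makes them cancel. *)
rewrite big_split /= big_ord_recl mul0r mulr0 scale0r add0r.
rewrite big_ord_recr /= subnn mul0r mulr0 scale0r addr0 -big_split /=.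
apply: big1 => j _; have jk := ltn_ord j.
rewrite /bump /= add1n jacobi_coefS // -scalerDr.
have -> : (k - j.+1).+1 = (k - j)%N by rewrite subnSK.
have -> : (k - j).-1 = (k - j.+1)%N by rewrite subnS.
by rewrite -opprB addNr scaler0.
Qed.

Lemma gbinom_gt0 (R : realType) (x : R) j : j%:R <= x -> 0 < gbinom R x j.
Proof.
move=> jx; rewrite /gbinom divr_gt0 ?ltr0n ?fact_gt0 // prodr_gt0 // => i _.
by rewrite subr_gt0 (lt_le_trans _ jx) // ltr_nat.
Qed.

Lemma jacobi_coef_gt0 (R : realType) (a b : R) k j : 0 <= a -> 0 <= b ->
  (j <= k)%N -> 0 < jacobi_coef R a b k j.
Proof.
move=> a0 b0 jk; rewrite mulr_gt0 // gbinom_gt0 //.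
  by rewrite ler_wpDr // ler_nat leq_subr.
by rewrite ler_wpDr // ler_nat.
Qed.

Lemma jacobi01_gt0 (R : realType) (a b : R) k x : 0 <= a -> 0 <= b ->
  1 <= x -> 0 < (jacobi01 R a b k).[x].
Proof.
move=> a0 b0 x1; rewrite horner_jacobi01 big_ord_recl /= expr0 mul1r subn0.
have x0 : 0 < x by rewrite (lt_le_trans _ x1).
rewrite ltr_pwDl //.
  by rewrite mulr_gt0 ?jacobi_coef_gt0 ?exprn_gt0.
apply: sumr_ge0 => j _; rewrite mulr_ge0 //.
  by rewrite ltW // jacobi_coef_gt0 //; exact: ltn_ord.
by rewrite mulr_ge0 // exprn_ge0 ?subr_ge0 // ltW.
Qed.

(** Both [x - 1] and [x] are nonpositive, so no summand has the sign opposite to [(-1) ^ k], and the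
    last one is nonzero. With [jacobi01_gt0] this confines the roots to the open unit interval. *)
Lemma jacobi01_le0_neq0 (R : realType) (a b : R) k x : 0 <= a -> 0 <= b ->
  x <= 0 -> (jacobi01 R a b k).[x] != 0.
Proof.
move=> a0 b0 x0.
suff : 0 < (-1) ^+ k * (jacobi01 R a b k).[x].
  by apply: contraTneq => ->; rewrite mulr0 ltxx.
rewrite horner_jacobi01 mulr_sumr.
have e (j : 'I_k.+1) :
    (-1) ^+ k * (jacobi_coef R a b k j * ((x - 1) ^+ j * x ^+ (k - j)))
    = jacobi_coef R a b k j * ((1 - x) ^+ j * (- x) ^+ (k - j)).
  have -> : (-1) ^+ k = (-1) ^+ j * (-1) ^+ (k - j) :> R.
    by rewrite -exprD subnKC // -ltnS.
  by rewrite -(opprB x 1) (exprNn (x - 1)) (exprNn x); ring.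
under eq_bigr do rewrite e.
rewrite big_ord_recr /= subnn expr0 mulr1 ltr_wpDl //.
  apply: sumr_ge0 => j _; rewrite mulr_ge0 //.
    by rewrite ltW // jacobi_coef_gt0 // ltnW.
  by rewrite mulr_ge0 // exprn_ge0; lra.
by rewrite mulr_gt0 ?jacobi_coef_gt0 // exprn_gt0; lra.
Qed.

(** At a root of multiplicity [n + 2] the term [s (1 - s) f''] vanishes to order [n] only and the
    other terms to higher order, so nothing can cancel it at a point where [s (1 - s)] is
    nonzero. *)
Lemma jacobi_op_simple_root (R : realType) (a b l c : R) (f : {poly R}) :
  f != 0 -> jacobi_op R a b f + l *: f = 0 -> 0 < c < 1 ->
  f.[c] = 0 -> f^`().[c] != 0.
Proof.
move=> f0 ode /andP[c0 c1] fc; apply/eqP => f'c.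
have [m [T]] := multiplicity_XsubC f c.
rewrite f0 /= => rT fE.
set Y : {poly R} := 'X - c%:P in fE.
have Yc : Y.[c] = 0 by rewrite /Y !hornerE subrr.
have dY : Y^`() = 1 by rewrite derivXsubC.
have Y0 : Y != 0 by rewrite polyXsubC_eq0.
have Tc : T.[c] != 0 by [].
clearbody Y.
have dYn i : (Y ^+ i.+1)^`() = i.+1%:R * Y ^+ i.
  by rewrite deriv_exp dY mul1r mulr_natl.
case: m fE => [|[|n]] fE.
- by move: fc; rewrite fE expr0 mulr1 => h; rewrite h eqxx in Tc.
- move: f'c; rewrite fE expr1 derivM dY mulr1 !hornerE Yc mulr0 add0r => h.
  by rewrite h eqxx in Tc.
have f1 : f^`() = T^`() * Y ^+ n.+2 + T * (n.+2%:R * Y ^+ n.+1).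
  by rewrite fE derivM dYn.
have f2 : f^`()^`() = T^`()^`() * Y ^+ n.+2 + T^`() * (n.+2%:R * Y ^+ n.+1) +
    (T^`() * (n.+2%:R * Y ^+ n.+1) + T * (n.+2%:R * (n.+1%:R * Y ^+ n))).
  have dn i : (i%:R : {poly R})^`() = 0 by rewrite -polyC_natr derivC.
  by rewrite f1 derivD (derivM T^`()) (derivM T) (derivM _ (Y ^+ _)) !dYn dn mul0r add0r.
(* The equation divided by [Y ^+ n]; at [c] only [c (1 - c) (n + 2) (n + 1) T(c)] remains. *)
pose W : {poly R} := 'X * (1 - 'X) * (T^`()^`() * Y ^+ 2 + 2 * n.+2%:R * T^`() * Y
   + n.+2%:R * n.+1%:R * T) +
   (b%:P - (a + b) *: 'X) * (T^`() * Y ^+ 2 + n.+2%:R * T * Y) + l *: (T * Y ^+ 2).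
have : Y ^+ n * W = 0.
  rewrite -[RHS]ode /jacobi_op f2 f1 fE /W -!mul_polyC !exprS expr0.
  by set y := Y ^+ n; ring.
move/eqP; rewrite mulf_eq0 expf_eq0 (negPf Y0) andbF /= => /eqP W0.
have : W.[c] = 0 by rewrite W0 horner0.
rewrite /W -!polyC_natr !hornerE Yc !(mulr0, expr0n, addr0, add0r) /=.
move/eqP; rewrite !mulr0 !addr0 add0r !mulf_eq0 (negPf Tc) !pnatr_eq0 /= !orbF.
by rewrite gt_eqF //= subr_eq0 gt_eqF.
Qed.

Lemma poly_monotone (R : realType) (p : {poly R}) (u v : R) : u <= v ->
  (forall x, u <= x <= v -> 0 <= p^`().[x]) -> p.[u] <= p.[v].
Proof.
rewrite le_eqVlt => /predU1P[-> //|uv h].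
have [c] := poly_mvt p uv; rewrite in_itv /= => /andP[uc cv] e.
rewrite -subr_ge0 e mulr_ge0 ?subr_ge0 ?(ltW uv) // h //.
by rewrite (ltW uc) (ltW cv).
Qed.

(** The derivative of [q] is [- Q / P(c)]. Since [Q > 0] on [(c, 1]] and [P(c) < 0], [q] increases
    from [q(c) = 0]. The sign of [P(c)] comes from [Q'(c) > 0], hence from the simplicity of the
    root. *)
Lemma jacobi01_extremal (R : realType) (a b : R) (k : nat) (c : R) :
  0 < a -> 0 < b -> (jacobi01 R a b k).[c] = 0 ->
  (forall t, (jacobi01 R a b k).[t] = 0 -> t <= c) ->
  0 < c < 1 /\ exists q : {poly R},
   [/\ q.[c] = 0, q^`().[c] = 0, forall s, c <= s <= 1 -> 0 <= q.[s] &
     jacobi_op R a b q + (k.+1%:R * (k%:R + a + b)) *: q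
       = (k.+1%:R * (k%:R + a + b))%:P].
Proof.
move=> a0 b0 Qc cmax; set Q := jacobi01 R a b k in Qc cmax *.
have c01 : 0 < c < 1.
  apply/andP; split.
    rewrite ltNge; apply/negP => c0.
    by have := jacobi01_le0_neq0 R a b k c (ltW a0) (ltW b0) c0; rewrite Qc eqxx.
  rewrite ltNge; apply/negP => c1.
  by have := jacobi01_gt0 R a b k c (ltW a0) (ltW b0) c1; rewrite Qc ltxx.
split=> //; have /andP[c0 c1] := c01.
have Q1 : 0 < Q.[1] by apply: jacobi01_gt0; rewrite // ltW.
have Qpos s : c < s -> s <= 1 -> 0 < Q.[s].
  move=> cs s1; rewrite ltNge; apply/negP => Qs.
  have [||r] := @polyrcf.poly_ivt R Q s 1 => //.
    by rewrite mulr_le0_ge0 // ltW.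
  rewrite in_itv /= => /andP[sr _] /rootP Qr.
  by have := cmax _ Qr; rewrite leNgt (lt_le_trans cs sr).
have Q'c : 0 < Q^`().[c].
  have : Q^`().[c] != 0.
    apply: (jacobi_op_simple_root _ (a + 1) (b + 1) _ c Q _ (jacobi01_ode R a b k)) => //.
    by apply: contraTneq Q1 => ->; rewrite horner0 ltxx.
  rewrite lt_neqAle eq_sym => -> /=.
  rewrite leNgt; apply/negP => Q'n.
  have Q'n' : 0 < - Q^`().[c] by rewrite oppr_gt0.
  have [d d0 hd] := poly_cont c Q^`() Q'n'.
  (* Within distance [d] of [c] the derivative would stay negative, and the mean value theorem would
     give [Q(s) < 0]. *)
  pose s := Num.min 1 (c + d / 2).
  have cs : c < s by rewrite /s lt_min c1 ltrDl divr_gt0.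
  have s1 : s <= 1 by rewrite ge_min lexx.
  have sd : s <= c + d / 2 by rewrite ge_min lexx orbT.
  have [e] := poly_mvt Q cs; rewrite in_itv /= Qc subr0 => /andP[ce es] Qe.
  have := Qpos _ cs s1; rewrite Qe pmulr_lgt0 ?subr_gt0 //.
  apply/negP; rewrite -leNgt.
  have := hd e; rewrite gtr0_norm ?subr_gt0 // => /(_ ltac:(lra)).
  by rewrite ltr_norml => /andP[_]; lra.
pose lam : R := k.+1%:R * (k%:R + a + b).
have lam0 : 0 < lam.
  by rewrite mulr_gt0 ?ltr0n // -addrA ltr_wpDl // addr_gt0.
(* The equation [L P = - lam P] solved for [P] after putting [P' = Q]: an antiderivative of [Q] with
   the right constant of integration built in. *)
pose P : {poly R} := - lam^-1 *: ('X * (1 - 'X) * Q^`() + (b%:P - (a + b) *: 'X) * Q).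
have dP : P^`() = Q.
  rewrite /P derivZ.
  have -> : ('X * (1 - 'X) * Q^`() + (b%:P - (a + b) *: 'X) * Q)^`() = - lam *: Q.
    apply/eqP; rewrite -subr_eq0; apply/eqP.
    rewrite -[RHS](jacobi01_ode R a b k) -/Q /jacobi_op /lam.
    rewrite !(derivD, derivM, derivB, derivX, derivC, derivN, derivZ).
    rewrite -natr1 -!mul_polyC.
    rewrite !(polyCD,polyCM,polyCB,natrD,polyC1,polyCN,polyC_natr).
    by ring.
  by rewrite scalerA mulrNN mulVf ?scale1r // gt_eqF.
have LP : jacobi_op R a b P = - lam *: P.
  by rewrite /jacobi_op dP /P scalerA mulrNN mulfV ?gt_eqF // scale1r.
have Pc : P.[c] < 0.
  rewrite /P !hornerE Qc mulr0 addr0 mulNr oppr_lt0 mulr_gt0 ?invr_gt0 //.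
  by rewrite !mulr_gt0 // subr_gt0.
clearbody P.
exists (1 - (P.[c])^-1 *: P).
have dq : (1 - (P.[c])^-1 *: P)^`() = - (P.[c])^-1 *: Q.
  by rewrite derivB derivZ dP -polyC1 derivC sub0r scaleNr.
split.
- by rewrite !hornerE mulVf ?subrr // lt_eqF.
- by rewrite dq !hornerE Qc mulr0.
- move=> s /andP[cs s1].
  suff : (1 - (P.[c])^-1 *: P).[c] <= (1 - (P.[c])^-1 *: P).[s].
    by rewrite [X in X <= _]hornerE /= !hornerE mulVf ?subrr // lt_eqF.
  apply: poly_monotone => // x /andP[cx xs].
  rewrite dq !hornerE mulr_ge0 // ?oppr_ge0 ?invr_le0 ?(ltW Pc) //.
  move: cx; rewrite le_eqVlt => /predU1P[<-|cx]; first by rewrite Qc.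
  by rewrite ltW // Qpos // (le_trans xs).
- rewrite -/lam.
  have -> : jacobi_op R a b (1 - (P.[c])^-1 *: P) = - (P.[c])^-1 *: jacobi_op R a b P.
    rewrite /jacobi_op !derivB !derivZ -polyC1 derivC deriv0 !sub0r -!mul_polyC.
    by rewrite polyCN; ring.
  rewrite LP scalerA mulrNN scalerBr scalerA [lam * _]mulrC -alg_polyC.
  by rewrite addrCA subrr addr0.
Qed.

(** * Polynomial approximation of the truncation *)

Lemma bernoulli_inequality (R : realType) (y : R) n : -1 <= y ->
  1 + n%:R * y <= (1 + y) ^+ n.
Proof.
move=> y1; elim: n => [|n ih]; first by rewrite mul0r addr0 expr0.
rewrite exprSr -natr1.
apply: (@le_trans _ _ ((1 + n%:R * y) * (1 + y))); last by rewrite ler_wpM2r //; lra.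
rewrite -subr_ge0.
have -> : (1 + n%:R * y) * (1 + y) - (1 + (n%:R + 1) * y) = n%:R * y ^+ 2 by ring.
by rewrite mulr_ge0 // sqr_ge0.
Qed.

(* [1 - (1 - x ^ n) ^ (2 ^ n)] tends to the unit step at [x = 1/2]. *)
Lemma step_polynomial (R : realType) (c e : R) : 0 < c -> 0 < e -> c + e <= 1 ->
  exists T : {poly R}, forall s : R, 0 <= s <= 1 ->
    [/\ 0 <= T.[s], T.[s] <= 1, s <= c -> T.[s] <= e & c + e <= s -> 1 - e <= T.[s]].
Proof.
move=> c0 e0 ce1; pose h := e / 2.
have h0 : 0 < h by rewrite divr_gt0.
have [n nP] : exists n : nat, e^-1 <= (1 + h) ^+ n.
  pose n := Num.bound (e^-1 / h).
  exists n; apply: le_trans (bernoulli_inequality R h n _); last by lra.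
  have : e^-1 / h <= n%:R.
    by rewrite ltW // archi_boundP // divr_ge0 ?invr_ge0 // ltW.
  by rewrite ler_pdivrMr //; lra.
have Ie : ((1 + h) ^+ n)^-1 <= e.
  by rewrite -[e]invrK lef_pV2 // posrE ?invr_gt0 // exprn_gt0; lra.
have hn0 : 0 < (1 + h) ^+ n by rewrite exprn_gt0; lra.
(* Affine of slope [1/2]: it sends the midpoint [c + h] of the transition layer to [1/2] and maps
   [[0, 1]] into itself. *)
pose x : {poly R} := 2^-1 *: 'X + ((1 - c - h) / 2)%:P.
exists (1 - (1 - x ^+ n) ^+ (2 ^ n)) => s /andP[s0 s1].
have xs : x.[s] = (1 + (s - c - h)) / 2.
  rewrite /x hornerD hornerZ hornerX hornerC.
  by field.
have -> : (1 - (1 - x ^+ n) ^+ (2 ^ n)).[s] = 1 - (1 - x.[s] ^+ n) ^+ (2 ^ n).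
  by rewrite !hornerE.
have eh : e = 2 * h by rewrite /h; field.
have x0 : 0 <= x.[s] by rewrite xs; lra.
have x1 : x.[s] <= 1 by rewrite xs; lra.
set y := x.[s] ^+ n.
have y0 : 0 <= y by rewrite exprn_ge0.
have y1 : y <= 1 by rewrite exprn_ile1.
have p0 : 0 <= (1 - y) ^+ (2 ^ n) by rewrite exprn_ge0; lra.
have p1 : (1 - y) ^+ (2 ^ n) <= 1 by rewrite exprn_ile1; lra.
(* By Bernoulli, [T <= (2 ^ n) y = (2 x) ^ n], which is small when [2 x <= 1 - h], and
   [1 - T <= 1 / (1 + (2 ^ n) y)], which is small when [2 x >= 1 + h]. *)
have yM : (2 ^ n)%:R * y = (2 * x.[s]) ^+ n by rewrite exprMn natrX.
split; [lra|lra| move=> sc | move=> sc].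
- have := bernoulli_inequality R (- y) (2 ^ n) ltac:(lra).
  rewrite mulrN yM.
  suff : (2 * x.[s]) ^+ n <= e by lra.
  apply: le_trans Ie.
  have x2 : 0 <= 2 * x.[s] <= 1 - h by rewrite xs; lra.
  apply: (@le_trans _ _ ((1 - h) ^+ n)).
    by rewrite lerXn2r // ?nnegrE; lra.
  rewrite -[leRHS]mul1r ler_pdivlMr // -exprMn exprn_ile1 //; last nra.
  by rewrite mulr_ge0; lra.
- suff : (1 - y) ^+ (2 ^ n) <= e by lra.
  apply: le_trans Ie.
  have My : (1 + h) ^+ n <= 1 + (2 ^ n)%:R * y.
    rewrite yM; apply: (@le_trans _ _ ((2 * x.[s]) ^+ n)); last lra.
    by rewrite lerXn2r // ?nnegrE; lra.
  have M2 := bernoulli_inequality R y (2 ^ n) ltac:(lra).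
  have M3 : (1 - y) ^+ (2 ^ n) * (1 + y) ^+ (2 ^ n) <= 1.
    by rewrite -exprMn exprn_ile1 //; [rewrite mulr_ge0; lra|nra].
  rewrite -[leRHS]mul1r ler_pdivlMr //; apply: le_trans M3.
  by rewrite ler_wpM2l //; lra.
Qed.

Lemma poly_primitive (R : realType) (f : {poly R}) :
  exists F : {poly R}, F^`() = f /\ F.[0] = 0.
Proof.
exists (\poly_(i < (size f).+1) (f`_i.-1 / i%:R)); split; last first.
  by rewrite horner_coef0 coef_poly /= invr0 mulr0.
apply/polyP => i; rewrite coef_deriv coef_poly ltnS /=.
case: ltnP => [_|si]; last by rewrite mul0rn nth_default.
by rewrite -mulrnAr -mulr_natr mulVf ?mulr1 // pnatr_eq0.
Qed.

Lemma poly_lipschitz_le (R : realType) (p : {poly R}) (u v B : R) : u <= v ->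
  (forall x, u <= x <= v -> `|p^`().[x]| <= B) -> `|p.[v] - p.[u]| <= B * (v - u).
Proof.
rewrite le_eqVlt => /predU1P[->|uv h]; first by rewrite !subrr normr0 mulr0.
have [x] := poly_mvt p uv; rewrite in_itv /= => /andP[ux xv] ->.
rewrite normrM [X in _ * X]gtr0_norm ?subr_gt0 //.
by apply: ler_wpM2r; [rewrite subr_ge0 ltW|apply: h; rewrite !ltW].
Qed.

Lemma poly_bounded01 (R : realType) (p : {poly R}) :
  exists2 B : R, 0 <= B & forall s : R, 0 <= s <= 1 -> `|p.[s]| <= B.
Proof.
have [B hB] := @poly_itv_bound R p 0 1.
have hB' s : 0 <= s <= 1 -> `|p.[s]| <= B by move=> s01; exact: hB.
by exists B => //; apply: le_trans (hB' 0 _); rewrite ?lexx ?ler01.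
Qed.

Lemma horner_jacobi_op (R : realType) (a b : R) (f : {poly R}) (s : R) :
  (jacobi_op R a b f).[s] =
  s * (1 - s) * f^`()^`().[s] + (b - (a + b) * s) * f^`().[s].
Proof. by rewrite /jacobi_op !hornerE. Qed.


Lemma poly_growth (R : realType) (p : {poly R}) (u v m B h : R) :
  u <= v -> 0 <= B -> v - u <= h -> `|p.[u]| <= m ->
  (forall x, u <= x <= v -> `|p^`().[x]| <= B) -> `|p.[v]| <= m + B * h.
Proof.
move=> uv B0 vh pm dp; rewrite -[p.[v]](subrK p.[u]).
apply: le_trans (ler_normD _ _) _; rewrite addrC lerD //.
by apply: le_trans (poly_lipschitz_le R p u v B uv dp) _; rewrite ler_wpM2l.
Qed.

(* [G] solves [G'' = q'' T] with zero data at [0]: as [T] is close to the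
   indicator function of [c, 1], [G] is close to [q] above [c]. *)
Lemma smoothed_truncation (R : realType) (c e B : R) (q T : {poly R}) :
  0 < c -> 0 < e -> c + e <= 1 -> 0 <= B -> q.[c] = 0 -> q^`().[c] = 0 ->
  (forall s : R, 0 <= s <= 1 -> `|q^`()^`().[s]| <= B) ->
  (forall s : R, 0 <= s <= 1 ->
    [/\ 0 <= T.[s], T.[s] <= 1, s <= c -> T.[s] <= e & c + e <= s -> 1 - e <= T.[s]]) ->
  exists G : {poly R},
    [/\ forall x, G^`()^`().[x] = q^`()^`().[x] * T.[x],
        forall x, 0 <= x <= c -> `|G.[x]| <= B * e /\ `|G^`().[x]| <= B * e,
        forall x, c <= x <= c + e -> `|G.[x]| <= 3 * (B * e) /\
          `|G^`().[x]| <= 2 * (B * e),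
        forall x, c <= x <= c + e -> `|q.[x]| <= B * e /\ `|q^`().[x]| <= B * e &
        forall x, c + e <= x <= 1 -> `|G.[x] - q.[x]| <= 8 * (B * e) /\
          `|G^`().[x] - q^`().[x]| <= 4 * (B * e)].
Proof.
move=> c0 e0 ce1 B0 qc q'c qB hT.
have [G1 [dG1 G10]] := poly_primitive R (q^`()^`() * T).
have [G [dG G0]] := poly_primitive R G1.
have c1 : c <= 1 by apply: le_trans ce1; rewrite lerDl ltW.
have e1 : e <= 1 by apply: le_trans ce1; rewrite lerDr ltW.
(* Every bound is a multiple of [K]: [|G''| <= B e] below [c], [|G''| <= B] on a layer of width [e],
   and [|G'' - q''| <= B e] above it. Integrating twice over lengths at most 1 accumulates the
   constants. *)
pose K := B * e; have K0 : 0 <= K by rewrite mulr_ge0 // ltW.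
have G2 (x : R) : G^`()^`().[x] = q^`()^`().[x] * T.[x] by rewrite dG dG1 hornerM.
have dsub (f g : {poly R}) (x : R) : (f - g).[x] = f.[x] - g.[x].
  by rewrite hornerD hornerN.
have lo1 (x : R) : 0 <= x <= c -> `|G^`().[x]| <= K.
  move=> /andP[x0 xc]; rewrite -[K]mulr1 -[K * 1]add0r.
  apply: (poly_growth R _ 0) => //; first by rewrite subr0 (le_trans xc).
    by rewrite dG G10 normr0.
  move=> z /andP[z0 zx]; have zc := le_trans zx xc.
  have z01 : 0 <= z <= 1 by rewrite z0 (le_trans zc).
  have [t0 _ tl _] := hT z z01; rewrite G2 normrM (ger0_norm t0).
  by rewrite ler_pM // ?qB // tl.
have lo0 (x : R) : 0 <= x <= c -> `|G.[x]| <= K.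
  move=> /andP[x0 xc]; rewrite -[K]mulr1 -[K * 1]add0r.
  apply: (poly_growth R _ 0) => //; first by rewrite subr0 (le_trans xc).
    by rewrite G0 normr0.
  by move=> z /andP[z0 zx]; apply: lo1; rewrite z0 (le_trans zx).
have cc : 0 <= c <= c by rewrite ltW /=.
have sub1 (z x : R) : c <= z <= x -> x <= c + e -> 0 <= z <= 1.
  move=> /andP[cz zx] xe; rewrite (le_trans (ltW c0) cz).
  by rewrite (le_trans zx) // (le_trans xe).
have mid1 (x : R) : c <= x <= c + e -> `|G^`().[x]| <= 2 * K.
  move=> /andP[cx xe]; rewrite mulr_natl mulr2n {2}/K.
  apply: (poly_growth R _ c) => //; first by rewrite lerBlDl.
    exact: lo1.
  move=> z zcx; have z01 := sub1 z x zcx xe.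
  have [t0 t1 _ _] := hT z z01; rewrite G2 normrM (ger0_norm t0).
  by rewrite -[B]mulr1 ler_pM // qB.
have mid0 (x : R) : c <= x <= c + e -> `|G.[x]| <= 3 * K.
  move=> /andP[cx xe].
  have -> : 3 * K = K + (2 * K) * 1 by ring.
  apply: (poly_growth R _ c) => //; first by rewrite mulr_ge0.
  - by rewrite lerBlDl (le_trans xe) // lerD2l.
  - exact: lo0.
  - by move=> z /andP[z0 zx]; apply: mid1; rewrite z0 (le_trans zx).
have q1 (x : R) : c <= x <= c + e -> `|q^`().[x]| <= K.
  move=> /andP[cx xe]; rewrite -[K]add0r {1}/K.
  apply: (poly_growth R _ c) => //; first by rewrite lerBlDl.
    by rewrite q'c normr0.
  by move=> z zcx; apply: qB; exact: sub1 zcx xe.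
have q0 (x : R) : c <= x <= c + e -> `|q.[x]| <= K.
  move=> /andP[cx xe]; rewrite -[K]mulr1 -[K * 1]add0r.
  apply: (poly_growth R _ c) => //; first by rewrite lerBlDl (le_trans xe) // lerD2l.
    by rewrite qc normr0.
  by move=> z /andP[z0 zx]; apply: q1; rewrite z0 (le_trans zx).
have ce : c <= c + e <= c + e by rewrite lexx lerDl ltW.
have xce (x : R) : x <= 1 -> x - (c + e) <= 1.
  by move=> x1; rewrite lerBlDl (le_trans x1) // lerDr addr_ge0 // ltW.
have hi1 (x : R) : c + e <= x <= 1 -> `|G^`().[x] - q^`().[x]| <= 4 * K.
  move=> /andP[cx x1]; rewrite -dsub.
  have -> : 4 * K = 3 * K + K * 1 by ring.
  apply: (poly_growth R _ (c + e)) => //; first exact: xce.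
    rewrite dsub; apply: le_trans (ler_normB _ _) _.
    have -> : 3 * K = 2 * K + K by ring.
    by rewrite lerD ?mid1 ?q1.
  move=> z /andP[cz zx]; rewrite derivB dsub G2.
  rewrite -{2}[_.[z]]mulr1 -mulrBr normrM.
  have z01 : 0 <= z <= 1.
    by rewrite (le_trans zx x1) andbT (le_trans _ cz) // addr_ge0 // ltW.
  have [t0 t1 _ t2] := hT z z01.
  rewrite ler_pM // ?qB // distrC ger0_norm ?subr_ge0 // lerBlDl -lerBlDr.
  exact: t2.
have hi0 (x : R) : c + e <= x <= 1 -> `|G.[x] - q.[x]| <= 8 * K.
  move=> /andP[cx x1]; rewrite -dsub.
  have -> : 8 * K = 4 * K + 4 * K * 1 by ring.
  apply: (poly_growth R _ (c + e)) => //; first by rewrite mulr_ge0.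
  - exact: xce.
  - rewrite dsub; apply: le_trans (ler_normB _ _) _.
    have -> : 4 * K = 3 * K + K by ring.
    by rewrite lerD ?mid0 ?q0.
  - move=> z /andP[cz zx]; rewrite derivB dsub.
    by apply: hi1; rewrite cz (le_trans zx).
exists G; split=> // x hx; split.
- exact: lo0.
- exact: lo1.
- exact: mid0.
- exact: mid1.
- exact: q0.
- exact: q1.
- exact: hi0.
- exact: hi1.
Qed.

Definition truncated (R : realType) (c : R) (q : {poly R}) (s : R) : R :=
  if s <= c then 0 else q.[s].

(** The next three bounds control [L G + lam G = u + w G' + lam G] with [w = b - (a + b) s], one
    region at a time. The weights 1, 4, 8 are those required above the layer; they are used in all
    regions so that one constant corrects them all. *)
Lemma below_layer_bound (R : realType) (A lam K u w g1 g0 : R) : 0 < lam ->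
  `|w| <= A -> `|u| <= K -> `|g1| <= K -> `|g0| <= K ->
  0 <= K ->
  - (K + 4 * (A * K) + 8 * (lam * K)) <= u + w * g1 + lam * g0.
Proof.
move=> l0 wA uK g1K g0K K0.
have h1 : `|w * g1| <= A * K by rewrite normrM ler_pM.
have h2 : `|lam * g0| <= lam * K.
  by rewrite normrM (gtr0_norm l0); apply: ler_wpM2l => //; exact: ltW.
have h3 : 0 <= A * K by rewrite mulr_ge0 // (le_trans _ wA).
have h4 : 0 <= lam * K by rewrite mulr_ge0 // ltW.
move: uK h1 h2; rewrite !ler_norml.
by move: (w * g1) (lam * g0) (A * K) (lam * K) h3 h4 => *; lra.
Qed.

(** In the layer [G''] is not small, but the equation of [q] turns [s (1 - s) q'' t] into [t lam]
    minus small terms, and [t lam] has the right sign. *)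
Lemma in_layer_bound (R : realType) (A lam K t w g1 g0 q1 q0 : R) : 0 < lam ->
  `|w| <= A -> 0 <= t <= 1 -> `|g1| <= 2 * K -> `|g0| <= 3 * K ->
  `|q1| <= K -> `|q0| <= K -> 0 <= K ->
  - (K + 4 * (A * K) + 8 * (lam * K)) <=
    t * (lam - w * q1 - lam * q0) + w * g1 + lam * g0.
Proof.
move=> l0 wA /andP[t0 t1] g1K g0K q1K q0K K0.
have lM (y L : R) : `|y| <= L -> `|lam * y| <= lam * L.
  by move=> yL; rewrite normrM (gtr0_norm l0); apply: ler_wpM2l => //; exact: ltW.
have wM (y L : R) : `|y| <= L -> `|w * y| <= A * L.
  by move=> yL; rewrite normrM ler_pM.
have h1 := wM _ _ g1K; have h2 := lM _ _ g0K.
have h3 : 0 <= A * K by rewrite mulr_ge0 // (le_trans _ wA).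
have h4 : 0 <= lam * K by rewrite mulr_ge0 // ltW.
have h5 : `|t * (w * q1 + lam * q0)| <= A * K + lam * K.
  rewrite normrM (ger0_norm t0) -[leRHS]mul1r ler_pM ?normr_ge0 //.
  by apply: le_trans (ler_normD _ _) _; rewrite lerD ?wM ?lM.
have h6 : 0 <= t * lam by rewrite mulr_ge0 // ltW.
have -> : t * (lam - w * q1 - lam * q0) = t * lam - t * (w * q1 + lam * q0) by ring.
have e1 : A * (2 * K) = 2 * (A * K) by ring.
have e2 : lam * (3 * K) = 3 * (lam * K) by ring.
rewrite e1 in h1; rewrite e2 in h2.
move: h1 h2 h5; rewrite !ler_norml; clear -K0 h3 h4 h6.
move: (w * g1) (lam * g0) (A * K) (lam * K) (t * lam) (t * _) h3 h4 h6 => *; lra.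
Qed.

(** The right side is [L G + lam G - lam]: subtracting the equation of [q] leaves
    [u = s (1 - s) q'' (1 - T)], [d1 = G' - q'] and [d0 = G - q]. *)
Lemma above_layer_bound (R : realType) (A lam K u w d1 d0 : R) : 0 < lam ->
  `|w| <= A -> `|u| <= K -> `|d1| <= 4 * K -> `|d0| <= 8 * K -> 0 <= K ->
  - (K + 4 * (A * K) + 8 * (lam * K)) <= - u + w * d1 + lam * d0.
Proof.
move=> l0 wA uK d1K d0K K0.
have h1 : `|w * d1| <= 4 * (A * K).
  have -> : 4 * (A * K) = A * (4 * K) by ring.
  by rewrite normrM ler_pM.
have h2 : `|lam * d0| <= 8 * (lam * K).
  rewrite normrM (gtr0_norm l0).
  have -> : 8 * (lam * K) = lam * (8 * K) by ring.
  by apply: ler_wpM2l => //; exact: ltW.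
move: uK h1 h2; rewrite !ler_norml; clear.
by move: (w * d1) (lam * d0) (A * K) (lam * K) => *; lra.
Qed.

(** The smoothed [G] satisfies both sign conditions only up to a multiple of [e]. A constant [k] is
    killed by [L], so adding it raises [L G + lam G] by [lam k] and makes both conditions exact,
    while [k] itself is of order [e]. *)
Lemma truncated_approx (R : realType) (a b lam c : R) (q : {poly R}) :
  0 < a -> 0 < b -> 0 < lam -> 0 < c < 1 ->
  q.[c] = 0 -> q^`().[c] = 0 -> (forall s, c <= s <= 1 -> 0 <= q.[s]) ->
  jacobi_op R a b q + lam *: q = lam%:P ->
  exists2 C : R, 0 <= C & forall e : R, 0 < e -> c + e <= 1 ->
    exists G : {poly R}, forall s : R, 0 <= s <= 1 ->
    [/\ 0 <= G.[s], 0 <= (jacobi_op R a b G + lam *: G).[s],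
        G.[s] <= truncated R c q s + C * e &
        lam * truncated R c q s - C * e
          <= G.[s] * (jacobi_op R a b G + lam *: G).[s] ].
Proof.
move=> a0 b0 lam0 /andP[c0 c1] qc q'c qpos Lq.
have [B B0 hB] := poly_bounded01 R q^`()^`().
pose A := a + b; have A0 : 0 < A by rewrite addr_gt0.
pose D := 1 + 4 * A + 8 * lam.
have D0 : 0 < D by rewrite /D; clearbody A; lra.
have M0 : 0 <= 16 * B + D * B / lam + lam * B.
  have h1 : 0 <= D * B / lam by rewrite divr_ge0 ?(ltW lam0) // mulr_ge0 // ltW.
  have h2 : 0 <= lam * B by rewrite mulr_ge0 // ltW.
  by rewrite !addr_ge0 // mulr_ge0.
exists (16 * B + D * B / lam + lam * B) => // e e0 ce1.
have [T hT] := step_polynomial R c e c0 e0 ce1.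
have [G [G2 lo mid midq hi]] :=
  smoothed_truncation R c e B q T c0 e0 ce1 B0 qc q'c hB hT.
pose K := B * e; have K0 : 0 <= K by rewrite mulr_ge0 // ltW.
(* The part [8 K] makes the sum nonnegative, and at least [q] above the layer; the part [D K / lam]
   offsets the lower bound [- D K] of the three regions. *)
pose k := 8 * K + D * K / lam.
have Kk : 8 * K <= k 
  by rewrite lerDl; exact: divr_ge0 (mulr_ge0 (ltW D0) K0) (ltW lam0).
have lkE : D * K <= lam * k.
  rewrite /k mulrDr [lam * (_ / _)]mulrCA divff ?gt_eqF // mulr1 lerDr.
  by rewrite !mulr_ge0 // ltW.
have DE : D * K = K + 4 * (A * K) + 8 * (lam * K) by rewrite /D; ring.
have lK0 : 0 <= lam * K by rewrite mulr_ge0 // ltW.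
have CE : (16 * B + D * B / lam + lam * B) * e = 8 * K + k + lam * K.
  by rewrite /k /K; ring.
have Ce0 : 0 <= 8 * K + k + lam * K by rewrite -CE mulr_ge0 // ltW.
exists (G + k%:P) => s s01; have /andP[s0 s1] := s01.
have [t0 t1 tlo thi] := hT s s01.
pose w := b - A * s.
have wA : `|w| <= A.
  have As : 0 <= A * s <= A by rewrite mulr_ge0 ?(ltW A0) // ler_piMr // ltW.
  have bA : b <= A by rewrite lerDr ltW.
  rewrite /w; move: (A * s) As => z; clearbody A; clear -bA b0 => /andP[? ?].
  by rewrite ler_norml; apply/andP; split; lra.
pose u := s * (1 - s) * (q^`()^`().[s] * T.[s]).
have XE : (jacobi_op R a b (G + k%:P) + lam *: (G + k%:P)).[s] =
    u + w * G^`().[s] + lam * G.[s] + lam * k.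
  rewrite hornerD hornerZ horner_jacobi_op derivD derivC addr0 G2 hornerD hornerC.
  by rewrite /u /w /A; ring.
have Lqs : s * (1 - s) * q^`()^`().[s] = lam - w * q^`().[s] - lam * q.[s].
  have : (jacobi_op R a b q + lam *: q).[s] = lam by rewrite Lq hornerC.
  rewrite hornerD hornerZ horner_jacobi_op => h.
  transitivity (s * (1 - s) * q^`()^`().[s] + (b - (a + b) * s) * q^`().[s] +
    lam * q.[s] - w * q^`().[s] - lam * q.[s]); last by rewrite h.
  by rewrite /w /A; ring.
have ss : 0 <= s * (1 - s) <= 1.
  have s1' : 0 <= 1 - s by rewrite subr_ge0.
  by rewrite mulr_ge0 // mulr_ile1 // gerBl.
have uM (y : R) : `|y| <= K -> `|s * (1 - s) * y| <= K.
  move/andP: ss => [z0 z1] yK.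
  by rewrite normrM (ger0_norm z0) -[leRHS]mul1r ler_pM.
rewrite XE CE hornerD hornerC /truncated.
set X := u + _ + _ + _.
case: (leP s c) => [sc|cs].
  have [g0 g1] := lo s (introT andP (conj s0 sc)).
  have uK : `|u| <= K.
    by apply: uM; rewrite normrM (ger0_norm t0) ler_pM // ?hB // tlo.
  have X0 : 0 <= X.
    have := below_layer_bound R A lam K u w _ _ lam0 wA uK g1 g0 K0.
    rewrite -DE => h; apply: le_trans (lerD h lkE).
    by rewrite addNr.
  have G0 : 0 <= G.[s] + k.
    by move: g0; rewrite -/K ler_norml => /andP[h _]; clear -h Kk K0; lra.
  split=> //.
    move: g0; rewrite -/K ler_norml => /andP[_ h].
    by clear -h lK0 K0; lra.
  by rewrite mulr0 sub0r (le_trans _ (mulr_ge0 G0 X0)) // oppr_le0.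
have qs0 : 0 <= q.[s] by apply: qpos; rewrite (ltW cs).
case: (leP s (c + e)) => [sce|ces].
  have cse : c <= s <= c + e by rewrite (ltW cs).
  have [g0 g1] := mid s cse; have [r0 r1] := midq s cse.
  have uE : u = T.[s] * (lam - w * q^`().[s] - lam * q.[s]).
    by rewrite -Lqs /u; ring.
  have t01 : 0 <= T.[s] <= 1 by rewrite t0.
  have X0 : 0 <= X.
    have := in_layer_bound R A lam K _ w _ _ _ _ lam0 wA t01 g1 g0 r1 r0 K0.
    rewrite -DE -uE => h; apply: le_trans (lerD h lkE).
    by rewrite addNr.
  have G0 : 0 <= G.[s] + k.
    by move: g0; rewrite -/K ler_norml => /andP[h _]; clear -h Kk K0; lra.
  split=> //.
    move: g0; rewrite -/K ler_norml => /andP[_ h].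
    by clear -h lK0 K0 qs0; lra.
  (* In the layer [q <= K], so the quantity to be dominated is already nonpositive. *)
  apply: le_trans (mulr_ge0 G0 X0); rewrite subr_le0.
  apply: (@le_trans _ _ (lam * K)); last by clear -Kk K0; lra.
  by rewrite ler_wpM2l ?(ltW lam0) // (le_trans (ler_norm _)).
have ce1s : c + e <= s <= 1 by rewrite (ltW ces).
have [g0 g1] := hi s ce1s.
have uK : `|s * (1 - s) * (q^`()^`().[s] * (1 - T.[s]))| <= K.
  apply: uM; rewrite normrM ler_pM ?hB // ger0_norm ?subr_ge0 //.
  by rewrite lerBlDl -lerBlDr; apply: thi; exact: ltW.
have Xlam : lam <= X.
  have := above_layer_bound R A lam K _ w _ _ lam0 wA uK g1 g0 K0.
  rewrite -DE => h; rewrite -subr_ge0.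
  apply: le_trans (_ : 0 <= - (D * K) + lam * k) _; first by rewrite addrC subr_ge0.
  apply: le_trans (lerD h (lexx (lam * k))) _.
  have -> : X - lam = X - (s * (1 - s) * q^`()^`().[s] + w * q^`().[s] + lam * q.[s]).
    by rewrite Lqs; congr (X - _); ring.
  by rewrite le_eqVlt; apply/orP; left; apply/eqP; rewrite /X /u; ring.
have Gq : q.[s] <= G.[s] + k.
  by move: g0; rewrite -/K ler_norml => /andP[h _]; clear -h Kk K0; lra.
have G0 : 0 <= G.[s] + k := le_trans qs0 Gq.
have X0 : 0 <= X := le_trans (ltW lam0) Xlam.
split=> //.
  move: g0; rewrite -/K ler_norml => /andP[_ h].
  by clear -h lK0 K0; lra.
apply: (@le_trans _ _ (q.[s] * lam)).
  by rewrite mulrC gerBl.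
by rewrite ler_pM // ltW.
Qed.

(** * Eigenpolynomials of the Jacobi operator *)

Definition jacobi_eigenvalue (R : realType) (a b : R) (l : nat) : R :=
  l%:R * (l%:R - 1 + a + b).

(** In the monomial basis the operator is bidiagonal, and its diagonal shows the eigenvalues. *)
Lemma coef_jacobi_op (R : realType) (a b : R) (f : {poly R}) i :
  (jacobi_op R a b f)`_i = i.+1%:R * (i%:R + b) * f`_i.+1 -
    jacobi_eigenvalue R a b i * f`_i.
Proof.
have -> : jacobi_op R a b f = 'X * f^`()^`() - 'X * ('X * f^`()^`()) +
    b *: f^`() - (a + b) *: ('X * f^`()).
  by rewrite /jacobi_op -!mul_polyC; ring.
rewrite !(coefD, coefN, coefZ, coefXM, coef_deriv) /jacobi_eigenvalue.
case: i => [|[|i]] /=; rewrite -?(mulr_natr f`_(_)) -?(mulr_natr (_ * _));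
  rewrite -?[i.+3%:R]natr1 -?[i.+2%:R]natr1 -?[i.+1%:R]natr1; ring.
Qed.

Lemma jacobi_opD (R : realType) (a b : R) (f g : {poly R}) :
  jacobi_op R a b (f + g) = jacobi_op R a b f + jacobi_op R a b g.
Proof. by rewrite /jacobi_op !derivD; ring. Qed.

Lemma jacobi_opZ (R : realType) (a b c : R) (f : {poly R}) :
  jacobi_op R a b (c *: f) = c *: jacobi_op R a b f.
Proof. by rewrite /jacobi_op !derivZ -!mul_polyC; ring. Qed.

Lemma jacobi_eigenvalue_lt (R : realType) (a b : R) i l : 0 < a -> 0 < b ->
  (i < l)%N -> jacobi_eigenvalue R a b i < jacobi_eigenvalue R a b l.
Proof.
move=> a0 b0 il; rewrite /jacobi_eigenvalue.
have : i.+1%:R <= l%:R :> R by rewrite ler_nat.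
rewrite -natr1; have : 0 <= i%:R :> R by rewrite ler0n.
move: i%:R l%:R => x y x0 xy; rewrite -subr_gt0.
have -> : y * (y - 1 + a + b) - x * (x - 1 + a + b) =
  (y - x) * (y + x - 1 + a + b) by ring.
by rewrite mulr_gt0; lra.
Qed.

(** On polynomials of size at most [n <= l] the operator is triangular with diagonal entries the
    eigenvalue of [l] minus those of smaller degrees, all nonzero. The induction removes the top
    coefficient. *)
Lemma jacobi_op_solve (R : realType) (a b : R) (l n : nat) (f : {poly R}) :
  0 < a -> 0 < b -> (n <= l)%N -> (size f <= n)%N ->
  exists h : {poly R}, (size h <= n)%N /\
    jacobi_op R a b h + jacobi_eigenvalue R a b l *: h = f.
Proof.
move=> a0 b0; elim: n f => [|n ih] f nl sf.
  exists 0; rewrite size_poly0; split=> //.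
  move: sf; rewrite leqn0 size_poly_eq0 => /eqP ->.
  by rewrite /jacobi_op !deriv0 !mulr0 scaler0 !addr0.
have ev : jacobi_eigenvalue R a b l - jacobi_eigenvalue R a b n != 0.
  by rewrite gt_eqF // subr_gt0 jacobi_eigenvalue_lt.
pose c := f`_n / (jacobi_eigenvalue R a b l - jacobi_eigenvalue R a b n).
pose g := f - (jacobi_op R a b (c *: 'X^n) + jacobi_eigenvalue R a b l *: (c *: 'X^n)).
have sg : (size g <= n)%N.
  apply/leq_sizeP => j nj.
  rewrite /g coefB coefD coef_jacobi_op !coefZ !coefXn gtn_eqF ?ltnS //.
  move: nj; rewrite leq_eqVlt => /predU1P[<-|nj].
    by rewrite eqxx /c !mulr1 !mulr0 sub0r; field.
  rewrite gtn_eqF // !mulr0 subrr addr0 subr0 nth_default //.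
  exact: leq_trans sf nj.
have [h [sh eh]] := ih g (ltnW nl) sg.
exists (h + c *: 'X^n); split.
  rewrite (leq_trans (size_polyD _ _)) // geq_max (leqW sh) /=.
  by rewrite (leq_trans (size_scale_leq _ _)) // size_polyXn.
by rewrite jacobi_opD scalerDr addrACA eh /g addrNK.
Qed.

(** Applied to ['X^l], the shifted operator leaves a remainder of degree below [l];
    [jacobi_op_solve] provides the lower-degree correction that cancels it. *)
Lemma jacobi_eigenpoly (R : realType) (a b : R) (l : nat) : 0 < a -> 0 < b ->
  exists p : {poly R}, [/\ p \is monic, size p = l.+1 &
    jacobi_op R a b p = - jacobi_eigenvalue R a b l *: p].
Proof.
move=> a0 b0; pose L := jacobi_eigenvalue R a b l.
pose f := jacobi_op R a b 'X^l + L *: 'X^l.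
have sf : (size f <= l)%N.
  apply/leq_sizeP => j lj; rewrite /f coefD coef_jacobi_op coefZ !coefXn.
  rewrite gtn_eqF ?ltnS //; move: lj; rewrite leq_eqVlt => /predU1P[<-|lj].
    rewrite eqxx -/L !mulr0 !mulr1 sub0r addNr //.
  by rewrite gtn_eqF // !mulr0 subrr addr0.
have [h [sh eh]] := jacobi_op_solve R a b l l f a0 b0 (leqnn l) sf.
have sp : size ('X^l - h) = l.+1.
  by rewrite size_polyDl ?size_polyXn // size_polyN ltnS.
exists ('X^l - h); split=> //.
  apply/monicP; rewrite lead_coefDl ?lead_coefXn //.
  by rewrite size_polyXn size_polyN ltnS.
have -> : 'X^l - h = 'X^l + (-1) *: h by rewrite scaleN1r.
rewrite -/L; apply/eqP; rewrite [- L *: _]scaleNr -addr_eq0; apply/eqP.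
by rewrite jacobi_opD jacobi_opZ !scaleN1r scalerBr addrACA -opprD -/f eh subrr.
Qed.

Lemma monic_basis (R : realType) (p : nat -> {poly R}) :
  (forall l, p l \is monic) -> (forall l, size (p l) = l.+1) ->
  forall n (f : {poly R}), (size f <= n)%N ->
  exists c : nat -> R, f = \sum_(l < n) c l *: p l.
Proof.
move=> pm sp; elim=> [|n ih] f sf.
  exists (fun=> 0); move: sf; rewrite leqn0 size_poly_eq0 => /eqP ->.
  by rewrite big_ord0.
pose g := f - f`_n *: p n.
have sg : (size g <= n)%N.
  apply/leq_sizeP => j; rewrite /g leq_eqVlt coefB coefZ => /predU1P[<-|nj].
    have /monicP := pm n; rewrite lead_coefE sp /= => ->.
    by rewrite mulr1 subrr.
  have -> : f`_j = 0 by apply: nth_default; exact: leq_trans sf nj.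
  have -> : (p n)`_j = 0 by apply: nth_default; rewrite sp.
  by rewrite mulr0 subr0.
have [c ec] := ih _ sg.
exists (fun l => if l == n then f`_n else c l).
rewrite big_ord_recr /= eqxx -[LHS](subrK (f`_n *: p n)) -/g ec.
by congr (_ + _); apply: eq_bigr => i _; rewrite ltn_eqF.
Qed.

(** * Means over the sphere and rotations *)

Definition mean (R : realType) (N : nat) (sigma : probability (N.-tuple R) R)
  (U : N.-tuple R -> R) : R := \int[sigma]_(y in sphere R N) U y.
Arguments mean {R N} sigma U.

(** Boundedness is asked on the sphere only, so that polynomial functions qualify; this is enough
    for integrability there. *)
Definition bmeas (R : realType) (N : nat) (U : N.-tuple R -> R) : Prop :=
  measurable_fun setT U /\ exists M, forall y, sphere R N y -> `|U y| <= M.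
Arguments bmeas {R N} U.

Lemma measurable_sphere (R : realType) (N : nat) : measurable (sphere R N).
Proof.
have mf : measurable_fun setT (fun y : N.-tuple R => \sum_(i < N) tnth y i ^+ 2).
  by apply: measurable_sum => i; apply: measurable_funX; exact: measurable_tnth.
have := mf measurableT [set 1] (measurable_set1 1).
by rewrite setTI; congr measurable; apply/seteqP; split.
Qed.

Lemma bmeas_integrable (R : realType) (N : nat) (sigma : probability (N.-tuple R) R)
  (U : N.-tuple R -> R) : bmeas U -> sigma.-integrable (sphere R N) (EFin \o U).
Proof.
move=> [mU [M hM]]; apply: measurable_bounded_integrable.
- exact: measurable_sphere.
- rewrite (le_lt_trans (probability_le1 _ _)) ?ltry //; exact: measurable_sphere.
- exact: measurable_funTS.
- exists M; split; rewrite ?num_real // => z Mz y Sy /=.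
  by rewrite (le_trans (hM y Sy)) // ltW.
Qed.

Lemma bmeas_cst (R : realType) (N : nat) (c : R) : bmeas (fun=> c : R) (N := N).
Proof. by split; [exact: measurable_cst|exists `|c|]. Qed.

Lemma bmeasD (R : realType) (N : nat) (U V : N.-tuple R -> R) :
  bmeas U -> bmeas V -> bmeas (fun y => U y + V y).
Proof.
move=> [mU [M hM]] [mV [L hL]]; split; first exact: measurable_funD.
exists (M + L) => y Sy; rewrite (le_trans (ler_normD _ _)) // lerD //.
  exact: hM.
exact: hL.
Qed.

Lemma bmeasM (R : realType) (N : nat) (U V : N.-tuple R -> R) :
  bmeas U -> bmeas V -> bmeas (fun y => U y * V y).
Proof.
move=> [mU [M hM]] [mV [L hL]]; split; first exact: measurable_funM.
exists (M * L) => y Sy; rewrite normrM ler_pM //; first exact: hM.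
exact: hL.
Qed.

Lemma bmeasZ (R : realType) (N : nat) (c : R) (U : N.-tuple R -> R) :
  bmeas U -> bmeas (fun y => c * U y).
Proof. by move=> bU; apply: bmeasM => //; exact: bmeas_cst. Qed.

Lemma bmeas_sum (R : realType) (N : nat) (I : Type) (r : seq I) (P : pred I)
  (U : I -> N.-tuple R -> R) : (forall i, P i -> bmeas (U i)) ->
  bmeas (fun y => \sum_(i <- r | P i) U i y).
Proof.
move=> bU; elim: r => [|i r ih].
  by under eq_fun do rewrite big_nil; exact: bmeas_cst.
have [Pi|Pi] := boolP (P i); last by under eq_fun do rewrite big_cons (negPf Pi).
by under eq_fun do rewrite big_cons Pi; apply: bmeasD => //; exact: bU.
Qed.

Lemma sphere_coord_le1 (R : realType) (N : nat) (y : N.-tuple R) i :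
  sphere R N y -> `|tnth y i| <= 1.
Proof.
move=> Sy; rewrite -(@ler_pXn2r _ 2) ?nnegrE //.
rewrite expr1n -normrX ger0_norm ?sqr_ge0 // -Sy (bigD1 i) //=.
by rewrite lerDl sumr_ge0 // => j _; exact: sqr_ge0.
Qed.

Lemma bmeas_coord (R : realType) (N : nat) (i : 'I_N) :
  bmeas (fun y : N.-tuple R => tnth y i).
Proof.
split; first exact: measurable_tnth.
by exists 1 => y; exact: sphere_coord_le1.
Qed.

Lemma bmeas_horner (R : realType) (N : nat) (p : {poly R}) (U : N.-tuple R -> R) :
  bmeas U -> bmeas (fun y => p.[U y]).
Proof.
move=> bU; elim/poly_ind: p => [|p c ih].
  by under eq_fun do rewrite horner0; exact: bmeas_cst.
under eq_fun do rewrite hornerMXaddC.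
by apply: bmeasD; [exact: bmeasM|exact: bmeas_cst].
Qed.

Lemma meanD (R : realType) (N : nat) (sigma : probability (N.-tuple R) R)
  (U V : N.-tuple R -> R) : bmeas U -> bmeas V ->
  mean sigma (fun y => U y + V y) = mean sigma U + mean sigma V.
Proof.
move=> bU bV; apply: RintegralD; first exact: measurable_sphere.
  exact: bmeas_integrable.
exact: bmeas_integrable.
Qed.

Lemma meanZ (R : realType) (N : nat) (sigma : probability (N.-tuple R) R)
  (c : R) (U : N.-tuple R -> R) : bmeas U ->
  mean sigma (fun y => c * U y) = c * mean sigma U.
Proof.
move=> bU; apply: RintegralZl; first exact: measurable_sphere.
exact: bmeas_integrable.
Qed.

Lemma mean_sum (R : realType) (N : nat) (sigma : probability (N.-tuple R) R)
  (I : Type) (r : seq I) (P : pred I) (U : I -> N.-tuple R -> R) :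
  (forall i, P i -> bmeas (U i)) ->
  mean sigma (fun y => \sum_(i <- r | P i) U i y) =
  \sum_(i <- r | P i) mean sigma (U i).
Proof.
move=> bU; elim: r => [|i r ih].
  rewrite big_nil /mean; under eq_Rintegral do rewrite big_nil.
  by rewrite Rintegral_cst ?mul0r //; exact: measurable_sphere.
rewrite big_cons -ih; case: ifPn => Pi.
  rewrite -meanD //; [|exact: bU|exact: bmeas_sum].
  by rewrite /mean; under eq_Rintegral do rewrite big_cons Pi.
by rewrite /mean; under eq_Rintegral do rewrite big_cons (negPf Pi).
Qed.

Lemma le_mean (R : realType) (N : nat) (sigma : probability (N.-tuple R) R)
  (U V : N.-tuple R -> R) : bmeas U -> bmeas V ->
  (forall y, sphere R N y -> U y <= V y) -> mean sigma U <= mean sigma V.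
Proof.
move=> bU bV UV; apply: le_Rintegral => //; first exact: measurable_sphere.
  exact: bmeas_integrable.
exact: bmeas_integrable.
Qed.

Lemma eq_mean (R : realType) (N : nat) (sigma : probability (N.-tuple R) R)
  (U V : N.-tuple R -> R) : (forall y, sphere R N y -> U y = V y) ->
  mean sigma U = mean sigma V.
Proof. by move=> UV; apply: eq_Rintegral => y /set_mem; exact: UV. Qed.

Lemma mean_cst (R : realType) (N : nat) (sigma : probability (N.-tuple R) R) (c : R) :
  normalized_rotation_invariant R N sigma -> mean sigma (fun=> c) = c.
Proof.
move=> [s0 _]; rewrite /mean Rintegral_cst; last exact: measurable_sphere.
have mS := measurable_sphere R N.
have [r e] : exists r : R, sigma (sphere R N) = r%:E.
  by exists (fine (sigma (sphere R N))); rewrite fineK // fin_num_measure.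
have r1 : r = 1.
  by have := probability_setC sigma mS; rewrite s0 e => -[] /esym /eqP;
    rewrite subr_eq0 => /eqP.
transitivity (c * fine (sigma (sphere R N))) => //.
by rewrite e r1 mulr1.
Qed.

Lemma sphere_rotate (R : realType) (N : nat) (Q : 'M[R]_N) (y : N.-tuple R) :
  Q *m Q^T = 1%:M -> sphere R N y -> sphere R N (rotate R N Q y).
Proof.
move=> /mulmx1C QQ; rewrite /sphere /= => Sy.
pose v : 'cV[R]_N := \col_i tnth y i.
have e (w : 'cV[R]_N) : (w^T *m w) 0 0 = \sum_(i < N) w i 0 ^+ 2.
  by rewrite !mxE; apply: eq_bigr => i _; rewrite !mxE expr2.
have := e (Q *m v); rewrite trmx_mul -mulmxA (mulmxA Q^T) QQ mul1mx e.
have ev i : v i 0 = tnth y i by rewrite mxE.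
rewrite [X in X = _](_ : _ = 1); last first.
  by rewrite -[RHS]Sy; apply: eq_bigr => i _; rewrite ev.
move=> ->; apply: eq_bigr => i _; rewrite tnth_mktuple mxE.
by congr (_ ^+ 2); apply: eq_bigr => j _; rewrite ev.
Qed.

Lemma measurable_rotate (R : realType) (N : nat) (Q : 'M[R]_N) :
  measurable_fun setT (rotate R N Q).
Proof.
apply/measurable_fun_tnthP => i.
rewrite (_ : _ \o _ = fun y : N.-tuple R => \sum_(j < N) Q i j * tnth y j).
  apply: measurable_sum => j; apply: measurable_funM; first exact: measurable_cst.
  exact: measurable_tnth.
by apply/funext => y /=; rewrite tnth_mktuple.
Qed.

Lemma bmeas_rotate (R : realType) (N : nat) (Q : 'M[R]_N) (U : N.-tuple R -> R) :
  Q *m Q^T = 1%:M -> bmeas U -> bmeas (U \o rotate R N Q).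
Proof.
move=> QQ [mU [M hM]]; split.
  by apply: measurableT_comp => //; exact: measurable_rotate.
by exists M => y Sy; apply: hM; exact: sphere_rotate.
Qed.

Lemma mean_rotate (R : realType) (N : nat) (sigma : probability (N.-tuple R) R)
  (Q : 'M[R]_N) (U : N.-tuple R -> R) :
  normalized_rotation_invariant R N sigma -> is_rotation R N Q -> bmeas U ->
  mean sigma (U \o rotate R N Q) = mean sigma U.
Proof.
move=> [_ inv] rQ bU; have [QQ _] := rQ.
have mQ := measurable_rotate R N Q.
have -> : mean sigma U =
    fine (\int[pushforward sigma (rotate R N Q)]_(y in sphere R N) (U y)%:E)%E.
  congr fine; apply: eq_measure_integral => A mA _ /=.
  by rewrite /pushforward inv.
have QS : rotate R N Q @^-1` sphere R N = sphere R N.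
  apply/seteqP; split=> y /=; last exact: sphere_rotate.
  move/(sphere_rotate R N Q^T); rewrite trmxK => /(_ (mulmx1C QQ)).
  congr (sphere R N _); apply: eq_from_tnth => i.
  rewrite tnth_mktuple; under eq_bigr do rewrite tnth_mktuple mulr_sumr.
  rewrite exchange_big /= (bigD1 i) //=.
  have e j : \sum_(l < N) Q^T i l * (Q l j * tnth y j) = (i == j)%:R * tnth y j.
    have <- : (Q^T *m Q) i j = (i == j)%:R by rewrite (mulmx1C QQ) mxE.
    by rewrite mxE mulr_suml; apply: eq_bigr => l _; rewrite mulrA.
  rewrite e eqxx mul1r big1 ?addr0 // => j ji.
  by rewrite e eq_sym (negPf ji) mul0r.
rewrite integral_pushforward //=.
- by rewrite QS.
- by apply/measurable_EFinP; case: bU.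
- by rewrite QS; apply: bmeas_integrable; exact: bmeas_rotate.
- exact: measurable_sphere.
Qed.

(** The form [1 + (c - 1) P + s J], with [P] the projector on the plane and [J] its quarter turn,
    reduces products to [P P = P], [P J = J P = J], [J J = - P], that is, to multiplication of
    complex numbers. *)
Definition givens (R : realType) (N : nat) (a b : 'I_N) (c s : R) : 'M[R]_N :=
  1%:M + ((c - 1) *: (delta_mx a a + delta_mx b b) +
          s *: (delta_mx b a - delta_mx a b)).

Lemma givensM (R : realType) (N : nat) (a b : 'I_N) (c s c' s' : R) : a != b ->
  givens R N a b c s *m givens R N a b c' s' =
  givens R N a b (c * c' - s * s') (c * s' + s * c').
Proof.
move=> ab; rewrite /givens.
set P : 'M[R]_N := delta_mx a a + _; set J : 'M[R]_N := _ - _.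
have ba : b != a by rewrite eq_sym.
have PP : P *m P = P.
  rewrite /P mulmxDl !mulmxDr !mul_delta_mx_cond !eqxx (negPf ab) (negPf ba).
  by rewrite !mulr1n !mulr0n addr0 add0r.
have PJ : P *m J = J.
  rewrite /P /J mulmxDl !mulmxBr !mul_delta_mx_cond !eqxx (negPf ab) (negPf ba).
  by rewrite !mulr1n !mulr0n subr0 sub0r addrC.
have JP : J *m P = J.
  rewrite /P /J mulmxDr !mulmxBl !mul_delta_mx_cond !eqxx (negPf ab) (negPf ba).
  by rewrite !mulr1n !mulr0n subr0 sub0r.
have JJ : J *m J = - P.
  rewrite /P /J mulmxBl !mulmxBr !mul_delta_mx_cond !eqxx (negPf ab) (negPf ba).
  by rewrite !mulr1n !mulr0n subr0 sub0r opprD addrC.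
clearbody P J.
rewrite mulmxDl mul1mx mulmxDr mulmx1 !mulmxDl !mulmxDr -!scalemxAl -!scalemxAr.
rewrite PP PJ JP JJ -!addrA; congr (_ + _).
apply/matrixP => i j; rewrite !mxE; ring.
Qed.

Lemma givens_tr (R : realType) (N : nat) (a b : 'I_N) (c s : R) :
  (givens R N a b c s)^T = givens R N a b c (- s).
Proof.
apply/matrixP => i j; rewrite !mxE.
by rewrite ![(j == _) && _]andbC [j == i]eq_sym; ring.
Qed.

Lemma givens_orthogonal (R : realType) (N : nat) (a b : 'I_N) (c s : R) :
  a != b -> c ^+ 2 + s ^+ 2 = 1 ->
  givens R N a b c s *m (givens R N a b c s)^T = 1%:M.
Proof.
move=> ab cs; rewrite givens_tr givensM //.
have -> : c * c - s * - s = 1 by rewrite -cs; ring.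
have -> : c * - s + s * c = 0 by ring.
by rewrite /givens subrr !scale0r !addr0.
Qed.

(* The half-angle rotation squares to the given one, so the determinant is a
   square of [+-1]. *)
Lemma givens_rotation (R : realType) (N : nat) (a b : 'I_N) (t : R) : a != b ->
  is_rotation R N
    (givens R N a b ((1 - t ^+ 2) / (1 + t ^+ 2)) (2 * t / (1 + t ^+ 2))).
Proof.
move=> ab.
have t0 : 0 < 1 + t ^+ 2 by rewrite ltr_pwDl // sqr_ge0.
pose r := Num.sqrt (1 + t ^+ 2).
have r2 : r ^+ 2 = 1 + t ^+ 2 by rewrite sqr_sqrtr // ltW.
have r0 : r != 0 by rewrite sqrtr_eq0 -ltNge.
have hc : (r^-1) ^+ 2 = (1 + t ^+ 2)^-1 by rewrite exprVn r2.
have cs : (r^-1) ^+ 2 + (t / r) ^+ 2 = 1.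
  by rewrite expr_div_n -exprVn hc -[X in X + _]mul1r -mulrDl divff // gt_eqF.
have -> : givens R N a b ((1 - t ^+ 2) / (1 + t ^+ 2)) (2 * t / (1 + t ^+ 2)) =
    givens R N a b r^-1 (t / r) *m givens R N a b r^-1 (t / r).
  rewrite givensM //; congr (givens R N a b _ _).
    by rewrite -!hc; ring.
  by rewrite -!hc; ring.
set G := givens R N a b r^-1 (t / r).
have GG : G *m G^T = 1%:M by exact: givens_orthogonal.
split.
  by rewrite trmx_mul mulmxA -(mulmxA G) GG mulmx1 GG.
by rewrite det_mulmx -{2}[G]trmxK det_tr -det_mulmx GG det1.
Qed.

Lemma rotate_givens (R : realType) (N : nat) (a b : 'I_N) (c s : R)
  (y : N.-tuple R) (i : 'I_N) :
  tnth (rotate R N (givens R N a b c s) y) i =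
  tnth y i + ((c - 1) * ((i == a)%:R * tnth y a + (i == b)%:R * tnth y b) +
              s * ((i == b)%:R * tnth y a - (i == a)%:R * tnth y b)).
Proof.
rewrite tnth_mktuple.
have dE (p q : 'I_N) : \sum_j (delta_mx p q : 'M[R]_N) i j * tnth y j =
    (i == p)%:R * tnth y q.
  rewrite (bigD1 q) //= mxE eqxx andbT big1 ?addr0 // => j jq.
  by rewrite mxE (negPf jq) andbF mul0r.
have d1 : \sum_j (1%:M : 'M[R]_N) i j * tnth y j = tnth y i.
  rewrite (bigD1 i) //= mxE eqxx mul1r big1 ?addr0 // => j ji.
  by rewrite mxE eq_sym (negPf ji) mul0r.
rewrite -d1 -!dE !mulrDr mulrN !mulr_sumr -!sumrN -!big_split /=.
by apply: eq_bigr => j _; rewrite !mxE; ring.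
Qed.

(* [V] is the derivative of [U] along the rotations of the [(a, b)]-plane,
   uniformly on the sphere; the factor 2 comes from the rational
   parametrisation of the circle by [t = tan (theta / 2)]. *)
Definition rot_derivative (R : realType) (N : nat) (a b : 'I_N)
  (U V : N.-tuple R -> R) : Prop :=
  [/\ bmeas U, bmeas V & exists2 C : R, 0 <= C &
   forall (t : R) y, `|t| <= 1 -> sphere R N y ->
   `|U (rotate R N
        (givens R N a b ((1 - t ^+ 2) / (1 + t ^+ 2)) (2 * t / (1 + t ^+ 2))) y)
     - U y - 2 * t * V y| <= C * t ^+ 2].
Arguments rot_derivative {R N} a b U V.

(** Invariance makes [U] composed with the rotation and [U] have the same mean, so [2 t] times the
    mean of [V] is at most [C t ^ 2] in absolute value; then [t] tends to 0. Applied to a product,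
    this is integration by parts on the sphere. *)
Lemma rot_derivative_mean0 (R : realType) (N : nat)
  (sigma : probability (N.-tuple R) R) (a b : 'I_N) (U V : N.-tuple R -> R) :
  normalized_rotation_invariant R N sigma -> a != b ->
  rot_derivative a b U V -> mean sigma V = 0.
Proof.
move=> inv ab [bU bV [C C0 hC]].
have key (t : R) : 0 < t <= 1 -> `|mean sigma V| <= C * t.
  move=> /andP[t0 t1].
  have rot := givens_rotation R N a b t ab.
  have t1' : `|t| <= 1 by rewrite gtr0_norm.
  set Q := givens _ _ _ _ _ _ in rot.
  have bUQ : bmeas (U \o rotate R N Q) by apply: bmeas_rotate bU; case: rot.
  have bN (W : N.-tuple R -> R) : bmeas W -> bmeas (fun y => - 1 * W y) by exact: bmeasZ.
  pose D y := (U (rotate R N Q y) + - 1 * U y) + (- (2 * t)) * V y.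
  have bUU : bmeas (fun y => U (rotate R N Q y) + - 1 * U y).
    by apply: bmeasD => //; exact: bmeasZ.
  have bD : bmeas D by apply: bmeasD => //; exact: bmeasZ.
  have mD : mean sigma D = - (2 * t) * mean sigma V.
    rewrite /D meanD //; last exact: bmeasZ.
    rewrite meanD //; last exact: bmeasZ.
    have e : mean sigma (fun y => U (rotate R N Q y)) = mean sigma U.
      exact: mean_rotate.
    rewrite !meanZ // e.
    by rewrite mulN1r subrr add0r.
  have hD y : sphere R N y -> `|D y| <= C * t ^+ 2.
    by move=> Sy; have := hC t y t1' Sy; rewrite /D mulN1r mulNr.
  have up : mean sigma D <= C * t ^+ 2.
    rewrite -[leRHS](mean_cst R N sigma _ inv); apply: le_mean => //.
      exact: bmeas_cst.
    by move=> y Sy; rewrite (le_trans (ler_norm _)) // hD.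
  have lo : - (C * t ^+ 2) <= mean sigma D.
    rewrite -[leLHS](mean_cst R N sigma _ inv); apply: le_mean => //.
      exact: bmeas_cst.
    by move=> y Sy; have := hD y Sy; rewrite ler_norml => /andP[].
  have : `|mean sigma D| <= C * t ^+ 2 by rewrite ler_norml lo up.
  rewrite mD mulNr normrN normrM (gtr0_norm (_ : 0 < 2 * t)) ?mulr_gt0 // => h.
  rewrite -(ler_pM2l t0).
  have := mulr_ge0 (ltW t0) (normr_ge0 (mean sigma V)).
  by move: `|mean sigma V| h => v h v0; lra.
apply/eqP; rewrite -normr_eq0 eq_le normr_ge0 andbT.
apply/ler_addgt0Pl => e e0; rewrite addr0.
pose t := Num.min 1 (e / (C + 1)).
have C1 : 0 < C + 1 by lra.
have t01 : 0 < t <= 1 by rewrite /t lt_min ltr01 divr_gt0 //= ge_min lexx.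
apply: le_trans (key t t01) _.
apply: (@le_trans _ _ ((C + 1) * t)).
  by rewrite ler_wpM2r //; [case/andP: t01 => /ltW|lra].
by rewrite mulrC -ler_pdivlMr // /t ge_min lexx orbT.
Qed.

Lemma rot_derivative_ext (R : realType) (N : nat) (a b : 'I_N)
  (U U' V V' : N.-tuple R -> R) : U =1 U' -> V =1 V' ->
  rot_derivative a b U V -> rot_derivative a b U' V'.
Proof. by move=> /funext -> /funext ->. Qed.

Lemma rot_derivative_cst (R : realType) (N : nat) (a b : 'I_N) (c : R) :
  rot_derivative a b (fun=> c) (fun=> 0).
Proof.
split; [exact: bmeas_cst|exact: bmeas_cst|exists 0 => // t y _ _].
by rewrite subrr mulr0 subr0 normr0 mul0r.
Qed.

Lemma rot_derivativeD (R : realType) (N : nat) (a b : 'I_N)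
  (U V U' V' : N.-tuple R -> R) :
  rot_derivative a b U V -> rot_derivative a b U' V' ->
  rot_derivative a b (fun y => U y + U' y) (fun y => V y + V' y).
Proof.
move=> [bU bV [C C0 hC]] [bU' bV' [C' C0' hC']].
split; [exact: bmeasD|exact: bmeasD|exists (C + C'); first exact: addr_ge0].
move=> t y t1 Sy; have h := hC t y t1 Sy; have h' := hC' t y t1 Sy.
rewrite [leRHS]mulrDl; apply: le_trans (lerD h h').
set z := rotate _ _ _ _.
have -> : U z + U' z - (U y + U' y) - 2 * t * (V y + V' y) =
  (U z - U y - 2 * t * V y) + (U' z - U' y - 2 * t * V' y) by ring.
exact: ler_normD.
Qed.

Lemma rot_derivativeM (R : realType) (N : nat) (a b : 'I_N)
  (U V U' V' : N.-tuple R -> R) : a != b ->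
  rot_derivative a b U V -> rot_derivative a b U' V' ->
  rot_derivative a b (fun y => U y * U' y) (fun y => V y * U' y + U y * V' y).
Proof.
move=> ab [bU bV [C C0 hC]] [bU' bV' [C' C0' hC']].
split; [exact: bmeasM|by apply: bmeasD; exact: bmeasM|].
have [_ [M hM]] := bU; have [_ [M' hM']] := bU'.
have [_ [L hL]] := bV; have [_ [L' hL']] := bV'.
exists (4 * (`|L| * `|L'|) + C * `|M'| + (`|M| + 2 * `|L|) * C').
  by rewrite !addr_ge0 // !mulr_ge0 // addr_ge0 // mulr_ge0.
move=> t y t1 Sy.
have t2 : 0 <= t ^+ 2 by exact: sqr_ge0.
have [QQ _] := givens_rotation R N a b t ab.
have := hC t y t1 Sy; have := hC' t y t1 Sy.
set z := rotate _ _ _ _.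
have Sz : sphere R N z by exact: sphere_rotate.
have b1 : `|V y| <= `|L| by rewrite (le_trans (hL y Sy)) // ler_norm.
have b2 : `|V' y| <= `|L'| by rewrite (le_trans (hL' y Sy)) // ler_norm.
have b3 : `|U' z| <= `|M'| by rewrite (le_trans (hM' z Sz)) // ler_norm.
have b4 : `|U y| <= `|M| by rewrite (le_trans (hM y Sy)) // ler_norm.
set r := U z - U y - 2 * t * V y; set r' := U' z - U' y - 2 * t * V' y.
move=> hr' hr.
(* Substitute [U z = U y + 2 t V y + r], and likewise for [U']: each remaining term contains
   [t ^ 2], [r] or [r']. *)
have -> : U z * U' z - U y * U' y - 2 * t * (V y * U' y + U y * V' y) =
   4 * (V y * V' y) * t ^+ 2 + r * U' z + (U y + 2 * (t * V y)) * r'.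
  by rewrite /r /r'; ring.
rewrite [leRHS]mulrDl [X in _ <= X + _]mulrDl; apply: le_trans (ler_normD _ _) _.
apply: lerD; first (apply: le_trans (ler_normD _ _) _; apply: lerD).
- rewrite normrM (ger0_norm t2) ler_wpM2r //.
  by rewrite normrM (ger0_norm (_ : 0 <= 4 :> R)) // ler_wpM2l // normrM ler_pM.
- by rewrite normrM mulrAC ler_pM.
- rewrite normrM -mulrA ler_pM //.
  apply: le_trans (ler_normD _ _) _; apply: lerD => //.
  rewrite normrM (ger0_norm (_ : 0 <= 2 :> R)) // ler_wpM2l //.
  by rewrite normrM -[leRHS]mul1r ler_pM.
Qed.

Lemma rot_derivativeZ (R : realType) (N : nat) (a b : 'I_N) (c : R)
  (U V : N.-tuple R -> R) : a != b -> rot_derivative a b U V ->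
  rot_derivative a b (fun y => c * U y) (fun y => c * V y).
Proof.
move=> ab dU.
apply: rot_derivative_ext (rot_derivativeM R N a b _ _ _ _ ab
  (rot_derivative_cst R N a b c) dU) => // y.
by rewrite mul0r add0r.
Qed.

Lemma rot_derivative_sum (R : realType) (N : nat) (a b : 'I_N) (I : Type)
  (s : seq I) (U V : I -> N.-tuple R -> R) :
  (forall i, rot_derivative a b (U i) (V i)) ->
  rot_derivative a b (fun y => \sum_(i <- s) U i y) (fun y => \sum_(i <- s) V i y).
Proof.
move=> dU; elim: s => [|i s ih].
  by apply: rot_derivative_ext (rot_derivative_cst R N a b 0) => y; rewrite big_nil.
apply: rot_derivative_ext (rot_derivativeD R N a b _ _ _ _ (dU i) ih) => y;
  by rewrite big_cons.
Qed.

Lemma rot_derivative_horner (R : realType) (N : nat) (a b : 'I_N)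
  (p : {poly R}) (U V : N.-tuple R -> R) : a != b -> rot_derivative a b U V ->
  rot_derivative a b (fun y => p.[U y]) (fun y => p^`().[U y] * V y).
Proof.
move=> ab dU; elim/poly_ind: p => [|p c ih].
  apply: rot_derivative_ext (rot_derivative_cst R N a b 0) => y.
    by rewrite horner0.
  by rewrite deriv0 horner0 mul0r.
apply: rot_derivative_ext (rot_derivativeD R N a b _ _ _ _
  (rot_derivativeM R N a b _ _ _ _ ab ih dU) (rot_derivative_cst R N a b c)) => y.
  by rewrite hornerMXaddC.
rewrite derivD derivM derivC derivX mulr1 addr0 !hornerD horner0 hornerMX; ring.
Qed.

Lemma rot_derivative_coord (R : realType) (N : nat) (a b i : 'I_N) :
  rot_derivative a b (fun y : N.-tuple R => tnth y i)
   (fun y => (i == b)%:R * tnth y a - (i == a)%:R * tnth y b).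
Proof.
split; first exact: bmeas_coord.
  apply: bmeasD; first by apply: bmeasZ; exact: bmeas_coord.
  have := bmeasZ R N (- (i == a)%:R) _ (bmeas_coord R N b).
  by under eq_fun do rewrite mulNr.
exists 8 => // t y t1 Sy; rewrite rotate_givens.
have t0 : 0 < 1 + t ^+ 2 by rewrite ltr_pwDl // sqr_ge0.
have t2 : 0 <= t ^+ 2 by exact: sqr_ge0.
set p := (i == a)%:R * tnth y a + _; set q := (i == b)%:R * _ - _.
have xy (u v : 'I_N) : `|(i == u)%:R * tnth y v| <= 1.
  rewrite normrM normr_nat -[1 in leRHS]mul1r ler_pM ?sphere_coord_le1 //.
  by rewrite lern1 leq_b1.
have p2 : `|p| <= 2.
  by apply: le_trans (ler_normD _ _) _; rewrite [leRHS](_ : _ = 1 + 1) // lerD.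
have q2 : `|q| <= 2.
  by apply: le_trans (ler_normB _ _) _; rewrite [leRHS](_ : _ = 1 + 1) // lerD.
set d := (1 + t ^+ 2)^-1.
have d0 : 0 <= d by rewrite invr_ge0 ltW.
have d1 : d <= 1 by rewrite invf_le1 // lerDl.
(* The exact remainders of the rational parametrisation: the cosine minus 1 is [- 2 d t ^ 2] and the
   sine minus [2 t] is [- 2 d t ^ 3]. *)
have -> : tnth y i + (((1 - t ^+ 2) * d - 1) * p + 2 * t * d * q) - tnth y i
   - 2 * t * q = (- 2 * p * d - 2 * (t * (d * q))) * t ^+ 2.
  have e1 : (1 - t ^+ 2) * d - 1 = - 2 * d * t ^+ 2.
    by rewrite /d; field; rewrite gt_eqF.
  have e2 : 2 * t * d - 2 * t = - 2 * (t * d) * t ^+ 2.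
    by rewrite /d; field; rewrite gt_eqF.
  transitivity (((1 - t ^+ 2) * d - 1) * p + (2 * t * d - 2 * t) * q); first by ring.
  by rewrite e1 e2; ring.
rewrite normrM (ger0_norm t2) ler_wpM2r //.
apply: le_trans (ler_normB _ _) _; rewrite [leRHS](_ : _ = 4 + 4); last by ring.
apply: lerD.
  rewrite !normrM normrN (ger0_norm (_ : 0 <= 2 :> R)) // (ger0_norm d0).
  rewrite -[4]mulr1 ler_pM ?mulr_ge0 // [leRHS](_ : _ = 2 * 2) ?ler_wpM2l //.
  by ring.
rewrite !normrM (ger0_norm (_ : 0 <= 2 :> R)) // (ger0_norm d0).
rewrite [leRHS](_ : _ = 2 * (1 * (1 * 2))); last by ring.
by rewrite ler_wpM2l // ler_pM ?mulr_ge0 // ler_pM.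
Qed.

(** * Zonal functions *)

Definition orthonormal_system (R : realType) (N d : nat) (A : 'I_d -> 'I_N -> R) :=
  forall r r', \sum_i A r i * A r' i = (r == r')%:R.

Definition linear_form (R : realType) (N : nat) (A : 'I_N -> R) (y : N.-tuple R) : R :=
  \sum_i A i * tnth y i.

(** For an orthonormal [A] this is the squared length of the projection of [y] on a [d]-dimensional
    subspace; with the rows of [kform] it becomes [|(x, y)|^2]. *)
Definition zonal (R : realType) (N d : nat) (A : 'I_d -> 'I_N -> R)
  (y : N.-tuple R) : R := \sum_r linear_form R N (A r) y ^+ 2.

(** This definition and the next two are closed forms of rotation derivatives of [linear_form] and
    [zonal], of order at most two; [linear_form_rotP], [zonal_rotP] and [zonal_rot2P] justify
    them. *)
Definition linear_form_rot (R : realType) (N : nat) (A : 'I_N -> R) (a b : 'I_N)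
  (y : N.-tuple R) : R := A b * tnth y a - A a * tnth y b.

Definition zonal_rot (R : realType) (N d : nat) (A : 'I_d -> 'I_N -> R)
  (a b : 'I_N) (y : N.-tuple R) : R :=
  \sum_r 2 * (linear_form R N (A r) y * linear_form_rot R N (A r) a b y).

Definition zonal_rot2 (R : realType) (N d : nat) (A : 'I_d -> 'I_N -> R)
  (a b : 'I_N) (y : N.-tuple R) : R :=
  \sum_r 2 * (linear_form_rot R N (A r) a b y ^+ 2 -
     linear_form R N (A r) y * (A r a * tnth y a + A r b * tnth y b)).

Lemma lagrange_identity (R : realType) (N : nat) (u v : 'I_N -> R) :
  \sum_a \sum_b (u b * v a - u a * v b) ^+ 2 =
  2 * ((\sum_a u a ^+ 2) * (\sum_a v a ^+ 2) - (\sum_a u a * v a) ^+ 2).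
Proof.
have h1 : \sum_a \sum_b u b ^+ 2 * v a ^+ 2 =
    (\sum_a u a ^+ 2) * (\sum_a v a ^+ 2).
  by rewrite mulr_sumr; apply: eq_bigr => a _; rewrite mulr_suml.
have h2 : \sum_a \sum_b u a ^+ 2 * v b ^+ 2 =
    (\sum_a u a ^+ 2) * (\sum_a v a ^+ 2).
  by rewrite mulr_suml; apply: eq_bigr => a _; rewrite mulr_sumr.
have h3 : \sum_a \sum_b (u a * v a) * (u b * v b) = (\sum_a u a * v a) ^+ 2.
  by rewrite expr2 mulr_suml; apply: eq_bigr => a _; rewrite mulr_sumr.
rewrite mulrBr [in 2 * (_ * _)]mulr_natl mulr2n -{1}h1 -h2 -h3.
rewrite mulr_sumr -big_split /= -sumrB; apply: eq_bigr => a _.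
by rewrite mulr_sumr -big_split /= -sumrB; apply: eq_bigr => b _; ring.
Qed.

Lemma bmeas_linear_form (R : realType) (N : nat) (A : 'I_N -> R) :
  bmeas (linear_form R N A).
Proof. by apply: bmeas_sum => i _; apply: bmeasZ; exact: bmeas_coord. Qed.

Lemma bmeas_zonal (R : realType) (N d : nat) (A : 'I_d -> 'I_N -> R) :
  bmeas (zonal R N d A).
Proof.
by apply: bmeas_sum => r _; apply: bmeasM; exact: bmeas_linear_form.
Qed.

Lemma linear_form_rotP (R : realType) (N : nat) (A : 'I_N -> R) (a b : 'I_N) :
  a != b -> rot_derivative a b (linear_form R N A) (linear_form_rot R N A a b).
Proof.
move=> ab; apply: (rot_derivative_ext R N a b _ _ _ _ _ _
  (rot_derivative_sum R N a b _ (index_enum 'I_N) _ _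
    (fun i => rot_derivativeZ R N a b (A i) _ _ ab
       (rot_derivative_coord R N a b i)))) => y //.
rewrite /linear_form_rot; under eq_bigr do rewrite mulrBr.
rewrite sumrB; congr (_ - _).
  rewrite (bigD1 b) //= eqxx mul1r big1 ?addr0 // => i ib.
  by rewrite (negPf ib) mul0r mulr0.
rewrite (bigD1 a) //= eqxx mul1r big1 ?addr0 // => i ia.
by rewrite (negPf ia) mul0r mulr0.
Qed.

Lemma zonal_rotP (R : realType) (N d : nat) (A : 'I_d -> 'I_N -> R) (a b : 'I_N) :
  a != b -> rot_derivative a b (zonal R N d A) (zonal_rot R N d A a b).
Proof.
move=> ab; apply: (rot_derivative_ext R N a b _ _ _ _ _ _
  (rot_derivative_sum R N a b _ (index_enum 'I_d) _ _
    (fun r => rot_derivativeM R N a b _ _ _ _ ab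
       (linear_form_rotP R N (A r) a b ab) (linear_form_rotP R N (A r) a b ab)))) => y.
  by apply: eq_bigr => r _; rewrite expr2.
by apply: eq_bigr => r _; ring.
Qed.

Lemma linear_form_rot2P (R : realType) (N : nat) (A : 'I_N -> R) (a b : 'I_N) :
  a != b -> rot_derivative a b (linear_form_rot R N A a b)
    (fun y => - (A a * tnth y a + A b * tnth y b)).
Proof.
move=> ab.
have h (i : 'I_N) c := rot_derivativeZ R N a b c _ _ ab (rot_derivative_coord R N a b i).
apply: rot_derivative_ext (rot_derivativeD R N a b _ _ _ _ (h a (A b)) (h b (- A a))) => y.
  by rewrite /linear_form_rot mulNr.
by rewrite !eqxx (negPf ab) eq_sym (negPf ab) /=; ring.
Qed.

Lemma zonal_rot2P (R : realType) (N d : nat) (A : 'I_d -> 'I_N -> R) (a b : 'I_N) :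
  a != b -> rot_derivative a b (zonal_rot R N d A a b) (zonal_rot2 R N d A a b).
Proof.
move=> ab; apply: (rot_derivative_ext R N a b _ _ _ _ _ _
  (rot_derivative_sum R N a b _ (index_enum 'I_d) _ _
    (fun r => rot_derivativeZ R N a b 2 _ _ ab
      (rot_derivativeM R N a b _ _ _ _ ab
       (linear_form_rotP R N (A r) a b ab) (linear_form_rot2P R N (A r) a b ab))))) => y //.
by apply: eq_bigr => r _; ring.
Qed.

(** With [u] the Euclidean gradient of [s = zonal], the rotation derivative is [u b y_a - u a y_b].
    Lagrange's identity applies with [|y| = 1], [u . y = 2 s] (Euler) and [|u|^2 = 4 s]
    (orthonormality). *)
Lemma sum_zonal_rot_sqr (R : realType) (N d : nat) (A : 'I_d -> 'I_N -> R) y :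
  orthonormal_system R N d A -> sphere R N y ->
  \sum_a \sum_b zonal_rot R N d A a b y ^+ 2 =
  8 * (zonal R N d A y * (1 - zonal R N d A y)).
Proof.
move=> oA Sy.
pose u i := \sum_r 2 * (linear_form R N (A r) y * A r i).
have zE a b : zonal_rot R N d A a b y = u b * tnth y a - u a * tnth y b.
  rewrite /zonal_rot /u !mulr_suml -sumrB; apply: eq_bigr => r _.
  by rewrite /linear_form_rot; ring.
under eq_bigr do under eq_bigr do rewrite zE.
rewrite lagrange_identity.
have -> : \sum_a tnth y a ^+ 2 = 1 by [].
have -> : \sum_a u a * tnth y a = 2 * zonal R N d A y.
  under eq_bigr do rewrite /u mulr_suml.
  rewrite exchange_big /zonal mulr_sumr; apply: eq_bigr => r _.
  rewrite expr2 {3}/linear_form mulrA mulr_sumr.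
  by apply: eq_bigr => i _; ring.
have -> : \sum_a u a ^+ 2 = 4 * zonal R N d A y.
  have e a : u a ^+ 2 = \sum_r \sum_r' 4 *
      (linear_form R N (A r) y * linear_form R N (A r') y) * (A r a * A r' a).
    rewrite expr2 /u mulr_suml; apply: eq_bigr => r _.
    by rewrite mulr_sumr; apply: eq_bigr => r' _; ring.
  under eq_bigr do rewrite e.
  rewrite exchange_big /zonal mulr_sumr; apply: eq_bigr => r _.
  rewrite exchange_big (bigD1 r) //= -mulr_sumr oA eqxx big1 => [|r' rr'].
    by rewrite addr0 mulr1 expr2.
  by rewrite -mulr_sumr oA eq_sym (negPf rr') mulr0.
ring.
Qed.

(** Row by row, with [l] the value of the form: the squares contribute [2 (1 - l ^ 2)] by Lagrange's
    identity and the linear part [- 2 N l ^ 2] over all pairs. Removing the diagonal pairs gives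
    back [2 l ^ 2]. *)
Lemma sum_zonal_rot2 (R : realType) (N d : nat) (A : 'I_d -> 'I_N -> R) y :
  orthonormal_system R N d A -> sphere R N y ->
  \sum_a \sum_(b | a != b) zonal_rot2 R N d A a b y =
  4 * d%:R - 4 * N%:R * zonal R N d A y.
Proof.
move=> oA Sy.
have key r : \sum_a \sum_(b | a != b) (linear_form_rot R N (A r) a b y ^+ 2 -
    linear_form R N (A r) y * (A r a * tnth y a + A r b * tnth y b)) =
    2 - 2 * N%:R * linear_form R N (A r) y ^+ 2.
  set l := linear_form R N (A r) y.
  pose f a b := linear_form_rot R N (A r) a b y ^+ 2 -
    l * (A r a * tnth y a + A r b * tnth y b).
  have -> : \sum_a \sum_(b | a != b) f a b = \sum_a \sum_b f a b - \sum_a f a a.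
    rewrite -sumrB; apply: eq_bigr => a _.
    rewrite [in RHS](bigD1 a) //= addrAC subrr add0r.
    by apply: eq_bigl => b; rewrite eq_sym.
  have -> : \sum_a f a a = - 2 * l ^+ 2.
    rewrite expr2 mulrA {2}/l mulr_sumr; apply: eq_bigr => a _.
    by rewrite /f /linear_form_rot; ring.
  have -> : \sum_a \sum_b f a b = 2 * (1 - l ^+ 2) - 2 * N%:R * l ^+ 2.
    rewrite /f; under eq_bigr do rewrite sumrB.
    rewrite sumrB lagrange_identity; congr (2 * _ - _).
      rewrite -/(linear_form R N (A r) y) -/l; congr (_ - _).
      have -> : \sum_a tnth y a ^+ 2 = 1 by [].
      by rewrite mulr1; under eq_bigr do rewrite expr2; rewrite oA eqxx.
    under eq_bigr do rewrite -mulr_sumr big_split /= sumr_const card_ord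
      -/(linear_form R N (A r) y) -/l.
    rewrite -mulr_sumr big_split /= sumr_const card_ord sumrMnl.
    by rewrite -/(linear_form R N (A r) y) -/l -mulr_natl; ring.
  ring.
rewrite /zonal_rot2.
under eq_bigr do rewrite exchange_big /=.
rewrite exchange_big /= mulr_sumr.
rewrite (_ : 4 * d%:R = \sum_(r < d) 4); last first.
  by rewrite sumr_const card_ord mulr_natr.
rewrite -sumrB; apply: eq_bigr => r _.
under eq_bigr do rewrite -mulr_sumr.
by rewrite -mulr_sumr key; ring.
Qed.

Lemma bmeas_horner_zonal (R : realType) (N d : nat) (A : 'I_d -> 'I_N -> R)
  (p : {poly R}) : bmeas (fun y => p.[zonal R N d A y]).
Proof. by apply: bmeas_horner; exact: bmeas_zonal. Qed.

(* On the sphere, the sum of the squared rotation derivatives is the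
   spherical Laplacian, which acts on zonal functions as the Jacobi operator. *)
Lemma zonal_laplacian (R : realType) (N d : nat) (A : 'I_d -> 'I_N -> R)
  (p : {poly R}) y : orthonormal_system R N d A -> sphere R N y ->
  \sum_a \sum_(b | a != b)
    (p^`()^`().[zonal R N d A y] * zonal_rot R N d A a b y ^+ 2 +
     p^`().[zonal R N d A y] * zonal_rot2 R N d A a b y) =
  8 * (jacobi_op R ((N%:R - d%:R) / 2) (d%:R / 2) p).[zonal R N d A y].
Proof.
move=> oA Sy; rewrite horner_jacobi_op.
under eq_bigr do rewrite big_split /= -!mulr_sumr.
rewrite big_split /= -!mulr_sumr sum_zonal_rot2 //.
have -> : \sum_a \sum_(b | a != b) zonal_rot R N d A a b y ^+ 2 =
    8 * (zonal R N d A y * (1 - zonal R N d A y)).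
  rewrite -sum_zonal_rot_sqr //; apply: eq_bigr => a _.
  rewrite [RHS](bigD1 a) //= [X in _ = X + _](_ : _ = 0) ?add0r.
    by apply: eq_bigl => b; rewrite eq_sym.
  rewrite /zonal_rot big1 ?expr0n // => r _.
  by rewrite /linear_form_rot subrr !mulr0.
by field.
Qed.

(** Integration by parts in each coordinate plane turns both sides into the same Dirichlet form, the
    sum of means of products of rotation derivatives. The systems [A] and [B] may differ, which the
    cross terms between two nodes require. *)
Lemma zonal_symmetry (R : realType) (N d : nat)
  (sigma : probability (N.-tuple R) R) (A B : 'I_d -> 'I_N -> R) (p q : {poly R}) :
  normalized_rotation_invariant R N sigma ->
  orthonormal_system R N d A -> orthonormal_system R N d B ->
  let L := jacobi_op R ((N%:R - d%:R) / 2) (d%:R / 2) in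
  mean sigma (fun y => (L p).[zonal R N d A y] * q.[zonal R N d B y]) =
  mean sigma (fun y => p.[zonal R N d A y] * (L q).[zonal R N d B y]).
Proof.
move=> inv oA oB L.
pose lap (C : 'I_d -> 'I_N -> R) (f : {poly R}) a b y :=
  f^`()^`().[zonal R N d C y] * zonal_rot R N d C a b y ^+ 2 +
  f^`().[zonal R N d C y] * zonal_rot2 R N d C a b y.
pose grad (C : 'I_d -> 'I_N -> R) (f : {poly R}) a b y :=
  f^`().[zonal R N d C y] * zonal_rot R N d C a b y.
suff half (C D : 'I_d -> 'I_N -> R) (f g : {poly R}) :
    orthonormal_system R N d C -> orthonormal_system R N d D ->
  8 * mean sigma (fun y => (L f).[zonal R N d C y] * g.[zonal R N d D y]) =
  - \sum_a \sum_(b | a != b) mean sigma (fun y => grad C f a b y * grad D g a b y).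
  apply: (@mulfI _ 8) => //; rewrite half //.
  have -> : mean sigma (fun y => p.[zonal R N d A y] * (L q).[zonal R N d B y]) =
      mean sigma (fun y => (L q).[zonal R N d B y] * p.[zonal R N d A y]).
    by apply: eq_mean => y _; rewrite mulrC.
  rewrite half //; congr (- _); apply: eq_bigr => a _; apply: eq_bigr => b _.
  by apply: eq_mean => y _; rewrite mulrC.
move=> oC oD.
have dgrad a b : a != b -> rot_derivative a b (grad C f a b) (lap C f a b).
  move=> ab; apply: rot_derivative_ext (rot_derivativeM R N a b _ _ _ _ ab
    (rot_derivative_horner R N a b f^`() _ _ ab (zonal_rotP R N d C a b ab))
    (zonal_rot2P R N d C a b ab)) => // y.
  by rewrite /lap; ring.
have dg a b : a != b -> rot_derivative a b (fun y => g.[zonal R N d D y]) (grad D g a b).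
  by move=> ab; apply: rot_derivative_horner => //; exact: zonal_rotP.
have blap a b : a != b -> bmeas (lap C f a b) by move=> /dgrad[].
have bgC a b : a != b -> bmeas (grad C f a b) by move=> /dgrad[].
have bgD a b : a != b -> bmeas (grad D g a b) by move=> /dg[].
have bg : bmeas (fun y => g.[zonal R N d D y]) by exact: bmeas_horner_zonal.
have ibp a b : a != b ->
    mean sigma (fun y => lap C f a b y * g.[zonal R N d D y]) =
    - mean sigma (fun y => grad C f a b y * grad D g a b y).
  move=> ab; apply/eqP; rewrite -addr_eq0 -meanD; first last.
  - by apply: bmeasM; [exact: bgC|exact: bgD].
  - by apply: bmeasM => //; exact: blap.
  apply/eqP; apply: (rot_derivative_mean0 R N sigma a b _ _ inv ab).
  by apply: rot_derivativeM => //; [exact: dgrad|exact: dg].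
rewrite -meanZ; last by apply: bmeasM => //; exact: bmeas_horner_zonal.
rewrite -sumrN; under [RHS]eq_bigr do rewrite -sumrN.
transitivity (mean sigma (fun y =>
    \sum_(ab : 'I_N * 'I_N | ab.1 != ab.2) lap C f ab.1 ab.2 y * g.[zonal R N d D y])).
  apply: eq_mean => y Sy; rewrite mulrA -zonal_laplacian // -mulr_suml.
  by rewrite pair_big_dep.
rewrite mean_sum; last by move=> [a b] /= ab; apply: bmeasM => //; exact: blap.
by rewrite pair_big_dep /=; apply: eq_bigr => -[a b] /= ab; exact: ibp.
Qed.

Lemma zonal_ge0 (R : realType) (N d : nat) (A : 'I_d -> 'I_N -> R) y :
  0 <= zonal R N d A y.
Proof. by apply: sumr_ge0 => r _; exact: sqr_ge0. Qed.

(** Bessel's inequality, read off [sum_zonal_rot_sqr]: with [s] the value of [zonal], [8 s (1 - s)]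
    is a sum of squares. *)
Lemma zonal_01 (R : realType) (N d : nat) (A : 'I_d -> 'I_N -> R) y :
  orthonormal_system R N d A -> sphere R N y -> 0 <= zonal R N d A y <= 1.
Proof.
move=> oA Sy; rewrite zonal_ge0 /=.
have : 0 <= 8 * (zonal R N d A y * (1 - zonal R N d A y)).
  rewrite -sum_zonal_rot_sqr //.
  by apply: sumr_ge0 => a _; apply: sumr_ge0 => b _; exact: sqr_ge0.
rewrite pmulr_rge0 // => h; rewrite leNgt; apply/negP => s1.
by move: h; rewrite leNgt pmulr_rlt0 ?subr_lt0 ?s1 // (lt_trans _ s1).
Qed.

Lemma jacobi_op_horner_cst (R : realType) (a b : R) c :
  jacobi_op R a b c%:P = 0.
Proof. by rewrite /jacobi_op derivC deriv0 !mulr0 addr0. Qed.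

Lemma mean_zonal_jacobi_op (R : realType) (N d : nat)
  (sigma : probability (N.-tuple R) R) (A : 'I_d -> 'I_N -> R) (p : {poly R}) :
  normalized_rotation_invariant R N sigma -> orthonormal_system R N d A ->
  mean sigma (fun y =>
    (jacobi_op R ((N%:R - d%:R) / 2) (d%:R / 2) p).[zonal R N d A y]) = 0.
Proof.
move=> inv oA; have := zonal_symmetry R N d sigma A A p 1%:P inv oA oA.
rewrite /= jacobi_op_horner_cst => h.
transitivity (mean sigma (fun=> 0 : R)); last exact: mean_cst.
rewrite -[RHS](eq_mean _ _ _ (fun y => p.[zonal R N d A y] * 0.[zonal R N d A y])).
  by rewrite -h; apply: eq_mean => y _; rewrite hornerC mulr1.
by move=> y _; rewrite horner0 mulr0.
Qed.

Lemma zonal_orthogonal (R : realType) (N d : nat)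
  (sigma : probability (N.-tuple R) R) (A B : 'I_d -> 'I_N -> R)
  (p q : {poly R}) (u v : R) :
  normalized_rotation_invariant R N sigma ->
  orthonormal_system R N d A -> orthonormal_system R N d B ->
  jacobi_op R ((N%:R - d%:R) / 2) (d%:R / 2) p = - u *: p ->
  jacobi_op R ((N%:R - d%:R) / 2) (d%:R / 2) q = - v *: q ->
  u != v ->
  mean sigma (fun y => p.[zonal R N d A y] * q.[zonal R N d B y]) = 0.
Proof.
move=> inv oA oB Lp Lq uv; have := zonal_symmetry R N d sigma A B p q inv oA oB.
rewrite /= Lp Lq.
set U := fun y => p.[zonal R N d A y] * q.[zonal R N d B y].
have bU : bmeas U by apply: bmeasM; exact: bmeas_horner_zonal.
rewrite (eq_mean _ _ _ _ (fun y => - u * U y)); last first.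
  by move=> y _; rewrite hornerZ mulrA.
rewrite [RHS](eq_mean _ _ _ _ (fun y => - v * U y)); last first.
  by move=> y _; rewrite hornerZ mulrCA.
rewrite !meanZ // => /eqP; rewrite -subr_eq0 -mulrBl mulf_eq0 opprK addrC subr_eq0.
by rewrite eq_sym (negPf uv) => /eqP.
Qed.

(* Expanding [G] in eigenpolynomials of the Jacobi operator, only the constant
   and the frequencies above [k] survive after averaging over the nodes, and
   the latter contribute negatively. *)
Lemma zonal_energy_bound (R : realType) (N d n k : nat)
  (sigma : probability (N.-tuple R) R)
  (A : 'I_n -> 'I_d -> 'I_N -> R) (B : 'I_d -> 'I_N -> R)
  (rho : 'I_n -> R) (G : {poly R}) :
  let a : R := (N%:R - d%:R) / 2 in let b : R := d%:R / 2 in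
  let lam := jacobi_eigenvalue R a b k.+1 in
  let X := jacobi_op R a b G + lam *: G in
  0 < a -> 0 < b ->
  normalized_rotation_invariant R N sigma ->
  (forall i, orthonormal_system R N d (A i)) -> orthonormal_system R N d B ->
  (forall i, 0 <= rho i) ->
  (forall f : {poly R}, (size f <= k.+1)%N -> forall y, sphere R N y ->
    \sum_i rho i * f.[zonal R N d (A i) y] =
    mean sigma (fun z => f.[zonal R N d B z])) ->
  (forall s : R, 0 <= s <= 1 -> 0 <= G.[s]) ->
  (forall s : R, 0 <= s <= 1 -> 0 <= X.[s]) ->
  \sum_i rho i ^+ 2 * mean sigma (fun y => (G * X).[zonal R N d (A i) y]) <=
  lam * mean sigma (fun y => G.[zonal R N d B y]) ^+ 2.
Proof.
move=> a b lam X a0 b0 inv oA oB rho0 hcub G0 X0.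
have [p hp] := choice (fun l => jacobi_eigenpoly R a b l a0 b0).
have pm l : p l \is monic by case: (hp l).
have sp l : size (p l) = l.+1 by case: (hp l).
have Lp l : jacobi_op R a b (p l) = - jacobi_eigenvalue R a b l *: p l by case: (hp l).
have p0 : p 0%N = 1.
  by have := sp 0%N => /eqP /size_poly1P [c _ e]; have := pm 0%N;
    rewrite e monicE lead_coefC => /eqP ->.
(* One term more than the size of [G], so that the term of frequency [0] can be split off even when
   [G = 0]. *)
have [c Gc] := monic_basis R p pm sp (size G).+1 G (leqnSn _).
set m := (size G).+1 in Gc.
have ev i j : i != j -> jacobi_eigenvalue R a b i != jacobi_eigenvalue R a b j.
  rewrite neq_ltn => /orP[|] ij; first by rewrite lt_eqF // jacobi_eigenvalue_lt.
  by rewrite gt_eqF // jacobi_eigenvalue_lt.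
have Xc : X = \sum_(l < m) (lam - jacobi_eigenvalue R a b l) * c l *: p l.
  have LD := jacobi_opD R a b; have L0 := jacobi_op_horner_cst R a b 0.
  rewrite /X {1 2}Gc (big_morph _ LD L0) scaler_sumr -big_split /=.
  apply: eq_bigr => l _; rewrite jacobi_opZ Lp !scalerA -scalerDl.
  by congr (_ *: _); ring.
pose s i y := zonal R N d (A i) y.
pose Z l y := \sum_i rho i * (p l).[s i y].
have bpz q i : bmeas (fun y => q.[s i y]) by exact: bmeas_horner_zonal.
have bZ l : bmeas (Z l) by apply: bmeas_sum => i _; apply: bmeasZ.
have ZZ l l' : l != l' -> mean sigma (fun y => Z l y * Z l' y) = 0.
  move=> ll'.
  transitivity (mean sigma (fun y => \sum_i \sum_j rho i * rho j *
      ((p l).[s i y] * (p l').[s j y]))).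
    apply: eq_mean => y _; rewrite /Z mulr_suml; apply: eq_bigr => i _.
    by rewrite mulr_sumr; apply: eq_bigr => j _; ring.
  rewrite mean_sum; last first.
    by move=> i _; apply: bmeas_sum => j _; apply: bmeasZ; exact: bmeasM.
  apply: big1 => i _; rewrite mean_sum; last first.
    by move=> j _; apply: bmeasZ; exact: bmeasM.
  apply: big1 => j _; rewrite meanZ; last exact: bmeasM.
  rewrite (zonal_orthogonal R N d sigma _ _ _ _ _ _ inv (oA i) (oA j) (Lp l) (Lp l')).
    by rewrite mulr0.
  exact: ev.
have meanB l : mean sigma (fun y => (p l).[zonal R N d B y]) = (l == 0%N)%:R.
  have [->|l0] := eqVneq l 0%N.
    rewrite p0 -[RHS](mean_cst R N sigma 1 inv); apply: eq_mean => y _.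
    by rewrite -polyC1 hornerC.
  rewrite -[RHS](zonal_orthogonal R N d sigma B B _ _ _ _ inv oB oB (Lp l) (Lp 0%N)).
    by apply: eq_mean => y _; rewrite p0 -polyC1 hornerC mulr1.
  exact: ev.
(* Up to degree [k] the cubature sum equals the mean over the sphere, and eigenpolynomials of
   positive degree have mean zero, being orthogonal to constants. *)
have Zk l y : (l <= k)%N -> sphere R N y -> Z l y = (l == 0%N)%:R.
  by move=> lk Sy; rewrite /Z /s hcub ?sp // meanB.
have meanG : mean sigma (fun y => G.[zonal R N d B y]) = c 0%N.
  transitivity (mean sigma (fun y => \sum_(l < m) c l * (p l).[zonal R N d B y])).
    apply: eq_mean => y _; rewrite {1}Gc horner_sum.
    by apply: eq_bigr => l _; rewrite hornerZ.
  rewrite mean_sum; last first.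
    by move=> l _; apply: bmeasZ; exact: bmeas_horner_zonal.
  rewrite big_ord_recl meanZ; last exact: bmeas_horner_zonal.
  rewrite meanB mulr1 big1 ?addr0 // => l _.
  by rewrite meanZ ?meanB ?mulr0 //; exact: bmeas_horner_zonal.
pose u y := \sum_i rho i * G.[s i y].
pose v y := \sum_i rho i * X.[s i y].
have uE y : u y = \sum_(l < m) c l * Z l y.
  rewrite /u; under eq_bigr do rewrite {1}Gc horner_sum mulr_sumr.
  rewrite exchange_big; apply: eq_bigr => l _; rewrite /Z mulr_sumr.
  by apply: eq_bigr => i _; rewrite hornerZ mulrCA.
have vE y : v y = \sum_(l < m) (lam - jacobi_eigenvalue R a b l) * c l * Z l y.
  rewrite /v; under eq_bigr do rewrite {1}Xc horner_sum mulr_sumr.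
  rewrite exchange_big; apply: eq_bigr => l _; rewrite /Z mulr_sumr.
  by apply: eq_bigr => i _; rewrite hornerZ mulrCA.
have upper : mean sigma (fun y => u y * v y) <= lam * c 0%N ^+ 2.
  have -> : mean sigma (fun y => u y * v y) =
     \sum_(l < m) \sum_(l' < m) c l * ((lam - jacobi_eigenvalue R a b l') * c l') *
       mean sigma (fun y => Z l y * Z l' y).
    transitivity (mean sigma (fun y => \sum_(l < m) \sum_(l' < m)
      c l * ((lam - jacobi_eigenvalue R a b l') * c l') * (Z l y * Z l' y))).
      apply: eq_mean => y _; rewrite uE vE mulr_suml; apply: eq_bigr => l _.
      by rewrite mulr_sumr; apply: eq_bigr => l' _; ring.
    rewrite mean_sum; last first.
      by move=> i _; apply: bmeas_sum => j _; apply: bmeasZ; exact: bmeasM.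
    apply: eq_bigr => l _; rewrite mean_sum; last first.
      by move=> j _; apply: bmeasZ; exact: bmeasM.
    by apply: eq_bigr => l' _; rewrite meanZ //; exact: bmeasM.
  rewrite big_ord_recl [X in _ + X <= _](_ : _ = \sum_(i < size G)
      (lam - jacobi_eigenvalue R a b i.+1) * c i.+1 ^+ 2 *
      mean sigma (fun y => Z i.+1 y ^+ 2)); last first.
    apply: eq_bigr => i _; rewrite (bigD1 (lift ord0 i)) //= big1 ?addr0.
      rewrite (eq_mean _ _ _ _ (fun y => Z i.+1 y ^+ 2)); first by ring.
      by move=> y _; rewrite expr2.
    move=> l li; rewrite ZZ ?mulr0 //; apply: contra_neq li => /= e.
    by apply: val_inj => /=; rewrite -e.
  rewrite big_ord_recl /= [X in _ + X + _]big1 => [|i _]; last by rewrite ZZ ?mulr0.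
  rewrite (eq_mean _ _ _ (fun y => Z 0%N y * Z 0%N y) (fun=> 1)); last first.
    by move=> y Sy; rewrite !Zk // mulr1.
  rewrite mean_cst // /jacobi_eigenvalue mul0r subr0 addr0 mulr1.
  rewrite mulrCA -expr2 gerDl; apply: sumr_le0 => i _.
  have [ik|ki] := leqP i.+1 k.
    rewrite (eq_mean _ _ _ _ (fun=> 0)) ?mean_cst ?mulr0 //.
    by move=> y Sy; rewrite Zk // expr0n.
  rewrite mulr_le0_ge0 //.
    rewrite mulr_le0_ge0 ?sqr_ge0 // subr_le0 /lam.
    move: ki; rewrite leq_eqVlt => /predU1P[[->]//|ki].
    by rewrite ltW // jacobi_eigenvalue_lt.
  rewrite -(mean_cst R N sigma 0 inv); apply: le_mean => [||y _]; last exact: sqr_ge0.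
    exact: bmeas_cst.
  by under eq_fun do rewrite expr2; exact: bmeasM.
rewrite meanG; apply: le_trans upper.
have bu : bmeas u by apply: bmeas_sum => i _; apply: bmeasZ.
have bv : bmeas v by apply: bmeas_sum => i _; apply: bmeasZ.
have bGX i : bmeas (fun y => (G * X).[s i y]) by exact: bpz.
rewrite (eq_bigr (fun i => mean sigma (fun y => rho i ^+ 2 * (G * X).[s i y]))); last first.
  by move=> i _; rewrite meanZ.
rewrite -mean_sum; last by move=> i _; apply: bmeasZ; exact: bpz.
apply: le_mean => [||y Sy].
- by apply: bmeas_sum => i _; apply: bmeasZ; exact: bpz.
- exact: bmeasM.
rewrite /u mulr_suml; apply: ler_sum => i _.
rewrite /v (bigD1 i) //= hornerM mulrDr -/(s i y).
have s01 j : 0 <= s j y <= 1 by exact: zonal_01.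
rewrite -[leLHS]addr0; apply: lerD.
  by rewrite le_eqVlt; apply/orP; left; apply/eqP; ring.
rewrite mulr_ge0 //; first by rewrite mulr_ge0 // G0.
by apply: sumr_ge0 => j _; rewrite mulr_ge0 // X0.
Qed.

(** * Projective cubature formulas and zonal polynomials *)

(** A monomial is encoded as a list of variables with repetitions: products become concatenations,
    which makes homogeneity easy to propagate. Counting occurrences recovers the exponents of
    [homog_poly]. *)
Definition monomial_sum (R : realType) (N p : nat) (f : N.-tuple R -> R) : Prop :=
  exists L : seq (R * seq 'I_N), all (fun u => size u.2 == p) L /\
    forall y, f y = \sum_(u <- L) u.1 * \prod_(i <- u.2) tnth y i.

Lemma prod_count (R : realType) (N : nat) (l : seq 'I_N) (w : 'I_N -> R) :
  \prod_(i <- l) w i = \prod_i w i ^+ count_mem i l.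
Proof.
elim: l => [|x l ih]; first by rewrite big_nil big1.
rewrite big_cons ih /=; under [RHS]eq_bigr do rewrite exprD.
rewrite big_split /=; congr (_ * _).
rewrite (bigD1 x) //= eqxx expr1 big1 ?mulr1 // => i ix.
by rewrite eq_sym (negPf ix) expr0.
Qed.

Lemma sum_count (N : nat) (l : seq 'I_N) : (\sum_i count_mem i l = size l)%N.
Proof.
elim: l => [|x l ih]; first by rewrite big1.
rewrite /= big_split /= ih (bigD1 x) //= eqxx big1 ?addn0 // => i ix.
by rewrite eq_sym (negPf ix).
Qed.

Lemma monomial_sum_homog (R : realType) (N p : nat) (f : N.-tuple R -> R) :
  monomial_sum R N p f -> homog_poly R N p f.
Proof.
move=> [L [sL fE]].
pose e (l : seq 'I_N) : {ffun 'I_N -> 'I_p.+1} := [ffun i => inord (count_mem i l)].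
exists (fun a => \sum_(u <- L) u.1 * (a == e u.2)%:R) => y.
rewrite fE; under [RHS]eq_bigr do rewrite mulr_suml.
rewrite exchange_big /= big_seq [RHS]big_seq; apply: eq_bigr => u uL.
have /eqP su := allP sL u uL.
have eE i : e u.2 i = count_mem i u.2 :> nat.
  by rewrite ffunE inordK // ltnS -su count_size.
rewrite (bigD1 (e u.2)) /=; last first.
  by under eq_bigr do rewrite eE; rewrite sum_count su.
rewrite eqxx mulr1 [X in _ = _ + X]big1 ?addr0 => [|a /andP[_ /negPf ->]]; last first.
  by rewrite mulr0 mul0r.
by rewrite prod_count; congr (_ * _); apply: eq_bigr => i _; rewrite eE.
Qed.

Lemma monomial_sum_ext (R : realType) (N p : nat) (f g : N.-tuple R -> R) :
  f =1 g -> monomial_sum R N p f -> monomial_sum R N p g.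
Proof. by move=> /funext ->. Qed.

Lemma monomial_sum0 (R : realType) (N p : nat) : monomial_sum R N p (fun=> 0).
Proof. by exists [::]; split=> // y; rewrite big_nil. Qed.

Lemma monomial_sumD (R : realType) (N p : nat) (f g : N.-tuple R -> R) :
  monomial_sum R N p f -> monomial_sum R N p g ->
  monomial_sum R N p (fun y => f y + g y).
Proof.
move=> [L [sL fE]] [M [sM gE]]; exists (L ++ M); split; first by rewrite all_cat sL.
by move=> y; rewrite big_cat fE gE.
Qed.

Lemma monomial_sum_sum (R : realType) (N p : nat) (I : Type) (s : seq I)
  (f : I -> N.-tuple R -> R) : (forall i, monomial_sum R N p (f i)) ->
  monomial_sum R N p (fun y => \sum_(i <- s) f i y).
Proof.
move=> hf; elim: s => [|i s ih].
  by apply: monomial_sum_ext (monomial_sum0 R N p) => y; rewrite big_nil.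
apply: monomial_sum_ext (monomial_sumD R N p _ _ (hf i) ih) => y.
by rewrite big_cons.
Qed.

Lemma monomial_sumM (R : realType) (N p q : nat) (f g : N.-tuple R -> R) :
  monomial_sum R N p f -> monomial_sum R N q g ->
  monomial_sum R N (p + q) (fun y => f y * g y).
Proof.
move=> [L [sL fE]] [M [sM gE]].
exists [seq (u.1 * v.1, u.2 ++ v.2) | u <- L, v <- M]; split.
  apply/allP => w /allpairsP[[u v] /= [uL vM ->]] /=.
  by rewrite size_cat (eqP (allP sL u uL)) (eqP (allP sM v vM)).
move=> y; rewrite fE gE big_allpairs_dep /= mulr_suml; apply: eq_bigr => u _.
rewrite mulr_sumr; apply: eq_bigr => v _; rewrite big_cat /=; ring.
Qed.

Lemma monomial_sum_cst (R : realType) (N : nat) (c : R) :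
  monomial_sum R N 0 (fun=> c).
Proof.
exists [:: (c, [::])]; split=> // y.
by rewrite big_seq1 big_nil mulr1.
Qed.

Lemma monomial_sum_coord (R : realType) (N : nat) (i : 'I_N) :
  monomial_sum R N 1 (fun y => tnth y i).
Proof.
exists [:: (1, [:: i])]; split=> // y.
by rewrite !big_seq1 mul1r.
Qed.

Lemma monomial_sumX (R : realType) (N p n : nat) (f : N.-tuple R -> R) :
  monomial_sum R N p f -> monomial_sum R N (n * p) (fun y => f y ^+ n).
Proof.
move=> hf; elim: n => [|n ih]; first exact: monomial_sum_cst.
rewrite mulSn; apply: monomial_sum_ext (monomial_sumM R N _ _ _ _ hf ih) => y.
by rewrite exprS.
Qed.

Lemma monomial_sum_linear_form (R : realType) (N : nat) (A : 'I_N -> R) :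
  monomial_sum R N 1 (linear_form R N A).
Proof.
apply: monomial_sum_sum => i.
exact: (monomial_sumM R N 0 1 _ _ (monomial_sum_cst R N (A i))
  (monomial_sum_coord R N i)).
Qed.

(** The test functions must be homogeneous of degree exactly [2 k], so each power of [s] is padded
    by a power of [|y|^2], which equals 1 on the sphere. *)
Definition homogenize (R : realType) (N k : nat) (f : {poly R})
  (s : N.-tuple R -> R) (y : N.-tuple R) : R :=
  \sum_(j < k.+1) f`_j * (s y ^+ j * (\sum_i tnth y i ^+ 2) ^+ (k - j)).

Lemma homogenize_homog (R : realType) (N d k : nat) (f : {poly R})
  (A : 'I_d -> 'I_N -> R) :
  homog_poly R N (k * 2) (homogenize R N k f (zonal R N d A)).
Proof.
apply: monomial_sum_homog; apply: monomial_sum_sum => j.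
have hz : monomial_sum R N 2 (zonal R N d A).
  by apply: monomial_sum_sum => r; apply: (monomial_sumX R N 1 2);
    exact: monomial_sum_linear_form.
have hn : monomial_sum R N 2 (fun y => \sum_i tnth y i ^+ 2).
  by apply: monomial_sum_sum => i; apply: (monomial_sumX R N 1 2);
    exact: monomial_sum_coord.
have -> : (k * 2 = 0 + (j * 2 + (k - j) * 2))%N.
  by rewrite -mulnDl subnKC // -ltnS.
apply: monomial_sumM; first exact: monomial_sum_cst.
by apply: monomial_sumM; exact: monomial_sumX.
Qed.

Lemma homogenize_sphere (R : realType) (N k : nat) (f : {poly R})
  (s : N.-tuple R -> R) (y : N.-tuple R) : (size f <= k.+1)%N -> sphere R N y ->
  homogenize R N k f s y = f.[s y].
Proof.
move=> sf Sy; rewrite (horner_coef_wide _ sf); apply: eq_bigr => j _.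
by rewrite Sy expr1n mulr1.
Qed.

(** An eigenpolynomial of positive degree has nonzero eigenvalue, hence lies in the image of the
    operator. Modulo this image every polynomial is a constant, so each functional is determined by
    its value at [1]. *)
Lemma jacobi_functional_unique (R : realType) (a b : R) (F1 F2 : {poly R} -> R) :
  0 < a -> 0 < b ->
  (forall f g, F1 (f + g) = F1 f + F1 g) -> (forall c f, F1 (c *: f) = c * F1 f) ->
  (forall f g, F2 (f + g) = F2 f + F2 g) -> (forall c f, F2 (c *: f) = c * F2 f) ->
  (forall f, F1 (jacobi_op R a b f) = 0) -> (forall f, F2 (jacobi_op R a b f) = 0) ->
  forall f, F1 f * F2 1 = F2 f * F1 1.
Proof.
move=> a0 b0 D1 Z1 D2 Z2 L1 L2 f.
have [p hp] := choice (fun l => jacobi_eigenpoly R a b l a0 b0).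
have pm l : p l \is monic by case: (hp l).
have sp l : size (p l) = l.+1 by case: (hp l).
have p0 : p 0%N = 1.
  by have := sp 0%N => /eqP /size_poly1P [c _ e]; have := pm 0%N;
    rewrite e monicE lead_coefC => /eqP ->.
have [c fc] := monic_basis R p pm sp (size f).+1 f (leqnSn _).
have key (F : {poly R} -> R) : (forall f g, F (f + g) = F f + F g) ->
    (forall c f, F (c *: f) = c * F f) -> (forall f, F (jacobi_op R a b f) = 0) ->
    F f = c 0%N * F 1.
  move=> D Z L; have F0 : F 0 = 0 by rewrite -(scale0r 0) Z mul0r.
  rewrite {1}fc (big_morph F D F0) big_ord_recl p0 Z big1 ?addr0 // => l _.
  have [_ _ el] := hp l.+1; have := L (p l.+1).
  rewrite el !Z => /eqP; rewrite mulf_eq0 oppr_eq0 => /orP[/eqP e|/eqP ->].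
    have := jacobi_eigenvalue_lt R a b 0 l.+1 a0 b0 isT.
    by rewrite e /jacobi_eigenvalue mul0r ltxx.
  by rewrite mulr0.
by rewrite (key F1) // (key F2) //; ring.
Qed.

(** Used with [F] a one-dimensional integral, this identifies the distribution of [zonal] under
    [sigma] and shows that it does not depend on the system [A]. *)
Lemma mean_zonal_indep (R : realType) (N d : nat)
  (sigma : probability (N.-tuple R) R) (F : {poly R} -> R) (A : 'I_d -> 'I_N -> R) :
  let a : R := (N%:R - d%:R) / 2 in let b : R := d%:R / 2 in
  0 < a -> 0 < b -> normalized_rotation_invariant R N sigma ->
  orthonormal_system R N d A ->
  (forall f g, F (f + g) = F f + F g) -> (forall c f, F (c *: f) = c * F f) ->
  (forall f, F (jacobi_op R a b f) = 0) ->
  forall f, mean sigma (fun y => f.[zonal R N d A y]) * F 1 = F f.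
Proof.
move=> a b a0 b0 inv oA D Z L f.
have bA g : bmeas (fun y => g.[zonal R N d A y]) by exact: bmeas_horner_zonal.
rewrite (jacobi_functional_unique R a b (fun f => mean sigma (fun y => f.[zonal R N d A y])) F a0 b0) //.
- rewrite (eq_mean _ _ _ _ (fun=> 1)) ?mean_cst ?mulr1 // => y _.
  by rewrite -polyC1 hornerC.
- by move=> g h; rewrite -meanD //; apply: eq_mean => y _; rewrite hornerD.
- by move=> c g; rewrite -meanZ //; apply: eq_mean => y _; rewrite hornerZ.
- by move=> g; exact: mean_zonal_jacobi_op.
Qed.

(** * Real coordinates of the [K]-valued inner product *)

Lemma sum_blocks (V : nmodType) (d m : nat) (F : nat -> V) :
  \sum_(i < d * m) F i = \sum_(j < m) \sum_(t < d) F (j * d + t)%N.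
Proof.
rewrite -(big_mkord xpredT F) mulnC big_nat_mul big_mkord; apply: eq_bigr => j _.
rewrite mulSn -{1}[(j * d)%N]add0n big_addn addnK big_mkord.
by apply: eq_bigr => t _; rewrite addnC.
Qed.

Definition qconj (R : realType) (a : quat R) : quat R :=
  Quat R (q0 R a) (- q1 R a) (- q2 R a) (- q3 R a).

Definition qunit (R : realType) (t : nat) : quat R :=
  Quat R (t == 0%N)%:R (t == 1%N)%:R (t == 2%N)%:R (t == 3%N)%:R.

(* Row [r] of the real matrix of [y |-> (x, y)]: the [r]-th real component of
   the K-valued inner product is the linear form with these coefficients. *)
Definition kform (R : realType) (K : kfield) (m : nat) (x : seq R)
  (r : 'I_(kdim K)) (i : 'I_(kdim K * m)) : R :=
  qcomp R (qmul R (qconj R (kcoord R K x (i %/ kdim K))) (qunit R (i %% kdim K))) r.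

Definition kinner (R : realType) (K : kfield) (m : nat) (x y : seq R) (r : nat) : R :=
  \sum_(j < m) qcomp R (qmul R (qconj R (kcoord R K x j)) (kcoord R K y j)) r.

Lemma kdim_gt0 (K : kfield) : (0 < kdim K)%N. Proof. by case: K. Qed.

Lemma tnth_entry (R : realType) (K : kfield) (m : nat)
  (y : (kdim K * m).-tuple R) (i : 'I_(kdim K * m)) :
  tnth y i = entry R K y (i %/ kdim K) (i %% kdim K).
Proof.
rewrite /entry ltn_mod kdim_gt0 -divn_eq.
by rewrite (tnth_nth 0).
Qed.

Lemma linear_form_kform (R : realType) (K : kfield) (m : nat) (x : seq R)
  (r : 'I_(kdim K)) (y : (kdim K * m).-tuple R) :
  linear_form R (kdim K * m) (kform R K m x r) y = kinner R K m x y r.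
Proof.
rewrite /linear_form /kinner.
pose F i := qcomp R (qmul R (qconj R (kcoord R K x (i %/ kdim K)))
    (qunit R (i %% kdim K))) r * entry R K y (i %/ kdim K) (i %% kdim K).
rewrite (eq_bigr (fun i : 'I__ => F i)) => [|i _]; last by rewrite tnth_entry.
rewrite sum_blocks; apply: eq_bigr => j _.
have e (t : 'I_(kdim K)) : F (j * kdim K + t)%N =
    qcomp R (qmul R (qconj R (kcoord R K x j)) (qunit R t)) r * entry R K y j t.
  by rewrite /F divnMDl ?kdim_gt0 // modnMDl divn_small // modn_small // addn0.
under eq_bigr do rewrite e.
move: r {F e}; rewrite /kcoord.
case: K y => y r; rewrite !big_ord_recr big_ord0 /= /entry /=; case: r => -[|[|[|[|r]]]] //= _; ring.
Qed.

(** Multiplication by the conjugate of a coordinate [x_j] is [|x_j|] times an isometry of [K], so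
    the rows of its matrix are orthogonal with squared norm [|x_j|^2]; summing over [j] gives
    [|x|^2 = 1]. *)
Lemma kform_orthonormal (R : realType) (K : kfield) (m : nat)
  (x : (kdim K * m).-tuple R) : sphere R _ x ->
  orthonormal_system R (kdim K * m) (kdim K) (kform R K m x).
Proof.
move=> Sx r r'.
pose F i := qcomp R (qmul R (qconj R (kcoord R K x (i %/ kdim K)))
    (qunit R (i %% kdim K))) r *
  qcomp R (qmul R (qconj R (kcoord R K x (i %/ kdim K)))
    (qunit R (i %% kdim K))) r'.
rewrite (eq_bigr (fun i : 'I__ => F i)) => [|i _] //.
rewrite sum_blocks.
have e (j : nat) (t : 'I_(kdim K)) : F (j * kdim K + t)%N =
    qcomp R (qmul R (qconj R (kcoord R K x j)) (qunit R t)) r *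
    qcomp R (qmul R (qconj R (kcoord R K x j)) (qunit R t)) r'.
  by rewrite /F divnMDl ?kdim_gt0 // modnMDl divn_small // modn_small // addn0.
under eq_bigr do under eq_bigr do rewrite e.
have Sx' : \sum_(j < m) \sum_(t < kdim K) entry R K x j t ^+ 2 = 1.
  rewrite -[RHS]Sx.
  rewrite [RHS](eq_bigr (fun i : 'I__ =>
    entry R K x (i %/ kdim K) (i %% kdim K) ^+ 2)) => [|i _]; last by rewrite tnth_entry.
  rewrite (sum_blocks _ _ _ (fun i => entry R K x (i %/ kdim K) (i %% kdim K) ^+ 2)).
  apply: eq_bigr => j _; apply: eq_bigr => t _.
  by rewrite divnMDl ?kdim_gt0 // modnMDl divn_small // modn_small // addn0.
transitivity ((r == r')%:R * \sum_(j < m) \sum_(t < kdim K) entry R K x j t ^+ 2);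
  last by rewrite Sx' mulr1.
rewrite mulr_sumr; apply: eq_bigr => j _.
rewrite -val_eqE /=; move: r r' {F e Sx'}; rewrite /kcoord.
clear Sx; move: (x : seq R) => z.
case: K {x} => r r'; rewrite !big_ord_recr !big_ord0 /= /entry /=;
  case: r => -[|[|[|[|r]]]] //= _; case: r' => -[|[|[|[|r']]]] //= _; ring.
Qed.

(** As [K] is closed under conjugation and products, the components beyond [kdim K] vanish. The
    three fields can then be handled by one computation with four components. *)
Lemma kinner_zonal (R : realType) (K : kfield) (m : nat) (x : seq R)
  (y : (kdim K * m).-tuple R) :
  zonal R (kdim K * m) (kdim K) (kform R K m x) y =
  \sum_(r < 4) kinner R K m x y r ^+ 2.
Proof.
rewrite /zonal; under eq_bigr do rewrite linear_form_kform.
have z (r : nat) : (kdim K <= r)%N -> (r < 4)%N -> kinner R K m x y r = 0.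
  move=> Kr r4; apply: big1 => j _; rewrite /kcoord; move: (y : seq R) Kr r4 => w.
  case: K y => _; rewrite /entry /=; case: r => [|[|[|[|r]]]] //= _ _; ring.
case: K x y z => x y z; rewrite !big_ord_recr !big_ord0 /=.
- by rewrite !(z 1%N, z 2%N, z 3%N) // !expr0n !addr0.
- by rewrite !(z 2%N, z 3%N) // !expr0n !addr0.
- by [].
Qed.

(** [(y, x)] is the conjugate of [(x, y)]: the real part is kept and the three others change
    sign. *)
Lemma zonal_kform_sym (R : realType) (K : kfield) (m : nat)
  (x y : (kdim K * m).-tuple R) :
  zonal R (kdim K * m) (kdim K) (kform R K m x) y =
  zonal R (kdim K * m) (kdim K) (kform R K m y) x.
Proof.
rewrite !kinner_zonal !big_ord_recr !big_ord0 /=.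
have e0 : kinner R K m x y 0 = kinner R K m y x 0.
  by apply: eq_bigr => j _ /=; ring.
have e (r : nat) : r \in [:: 1; 2; 3]%N -> kinner R K m x y r = - kinner R K m y x r.
  rewrite !inE => /or3P[] /eqP ->; rewrite /kinner -sumrN; apply: eq_bigr => j _ /=; ring.
by rewrite e0 !(e 1%N, e 2%N, e 3%N) // !sqrrN.
Qed.

Lemma kcoord_rscale (R : realType) (K : kfield) (m : nat)
  (y : (kdim K * m).-tuple R) (l : quat R) (j : nat) : in_K R K l -> (j < m)%N ->
  kcoord R K (rscale R K m y l) j = qmul R (kcoord R K y j) l.
Proof.
move=> Kl jm.
have ent (r : nat) : (r < 4)%N ->
    entry R K (rscale R K m y l) j r = qcomp R (qmul R (kcoord R K y j) l) r.
  move=> r4; rewrite {1}/entry; case: ifPn => [rK|].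
    have lt : (j * kdim K + r < kdim K * m)%N.
      rewrite [X in (_ < X)%N]mulnC (@leq_trans (j.+1 * kdim K)) //.
        by rewrite mulSn addnC ltn_add2r.
      by rewrite leq_mul2r jm orbT.
    have -> : nth 0 (rscale R K m y l) (j * kdim K + r) =
        tnth (rscale R K m y l) (Ordinal lt) by rewrite (tnth_nth 0).
    rewrite tnth_mktuple /= divnMDl ?kdim_gt0 // modnMDl divn_small //.
    by rewrite modn_small // addn0.
  rewrite -leqNgt => Kr; rewrite /kcoord; move: (y : seq R) => w.
  have := Kl 1%N; have := Kl 2%N; have := Kl 3%N; move: Kr {Kl}.
  case: K y => _; rewrite /entry /=; case: r r4 => [|[|[|[|r]]]] //= _ _ => h3 h2 h1;
    rewrite ?(h3 isT); try rewrite (h2 isT); try rewrite (h1 isT); ring.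
by rewrite {1}/kcoord !ent //; case: (qmul _ _ _).
Qed.

(** The scalar acts on the right, so [(x, y l) = (x, y) l], and the quaternion norm is
    multiplicative. *)
Lemma zonal_kform_rscale (R : realType) (K : kfield) (m : nat) (x : seq R)
  (y : (kdim K * m).-tuple R) (l : quat R) : unit_K R K l ->
  zonal R (kdim K * m) (kdim K) (kform R K m x) (rscale R K m y l) =
  zonal R (kdim K * m) (kdim K) (kform R K m x) y.
Proof.
move=> [Kl l1]; rewrite !kinner_zonal.
have kc (j : nat) : (j < m)%N ->
    kcoord R K (rscale R K m y l) j = qmul R (kcoord R K y j) l.
  by move=> jm; exact: kcoord_rscale.
pose H := Quat R (kinner R K m x y 0) (kinner R K m x y 1)
   (kinner R K m x y 2) (kinner R K m x y 3).
have e (r : nat) : (r < 4)%N ->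
    kinner R K m x (rscale R K m y l) r = qcomp R (qmul R H l) r.
  move=> r4; rewrite /kinner; under eq_bigr => j _ do rewrite kc //.
  case: r r4 => [|[|[|[|r]]]] //= _;
    rewrite /kinner !mulr_suml -?sumrN -!big_split /= -?sumrN -?big_split /=;
    apply: eq_bigr => j _; ring.
under eq_bigr => r _ do rewrite e //.
rewrite !big_ord_recr !big_ord0 /= !add0r -[RHS]mulr1 -l1; ring.
Qed.

Lemma sum_sqr_kcoord (R : realType) (K : kfield) (m : nat)
  (y : (kdim K * m).-tuple R) :
  \sum_i tnth y i ^+ 2 = \sum_(j < m) (q0 R (kcoord R K y j) ^+ 2 +
    q1 R (kcoord R K y j) ^+ 2 + q2 R (kcoord R K y j) ^+ 2 +
    q3 R (kcoord R K y j) ^+ 2).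
Proof.
rewrite (eq_bigr (fun i : 'I__ =>
  entry R K y (i %/ kdim K) (i %% kdim K) ^+ 2)) => [|i _]; last by rewrite tnth_entry.
rewrite (sum_blocks _ _ _ (fun i => entry R K y (i %/ kdim K) (i %% kdim K) ^+ 2)).
apply: eq_bigr => j _.
have e (t : 'I_(kdim K)) : entry R K y ((j * kdim K + t) %/ kdim K)
    ((j * kdim K + t) %% kdim K) = entry R K y j t.
  by rewrite divnMDl ?kdim_gt0 // modnMDl divn_small // modn_small // addn0.
under eq_bigr do rewrite e.
rewrite /kcoord /=; move: (y : seq R) {e} => w.
by case: K {y} => /=; rewrite !big_ord_recr big_ord0 /= /entry /=; ring.
Qed.

Lemma sum_sqr_rscale (R : realType) (K : kfield) (m : nat)
  (y : (kdim K * m).-tuple R) (l : quat R) : unit_K R K l ->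
  \sum_i tnth (rscale R K m y l) i ^+ 2 = \sum_i tnth y i ^+ 2.
Proof.
move=> [Kl l1]; rewrite !sum_sqr_kcoord; apply: eq_bigr => j _.
rewrite kcoord_rscale //; move: (kcoord R K y j) => z.
by rewrite -[RHS]mulr1 -l1 /qmul /=; ring.
Qed.

(** The formula is applied to the homogenized function of [z] centred at [y], which lies in [Phi]
    with imaginary part 0. Symmetry of [|(x, y)|^2] then exchanges centre and node, making the left
    side a function of [y]. *)
Lemma cubature_zonal (R : realType) (K : kfield) (m k : nat)
  (sigma : probability ((kdim K * m).-tuple R) R)
  (n : nat) (x : 'I_n -> (kdim K * m).-tuple R) (rho : 'I_n -> R)
  (f : {poly R}) (y : (kdim K * m).-tuple R) :
  proj_cubature R K m (k * 2) sigma n x rho -> (size f <= k.+1)%N ->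
  sphere R _ y ->
  \sum_i rho i * f.[zonal R _ _ (kform R K m (x i)) y] =
  mean sigma (fun z => f.[zonal R _ _ (kform R K m y) z]).
Proof.
move=> [Sx _ _ cub] sf Sy.
pose h := homogenize R _ k f (zonal R _ _ (kform R K m y)).
have hPhi : Phi R K m (k * 2) (h, fun=> 0).
  split; first exact: homogenize_homog.
  split; first exact/monomial_sum_homog/monomial_sum0.
  move=> w l ul; split=> //=; rewrite /h /homogenize.
  by apply: eq_bigr => j _; rewrite zonal_kform_rscale // sum_sqr_rscale.
have [/= e _] := cub _ hPhi.
rewrite (eq_mean _ _ _ _ h); last by move=> z Sz; rewrite /h homogenize_sphere.
rewrite /mean /Rintegral e /=; apply: eq_bigr => i _.
by rewrite /h homogenize_sphere // zonal_kform_sym.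
Qed.

(** * Integrals over caps *)

Definition seg (R : realType) (f : R -> R) (a b : R) : R :=
  \int[@lebesgue_measure R]_(x in `[a, b]) f x.

Lemma seg_integrable (R : realType) (f : R -> R) (a b : R) : continuous f ->
  (@lebesgue_measure R).-integrable `[a, b] (EFin \o f).
Proof.
move=> cf; apply: continuous_compact_integrable; first exact: segment_compact.
exact: continuous_subspaceT.
Qed.

Lemma seg_FTC (R : realType) (F f : R -> R) (a b : R) : a <= b ->
  (forall x, is_derive x (1 : R) F (f x)) -> continuous f ->
  seg R f a b = F b - F a.
Proof.
move=> ab dF cf; rewrite /seg.
move: ab; rewrite le_eqVlt => /predU1P[->|ab].
  by rewrite set_itv1 Rintegral_set1 subrr.
have cF : continuous F.
  by move=> x; apply: differentiable_continuous; apply/derivable1_diffP;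
    have [] := dF x.
rewrite /Rintegral (@continuous_FTC2 R f F a b ab) //.
- exact: continuous_subspaceT.
- split; first by move=> x _; have [] := dF x.
    by apply: cvg_at_right_filter; exact: cF.
  by apply: cvg_at_left_filter; exact: cF.
- by move=> x _; rewrite derive1E; apply: derive_val.
Qed.

Lemma segD (R : realType) (f g : R -> R) (a b : R) :
  continuous f -> continuous g ->
  seg R (fun x => f x + g x) a b = seg R f a b + seg R g a b.
Proof. by move=> cf cg; apply: RintegralD => //; exact: seg_integrable. Qed.

Lemma segZ (R : realType) (c : R) (f : R -> R) (a b : R) :
  continuous f -> seg R (fun x => c * f x) a b = c * seg R f a b.
Proof. by move=> cf; apply: RintegralZl => //; exact: seg_integrable. Qed.

Lemma le_seg (R : realType) (f g : R -> R) (a b : R) :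
  continuous f -> continuous g -> (forall x, a <= x <= b -> f x <= g x) ->
  seg R f a b <= seg R g a b.
Proof.
move=> cf cg fg; apply: le_Rintegral; [by []|exact: seg_integrable|exact: seg_integrable|].
by move=> x /=; rewrite in_itv /=; exact: fg.
Qed.

Lemma eq_seg (R : realType) (f g : R -> R) (a b : R) :
  (forall x, a <= x <= b -> f x = g x) -> seg R f a b = seg R g a b.
Proof.
by move=> fg; apply: eq_Rintegral => x /set_mem /=; rewrite in_itv /=; exact: fg.
Qed.

Lemma seg_cat (R : realType) (f : R -> R) (a b c : R) : continuous f ->
  a <= c <= b -> seg R f a b = seg R f a c + seg R f c b.
Proof.
move=> cf /andP[ac cb]; rewrite /seg.
have i := seg_integrable R f a b cf.
have := @Rintegral_itvB R f (BLeft a) (BRight b) c i; rewrite !bnd_simp.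
move=> /(_ ac cb); rewrite Rintegral_itv_obnd_cbnd.
  by move=> <-; rewrite addrC subrK.
apply: integrableS i => //; apply: subset_itvr; rewrite bnd_simp; exact: ac.
Qed.

(* With [s = sin t ^ 2], this is, up to a constant, the density in [t] of
   [|(x, y)|^2] for [y] uniform on the sphere, where [d = delta] and
   [e = delta (m - 1)]. *)
Definition trig_weight (R : realType) (d e : nat) (t : R) : R :=
  sin t ^+ d.-1 * cos t ^+ e.-1.

(** In the variable [t] the weight is continuous even when [d] or [e] is 1, where
    [s^(d/2-1) (1 - s)^(e/2-1)] is singular at an endpoint. *)
Definition trig_int (R : realType) (d e : nat) (u : R) (f : {poly R}) : R :=
  seg R (fun t => f.[sin t ^+ 2] * trig_weight R d e t) u (pi / 2).

Lemma continuous_mul (R : realType) (f g : R -> R) :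
  continuous f -> continuous g -> continuous (fun x => f x * g x).
Proof. by move=> cf cg x; exact: cvgM (cf x) (cg x). Qed.

Lemma continuous_pow (R : realType) (f : R -> R) n : continuous f ->
  continuous (fun x => f x ^+ n).
Proof.
move=> cf x; apply: (@continuous_comp _ _ _ f (fun z => z ^+ n)); first exact: cf.
exact: exprn_continuous.
Qed.

Lemma continuous_trig_weight (R : realType) (d e : nat) :
  continuous (trig_weight R d e).
Proof.
apply: continuous_mul; first exact/continuous_pow/continuous_sin.
exact/continuous_pow/continuous_cos.
Qed.

Lemma continuous_trig_integrand (R : realType) (d e : nat) (f : {poly R}) :
  continuous (fun t => f.[sin t ^+ 2] * trig_weight R d e t).
Proof.
apply: continuous_mul; last exact: continuous_trig_weight.
move=> x; apply: (@continuous_comp _ _ _ (fun t => sin t ^+ 2) (horner f)).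
  exact/continuous_pow/continuous_sin.
exact: continuous_horner.
Qed.

Lemma trig_intD (R : realType) (d e : nat) (u : R) (f g : {poly R}) :
  trig_int R d e u (f + g) = trig_int R d e u f + trig_int R d e u g.
Proof.
rewrite -segD; try exact: continuous_trig_integrand.
by apply: eq_seg => x _; rewrite hornerD mulrDl.
Qed.

Lemma trig_intZ (R : realType) (d e : nat) (u c : R) (f : {poly R}) :
  trig_int R d e u (c *: f) = c * trig_int R d e u f.
Proof.
rewrite -segZ; last exact: continuous_trig_integrand.
by apply: eq_seg => x _; rewrite hornerZ -mulrA.
Qed.

Lemma is_derive_funM (R : realType) (f g : R -> R) (x a b : R) :
  is_derive x (1 : R) f a -> is_derive x (1 : R) g b ->
  is_derive x (1 : R) (fun t => f t * g t) (a * g x + f x * b).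
Proof.
move=> df dg; apply: (is_derive_eq (is_deriveM df dg)).
by rewrite addrC; congr (_ + _); exact: mulrC.
Qed.

Lemma is_derive_funX (R : realType) (f : R -> R) (x a : R) n :
  is_derive x (1 : R) f a ->
  is_derive x (1 : R) (fun t => f t ^+ n) (n%:R * f x ^+ n.-1 * a).
Proof.
move=> df; have := is_deriveX n df.
by rewrite (_ : f ^+ n = fun t => f t ^+ n) //; apply/funext => t; rewrite fctE.
Qed.

Lemma is_derive_funZ (R : realType) (c : R) (f : R -> R) (x a : R) :
  is_derive x (1 : R) f a -> is_derive x (1 : R) (fun t => c * f t) (c * a).
Proof. by move=> df; exact: (is_deriveZ c df). Qed.

(** The divergence form of the operator makes the integrand the derivative of [F]. The boundary term
    at [pi / 2] vanishes since [0 < e]; the one at [u] vanishes for [u = 0], or when [f'] is zero at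
    [sin u ^ 2]. *)
Lemma trig_int_jacobi_op (R : realType) (d e : nat) (u : R) (f : {poly R}) :
  (0 < d)%N -> (0 < e)%N -> u <= pi / 2 ->
  trig_int R d e u (jacobi_op R (e%:R / 2) (d%:R / 2) f) =
  - (2^-1 * f^`().[sin u ^+ 2] * (sin u ^+ d * cos u ^+ e)).
Proof.
case: d e => [|d] [|e] // _ _ u2.
pose F (t : R) := 2^-1 * (f^`().[sin t ^+ 2] * (sin t ^+ d.+1 * cos t ^+ e.+1)).
transitivity (F (pi / 2) - F u); last first.
  by rewrite /F cos_pihalf (expr0n _ e.+1) /= !mulr0 sub0r mulrA.
apply: seg_FTC => //; last exact: continuous_trig_integrand.
move=> t.
have ds n := is_derive_funX R _ t _ n (is_derive_sin t).
have dc n := is_derive_funX R _ t _ n (is_derive_cos t).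
have dh := @is_derive1_comp R (horner f^`()) _ t _ _ (is_derive_poly f^`() _) (ds 2%N).
have dF := is_derive_funZ R 2^-1 _ t _ (is_derive_funM R _ _ t _ _ dh
  (is_derive_funM R _ _ t _ _ (ds d.+1) (dc e.+1))).
apply: (is_derive_eq dF); rewrite /trig_weight /= horner_jacobi_op.
have c2 : cos t ^+ 2 = 1 - sin t ^+ 2 by rewrite -(cos2Dsin2 t) addrK.
rewrite -c2 -[e.+1%:R]natr1 -[d.+1%:R]natr1.
set p := f^`().[_]; set q := f^`()^`().[_].
rewrite !(exprS _ d) !(exprS _ e).
move: c2; move: (sin t) (cos t) => S C c2.
have -> : (d%:R + 1) / 2 - ((e%:R + 1) / 2 + (d%:R + 1) / 2) * S ^+ 2 =
    (d%:R + 1) / 2 * C ^+ 2 - (e%:R + 1) / 2 * S ^+ 2 by rewrite c2; field.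
by rewrite /= expr1; field.
Qed.

Lemma trig_weight_ge0 (R : realType) (d e : nat) (t : R) :
  0 <= t <= pi / 2 -> 0 <= trig_weight R d e t.
Proof.
move=> /andP[t0 t2]; rewrite mulr_ge0 // exprn_ge0 //.
  apply: sin_ge0_pi; rewrite t0 (le_trans t2) // ler_pdivrMr //.
  by rewrite ler_peMr ?pi_ge0 // ler1n.
by apply: cos_ge0_pihalf; rewrite t2 (le_trans _ t0) // oppr_le0 divr_ge0 // pi_ge0.
Qed.

Lemma seg_cst (R : realType) (c a b : R) : a <= b ->
  seg R (fun=> c) a b = c * (b - a).
Proof.
move=> ab.
have dF (x : R) : is_derive x (1 : R) (fun x => c * x) c.
  by have := is_derive_funZ R c id x 1 (is_derive_id x 1); rewrite mulr1.
rewrite mulrBr; apply: (seg_FTC R (fun x => c * x)) => //.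
exact: cst_continuous.
Qed.

Lemma trig_int1E (R : realType) (d e : nat) (u : R) :
  trig_int R d e u 1 = seg R (trig_weight R d e) u (pi / 2).
Proof. by apply: eq_seg => x _; rewrite -polyC1 hornerC mul1r. Qed.

Lemma sin_le_pihalf (R : realType) (s t : R) : 0 <= s -> s <= t -> t <= pi / 2 ->
  sin s <= sin t.
Proof.
move=> s0; rewrite le_eqVlt => /predU1P[->//|st] t2; apply: ltW.
have n0 : - (pi / 2) <= s by apply: (le_trans _ s0); rewrite oppr_le0; lra.
by rewrite ltr_sin // in_itv /=; apply/andP; split; lra.
Qed.

Lemma cos_le_pihalf (R : realType) (s t : R) : 0 <= s -> s <= t -> t <= pi / 2 ->
  cos t <= cos s.
Proof.
move=> s0; rewrite le_eqVlt => /predU1P[->//|st] t2; apply: ltW.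
have pi2 : pi = pi / 2 + pi / 2 :> R by field.
by rewrite ltr_cos // in_itv /=; apply/andP; split; lra.
Qed.

(** On the middle third of the interval, monotonicity of sine and cosine bounds the weight below by
    a positive constant. *)
Lemma trig_int_gt0 (R : realType) (d e : nat) (u : R) : 0 <= u < pi / 2 ->
  0 < trig_int R d e u 1.
Proof.
move=> /andP[u0 u2]; rewrite trig_int1E.
pose h := (pi / 2 - u) / 3.
have h0 : 0 < h by rewrite divr_gt0 // subr_gt0.
have ph : pi / 2 = u + 3 * h by rewrite /h; field.
pose v := u + h; pose w := u + 2 * h.
have v0 : 0 < v by rewrite /v; lra.
have vw : v <= w by rewrite /v /w; lra.
have w2 : w < pi / 2 by rewrite /w ph; lra.
have pp : (0 : R) <= pi / 2 by lra.
have lo : 0 < sin v ^+ d.-1 * cos w ^+ e.-1.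
  rewrite mulr_gt0 // exprn_gt0 //.
    by apply: sin_gt0_pihalf; rewrite v0 (le_lt_trans vw).
  by apply: cos_gt0_pihalf; rewrite w2 andbT; lra.
have cw := continuous_trig_weight R d e.
have nn (x y : R) : 0 <= x -> x <= y -> y <= pi / 2 ->
    0 <= seg R (trig_weight R d e) x y.
  move=> x0 xy y2; apply: Rintegral_ge0 => t /=; rewrite in_itv /= => /andP[xt ty].
  by apply: trig_weight_ge0; rewrite (le_trans x0) // (le_trans ty).
rewrite (seg_cat R _ u (pi / 2) v) //; last by rewrite /v ph; apply/andP; split; lra.
rewrite (seg_cat R _ v (pi / 2) w) //; last by rewrite vw ltW.
rewrite ltr_wpDl //; first by apply: nn; rewrite // /v; lra.
rewrite ltr_pwDl //; last by apply: nn; lra.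
apply: lt_le_trans (_ : 0 < sin v ^+ d.-1 * cos w ^+ e.-1 * (w - v)) _.
  by rewrite mulr_gt0 // /v /w; lra.
rewrite -seg_cst //; apply: le_seg => //; first exact: cst_continuous.
move=> t /andP[vt tw].
have sv : 0 <= sin v by apply: ltW; apply: sin_gt0_pihalf; rewrite v0 (le_lt_trans vw).
have cv : 0 <= cos w by apply: ltW; apply: cos_gt0_pihalf; rewrite w2 andbT; lra.
have t2 : t <= pi / 2 by lra.
have ss : sin v <= sin t by apply: sin_le_pihalf => //; lra.
have cc : cos w <= cos t by apply: cos_le_pihalf => //; lra.
rewrite ler_pM ?exprn_ge0 // lerXn2r ?nnegrE //.
  by rewrite (le_trans sv).
by rewrite (le_trans cv).
Qed.

(** * The cap bound *)

(** Cauchy-Schwarz, as nonnegativity of the variance of the weights around [1 / n]. *)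
Lemma sum_sqr_lower_bound (R : realType) (n : nat) (rho : 'I_n -> R) :
  \sum_i rho i = 1 -> 1 <= n%:R * \sum_i rho i ^+ 2.
Proof.
case: n rho => [|n] rho s1.
  by move: s1; rewrite big_ord0 => /eqP; rewrite eq_sym oner_eq0.
set N : R := n.+1%:R; have N0 : 0 < N by rewrite ltr0n.
have : 0 <= \sum_i (rho i - N^-1) ^+ 2 by apply: sumr_ge0 => i _; exact: sqr_ge0.
have -> : \sum_i (rho i - N^-1) ^+ 2 =
    \sum_i rho i ^+ 2 - 2 * N^-1 * \sum_i rho i + \sum_(i < n.+1) N^-1 ^+ 2.
  by rewrite mulr_sumr -sumrB -big_split /=; apply: eq_bigr => i _; ring.
have -> : \sum_(i < n.+1) N^-1 ^+ 2 = N^-1.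
  by rewrite sumr_const card_ord -[LHS]mulr_natl -/N; field; rewrite gt_eqF.
rewrite s1 mulr1.
move=> h; have : N^-1 <= \sum_i rho i ^+ 2.
  by move: N^-1 (\sum_i _) h => x y h; lra.
by rewrite -ler_pdivrMl // mulr1.
Qed.

Lemma sphere_nonempty (R : realType) (N : nat) : (0 < N)%N ->
  exists y, sphere R N y.
Proof.
case: N => // N _; exists [tuple (i == ord0)%:R | i < N.+1].
rewrite /sphere /= (bigD1 ord0) //= tnth_mktuple eqxx expr1n big1 ?addr0 //.
by move=> i /negPf i0; rewrite tnth_mktuple i0 expr0n.
Qed.

(** The energy bound with every mean written as a [trig_int] divided by the total mass [W]; the
    denominators are then cleared by [W ^ 2]. *)
Lemma cubature_energy_bound (R : realType) (K : kfield) (m k : nat)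
  (sigma : probability ((kdim K * m).-tuple R) R)
  (n : nat) (x : 'I_n -> (kdim K * m).-tuple R) (rho : 'I_n -> R) (G : {poly R}) :
  let d := kdim K in let e := (kdim K * (m - 1))%N in
  let a : R := e%:R / 2 in let b : R := d%:R / 2 in
  let lam := jacobi_eigenvalue R a b k.+1 in
  let X := jacobi_op R a b G + lam *: G in
  (2 <= m)%N -> normalized_rotation_invariant R (kdim K * m) sigma ->
  proj_cubature R K m (k * 2) sigma n x rho ->
  (forall s : R, 0 <= s <= 1 -> 0 <= G.[s]) ->
  (forall s : R, 0 <= s <= 1 -> 0 <= X.[s]) ->
  trig_int R d e 0 1 * trig_int R d e 0 (G * X) <=
  n%:R * (lam * trig_int R d e 0 G ^+ 2).
Proof.
move=> d e a b lam X m2 inv cub G0 X0.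
have [Sx _ rho0 _] := cub.
have d0 : (0 < d)%N := kdim_gt0 K.
have e0 : (0 < e)%N by rewrite muln_gt0 d0 subn_gt0.
have a0 : 0 < a by rewrite divr_gt0 // ltr0n.
have b0 : 0 < b by rewrite divr_gt0 // ltr0n.
have aE : ((kdim K * m)%:R - (kdim K)%:R) / 2 = a.
  by rewrite /a /e natrM natrM natrB ?(ltnW m2) // mulrBr mulr1.
have pp : (0 : R) <= pi / 2 by rewrite divr_ge0 // pi_ge0.
have [y0 Sy0] : exists y, sphere R (kdim K * m) y.
  by apply: sphere_nonempty; rewrite muln_gt0 d0 (ltnW m2).
set W := trig_int R d e 0 1.
have W0 : 0 < W.
  by apply: trig_int_gt0; rewrite lexx /= divr_gt0 // pi_gt0.
have killF f : trig_int R d e 0 (jacobi_op R a b f) = 0.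
  by rewrite trig_int_jacobi_op // sin0 cos0 (expr0n _ d) gtn_eqF //= mul0r mulr0 oppr0.
have meanE (y : (kdim K * m).-tuple R) f : sphere R _ y ->
    mean sigma (fun z => f.[zonal R _ _ (kform R K m y) z]) = trig_int R d e 0 f / W.
  move=> Sy; apply: (canRL (mulfK (lt0r_neq0 W0))).
  have := mean_zonal_indep R _ _ sigma (trig_int R d e 0) (kform R K m y).
  rewrite /= aE; apply => //.
  - exact: kform_orthonormal.
  - exact: trig_intD.
  - exact: trig_intZ.
(* The cubature formula for the constant polynomial 1, which homogenizes to [|y|^(2k)]. *)
have sum1 : \sum_i rho i = 1.
  have := cubature_zonal R K m k sigma n x rho 1 y0 cub _ Sy0.
  rewrite size_poly1 meanE // divff ?gt_eqF // => /(_ isT) <-.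
  by apply: eq_bigr => i _; rewrite -polyC1 hornerC mulr1.
have := zonal_energy_bound R (kdim K * m) (kdim K) n k sigma
  (fun i => kform R K m (x i)) (kform R K m y0) rho G.
rewrite /= aE -/b -/lam -/X => /(_ a0 b0 inv).
move=> /(_ (fun i => kform_orthonormal R K m (x i) (Sx i)) (kform_orthonormal R K m y0 Sy0)).
move=> /(_ (fun i => ltW (rho0 i))) h.
have {}h := h _ G0 X0.
have {h} : \sum_i rho i ^+ 2 * (trig_int R d e 0 (G * X) / W) <=
    lam * (trig_int R d e 0 G / W) ^+ 2.
  rewrite -(meanE y0) // -[X in _ <= lam * X ^+ 2](meanE y0) //.
  apply: le_trans (h _); last first.
    move=> f sf y Sy; rewrite (cubature_zonal R K m k sigma n x rho f y cub sf Sy).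
    by rewrite !meanE.
  rewrite le_eqVlt; apply/orP; left; apply/eqP; apply: eq_bigr => i _.
  by rewrite meanE // meanE.
rewrite -mulr_suml => h.
have GX0 : 0 <= trig_int R d e 0 (G * X).
  apply: Rintegral_ge0 => t /=; rewrite in_itv /= => t02.
  rewrite mulr_ge0 ?trig_weight_ge0 // hornerM mulr_ge0 // ?G0 ?X0 //;
  by rewrite sqr_ge0 /= -(cos2Dsin2 t) lerDr sqr_ge0.
have s2 := sum_sqr_lower_bound R n rho sum1.
have h2 : trig_int R d e 0 (G * X) / W <=
    n%:R * (lam * (trig_int R d e 0 G / W) ^+ 2).
  apply: le_trans (ler_wpM2l (ler0n _ n) h).
  rewrite [leRHS]mulrA -[leLHS]mul1r.
  by apply: ler_wpM2r => //; exact: divr_ge0 GX0 (ltW W0).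
move: h2; rewrite ler_pdivrMr // => h2.
rewrite -ler_pdivlMl //; apply: le_trans h2 _.
by rewrite le_eqVlt; apply/orP; left; apply/eqP; field; rewrite gt_eqF.
Qed.

Lemma trig_int_seg_ge (R : realType) (d e : nat) (u v : R) (f g : {poly R}) :
  0 <= u -> v <= pi / 2 -> (forall t, u <= t <= v -> f.[sin t ^+ 2] <= g.[sin t ^+ 2]) ->
  seg R (fun t => f.[sin t ^+ 2] * trig_weight R d e t) u v <=
  seg R (fun t => g.[sin t ^+ 2] * trig_weight R d e t) u v.
Proof.
move=> u0 v2 fg; apply: le_seg; try exact: continuous_trig_integrand.
move=> t /andP[ut tv]; rewrite ler_wpM2r ?fg ?ut //.
by apply: trig_weight_ge0; rewrite (le_trans u0) // (le_trans tv).
Qed.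

Lemma cubature_cap_bound (R : realType) (K : kfield) (m k : nat)
  (sigma : probability ((kdim K * m).-tuple R) R)
  (n : nat) (x : 'I_n -> (kdim K * m).-tuple R) (rho : 'I_n -> R) (u : R) :
  let d := kdim K in let e := (kdim K * (m - 1))%N in
  let a : R := e%:R / 2 in let b : R := d%:R / 2 in
  (2 <= m)%N -> normalized_rotation_invariant R (kdim K * m) sigma ->
  proj_cubature R K m (k * 2) sigma n x rho ->
  (jacobi01 R a b k).[sin u ^+ 2] = 0 ->
  (forall t, (jacobi01 R a b k).[t] = 0 -> t <= sin u ^+ 2) ->
  0 <= u < pi / 2 ->
  trig_int R d e 0 1 <= n%:R * trig_int R d e u 1.
Proof.
move=> d e a b m2 inv cub Qc cmax u02; have /andP[u0 u2] := u02.
set c := sin u ^+ 2 in Qc cmax.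
have d0 : (0 < d)%N := kdim_gt0 K.
have e0 : (0 < e)%N by rewrite muln_gt0 d0 subn_gt0.
have a0 : 0 < a by rewrite divr_gt0 // ltr0n.
have b0 : 0 < b by rewrite divr_gt0 // ltr0n.
have [c01 [q [qc q'c qpos Lq]]] := jacobi01_extremal R a b k c a0 b0 Qc cmax.
have /andP[c0 c1] := c01.
set lam := k.+1%:R * (k%:R + a + b) in Lq.
have lamE : lam = jacobi_eigenvalue R a b k.+1.
  by rewrite /lam /jacobi_eigenvalue -natr1; ring.
have lam0 : 0 < lam by rewrite mulr_gt0 ?ltr0n // -addrA ltr_wpDl // addr_gt0.
have [C C0 hC] := truncated_approx R a b lam c q a0 b0 lam0 c01 qc q'c qpos Lq.
set W := trig_int R d e 0 1; set J := trig_int R d e u 1.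
have pp : (0 : R) < pi / 2 by rewrite divr_gt0 // pi_gt0.
have W0 : 0 < W by apply: trig_int_gt0; rewrite lexx.
have J0 : 0 < J by exact: trig_int_gt0.
(* Integrate [L q + lam q = lam] over the cap: the boundary term of [L q] contains [q'(c) = 0]. *)
have Jq : trig_int R d e u q = J.
  apply: (mulfI (lt0r_neq0 lam0)); rewrite -!trig_intZ.
  rewrite (_ : lam *: (1 : {poly R}) = jacobi_op R a b q + lam *: q); last first.
    by rewrite Lq alg_polyC.
  rewrite trig_intD trig_int_jacobi_op // ?(ltW u2) // -/c q'c.
  by rewrite mulr0 mul0r oppr0 add0r.
have s01 (t : R) : 0 <= sin t ^+ 2 <= 1.
  by rewrite sqr_ge0 -(cos2Dsin2 t) lerDr sqr_ge0.
have up : 0 <= u <= pi / 2 by rewrite u0 ltW.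
have split_int f : trig_int R d e 0 f =
    seg R (fun t => f.[sin t ^+ 2] * trig_weight R d e t) 0 u + trig_int R d e u f.
  by apply: seg_cat => //; exact: continuous_trig_integrand.
have below t : 0 <= t <= u -> sin t ^+ 2 <= c.
  move=> /andP[t0 tu]; have h := sin_le_pihalf R t u t0 tu (ltW u2).
  have st : 0 <= sin t.
    by rewrite -(sin0 R) sin_le_pihalf // (le_trans tu) // ltW.
  by rewrite /c lerXn2r // nnegrE // (le_trans st).
have above t : u <= t <= pi / 2 -> c <= sin t ^+ 2.
  move=> /andP[ut t2]; have h := sin_le_pihalf R u t u0 ut t2.
  have st : 0 <= sin u by rewrite -(sin0 R) sin_le_pihalf // ltW.
  by rewrite /c lerXn2r // nnegrE // (le_trans st).
have tr0 s : s <= c -> truncated R c q s = 0 by move=> sc; rewrite /truncated sc.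
have trq s : c <= s -> truncated R c q s = q.[s].
  rewrite le_eqVlt => /predU1P[<-|cs]; first by rewrite tr0.
  by rewrite /truncated leNgt cs.
have trC v r : trig_int R d e v r%:P = r * trig_int R d e v 1.
  by rewrite -alg_polyC trig_intZ.
pose S (f : {poly R}) := seg R (fun t => f.[sin t ^+ 2] * trig_weight R d e t) 0 u.
have SC r : S r%:P = r * (W - J).
  have h := split_int r%:P; rewrite (trC 0 r) (trC u r) in h.
  have {}h : r * W = S r%:P + r * J := h.
  by rewrite mulrBr h addrK.
(* The energy bound for the approximating polynomial, with errors of order [z]. As [z] tends to 0 it
   becomes [W lam J <= n lam J ^ 2], from which [lam J] is cancelled. *)
have key (z : R) : 0 < z -> c + z <= 1 ->
    W * (lam * J - C * z * W) <= n%:R * (lam * (J + C * z * W) ^+ 2).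
  move=> z0 cz; have [G hG] := hC z z0 cz.
  have Gpos (s : R) : 0 <= s <= 1 -> 0 <= G.[s] by move=> /hG[].
  have Xpos (s : R) : 0 <= s <= 1 -> 0 <= (jacobi_op R a b G + lam *: G).[s].
    by move=> /hG[].
  have E := cubature_energy_bound R K m k sigma n x rho G m2 inv cub Gpos.
  rewrite -/d -/e -/a -/b -lamE in E.
  have {}E := E Xpos.
  set X := _ + _ in E Xpos hG.
  have lower : lam * J - C * z * W <= trig_int R d e 0 (G * X).
    have -> : lam * J - C * z * W =
        S (- (C * z))%:P + trig_int R d e u (lam *: q + (- (C * z))%:P).
      by rewrite SC trig_intD trig_intZ trC Jq -/J; ring.
    rewrite (split_int (G * X)); apply: lerD.
      apply: trig_int_seg_ge => [//||t tu]; first exact: ltW.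
      rewrite hornerC.
      have [_ _ _] := hG _ (s01 t); rewrite tr0 ?below // mulr0 sub0r.
      by rewrite hornerM.
    apply: trig_int_seg_ge => // t tu; rewrite hornerD hornerZ hornerC hornerM.
    by have [_ _ _] := hG _ (s01 t); rewrite trq ?above.
  have upper : trig_int R d e 0 G <= J + C * z * W.
    have -> : J + C * z * W = S (C * z)%:P + trig_int R d e u (q + (C * z)%:P).
      by rewrite SC trig_intD trC Jq -/J; ring.
    rewrite (split_int G); apply: lerD.
      apply: trig_int_seg_ge => [//||t tu]; first exact: ltW.
      rewrite hornerC.
      by have [_ _] := hG _ (s01 t); rewrite tr0 ?below // add0r.
    apply: trig_int_seg_ge => // t tu; rewrite hornerD hornerC.
    by have [_ _] := hG _ (s01 t); rewrite trq ?above.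
  have G0 : 0 <= trig_int R d e 0 G.
    apply: Rintegral_ge0 => t /=; rewrite in_itv /= => t02.
    by rewrite mulr_ge0 ?trig_weight_ge0 // Gpos.
  apply: le_trans (ler_wpM2l (ltW W0) lower) (le_trans E _).
  rewrite ler_wpM2l // ler_wpM2l ?(ltW lam0) // lerXn2r // nnegrE.
  exact: le_trans upper.
suff : W * (lam * J) <= n%:R * (lam * J ^+ 2).
  have -> : W * (lam * J) = (lam * J) * W by ring.
  have -> : n%:R * (lam * J ^+ 2) = (lam * J) * (n%:R * J) by ring.
  by rewrite ler_pM2l // mulr_gt0.
(* The sum of all error coefficients, the quadratic one included, because [z <= 1] gives
   [z ^ 2 <= z]. *)
pose M := n%:R * lam * (2 * J * (C * W) + (C * W) ^+ 2) + W * C * W.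
have CW0 : 0 <= C * W by rewrite mulr_ge0 // ltW.
have M0 : 0 <= M.
  rewrite addr_ge0 //; last by rewrite -mulrA mulr_ge0 // ltW.
  apply: mulr_ge0; first by rewrite mulr_ge0 // ltW.
  by apply: addr_ge0 (sqr_ge0 _); apply: mulr_ge0 CW0; rewrite mulr_ge0 // ltW.
apply/ler_addgt0Pr => eta eta0.
pose z := Num.min (1 - c) (eta / (M + 1)).
have M1 : 0 < M + 1 by rewrite ltr_wpDl.
have z0 : 0 < z by rewrite lt_min subr_gt0 c1 divr_gt0.
have zc : c + z <= 1 by rewrite -lerBrDl ge_min lexx.
have z1 : z <= 1 by apply: le_trans zc; rewrite lerDr ltW.
have zM : M * z <= eta.
  apply: (@le_trans _ _ ((M + 1) * z)); first by rewrite ler_wpM2r ?(ltW z0) // lerDl.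
  by rewrite mulrC -ler_pdivlMr // ge_min lexx orbT.
have zz : z ^+ 2 <= z by rewrite expr2 ler_piMr // ltW.
have h2 : n%:R * lam * (C * W) ^+ 2 * z ^+ 2 <= n%:R * lam * (C * W) ^+ 2 * z.
  apply: ler_wpM2l => //; apply: mulr_ge0 (sqr_ge0 _).
  by rewrite mulr_ge0 // ltW.
have := key z z0 zc.
have -> : W * (lam * J - C * z * W) = W * (lam * J) - W * C * W * z by ring.
have -> : n%:R * (lam * (J + C * z * W) ^+ 2) = n%:R * (lam * J ^+ 2) +
    n%:R * lam * (2 * J * (C * W)) * z + n%:R * lam * (C * W) ^+ 2 * z ^+ 2 by ring.
have ME : M * z = n%:R * lam * (2 * J * (C * W)) * z +
    n%:R * lam * (C * W) ^+ 2 * z + W * C * W * z by rewrite /M; ring.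
move: zM; rewrite ME.
move: h2 (W * (lam * J)) (n%:R * (lam * J ^+ 2)).
move: (n%:R * lam * (2 * J * (C * W)) * z) (n%:R * lam * (C * W) ^+ 2 * z).
move: (W * C * W * z) (n%:R * lam * (C * W) ^+ 2 * z ^+ 2).
by clear; move=> *; lra.
Qed.

(** * The hypergeometric function *)

Lemma cvg_geometric_bound (R : realType) (F : nat -> R) (L M s : R) (n0 : nat) :
  0 <= s < 1 -> (forall n, (n0 <= n)%N -> `|F n - L| <= M * s ^+ n) ->
  F @ \oo --> L.
Proof.
move=> /andP[s0 s1] h; apply/cvgrPdist_le => e e0.
have g : (fun n => M * s ^+ n) @ \oo --> (0 : R).
  by apply: cvg_geometric; rewrite ger0_norm.
move/cvgrPdist_le : g => /(_ e e0) g.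
near=> n; rewrite distrC; apply: le_trans (h n _) _; first by near: n; exact: nbhs_infty_ge.
have : `|0 - M * s ^+ n| <= e by near: n.
by rewrite sub0r normrN; apply: le_trans; exact: ler_norm.
Unshelve. all: by end_near. Qed.

Definition binomial_coef (R : realType) (b : R) (k : nat) : R :=
  pochhammer R b k / k`!%:R.

(* Truncation of the binomial series of [(1 - s) ^ (- b)]. *)
Definition binomial_poly (R : realType) (b : R) (n : nat) : {poly R} :=
  \sum_(0 <= k < n) binomial_coef R b k *: 'X^k.

Lemma binomial_coef0 (R : realType) (b : R) : binomial_coef R b 0 = 1.
Proof. by rewrite /binomial_coef /pochhammer big_ord0 fact0 divr1. Qed.

Lemma binomial_coefS (R : realType) (b : R) k :
  k.+1%:R * binomial_coef R b k.+1 = (b + k%:R) * binomial_coef R b k.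
Proof.
rewrite /binomial_coef /pochhammer big_ord_recr /= factS natrM.
have h1 : (k`!%:R : R) != 0 by rewrite pnatr_eq0 -lt0n fact_gt0.
have h2 : (k.+1%:R : R) != 0 by rewrite pnatr_eq0.
by field; rewrite h1 addrC natr1 h2.
Qed.

Lemma binomial_coef_01 (R : realType) (b : R) k : 0 <= b <= 1 ->
  0 <= binomial_coef R b k <= 1.
Proof.
move=> /andP[b0 b1]; elim: k => [|k /andP[c0 c1]].
  by rewrite binomial_coef0 ler01 lexx.
have k0 : 0 < k.+1%:R :> R by rewrite ltr0n.
have kb : b + k%:R <= k.+1%:R by rewrite -natr1 addrC lerD2l.
have bk : 0 <= b + k%:R by rewrite addr_ge0.
have -> : binomial_coef R b k.+1 = (b + k%:R) * binomial_coef R b k / k.+1%:R.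
  by rewrite -binomial_coefS mulrAC mulfV ?mul1r // gt_eqF.
apply/andP; split; first exact: divr_ge0 (mulr_ge0 bk c0) (ltW k0).
by rewrite ler_pdivrMr // mul1r (le_trans _ kb) // ler_piMr.
Qed.

(** The function [(1 - s)^(-b)] satisfies [b y = (1 - s) y']; truncating its series leaves a defect
    in the top degree only. *)
Lemma binomial_poly_ode (R : realType) (b : R) n :
  b *: binomial_poly R b n - (1 - 'X) * (binomial_poly R b n)^`() =
  (n%:R * binomial_coef R b n) *: 'X^(n.-1).
Proof.
elim: n => [|n ih].
  by rewrite /binomial_poly big_geq // deriv0 scaler0 mulr0 mul0r scale0r subr0.
rewrite binomial_coefS /binomial_poly big_nat_recr //= -/(binomial_poly R b n).
rewrite derivD derivZ derivXn -[_ *+ n]scaler_nat.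
have -> : b *: (binomial_poly R b n + binomial_coef R b n *: 'X^n) -
   (1 - 'X) * ((binomial_poly R b n)^`() + binomial_coef R b n *: (n%:R *: 'X^(n.-1))) =
   (b *: binomial_poly R b n - (1 - 'X) * (binomial_poly R b n)^`()) +
   (b *: (binomial_coef R b n *: 'X^n) - (1 - 'X) * (binomial_coef R b n *: (n%:R *: 'X^(n.-1)))).
  by rewrite -!mul_polyC; ring.
rewrite ih; case: n {ih} => [|n] /=.
  by rewrite -!mul_polyC expr0 !(polyCM, polyCD, polyC_natr); ring.
by rewrite -!mul_polyC exprS !(polyCM, polyCD, polyC_natr); ring.
Qed.

Lemma horner_binomial_poly (R : realType) (b r : R) n :
  (binomial_poly R b n).[r] = \sum_(0 <= k < n) binomial_coef R b k * r ^+ k.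
Proof.
rewrite /binomial_poly horner_sum; apply: eq_bigr => k _.
by rewrite hornerZ hornerXn.
Qed.

(** The quotient of the Pochhammer symbols of [a] and [a + 1] telescopes, leaving the binomial
    series with factors [a / (a + k)] produced by integrating term by term. *)
Lemma hyp2F1_term (R : realType) (b a z : R) k : 0 < a ->
  pochhammer R b k * pochhammer R a k / (pochhammer R (a + 1) k * k`!%:R) * z ^+ k =
  binomial_coef R b k * (a / (a + k%:R)) * z ^+ k.
Proof.
move=> a0; congr (_ * _); rewrite /binomial_coef.
have pos (x : R) (i : nat) : 0 < x -> x + i%:R != 0.
  by move=> x0; rewrite gt_eqF // ltr_wpDr.
have p0 (x : R) : 0 < x -> pochhammer R x k != 0.
  by move=> x0; apply/prodf_neq0 => i _; exact: pos.
have e : pochhammer R a k * (a + k%:R) = a * pochhammer R (a + 1) k.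
  transitivity (\prod_(i < k.+1) (a + i%:R)); first by rewrite big_ord_recr.
  rewrite big_ord_recl addr0 /pochhammer.
  by congr (_ * _); apply: eq_bigr => i _; rewrite /= -natr1; ring.
have e2 : pochhammer R a k / pochhammer R (a + 1) k = a / (a + k%:R).
  have ak := pos a k a0.
  have a1 : pochhammer R (a + 1) k != 0 by apply: p0; rewrite addr_gt0.
  by apply/eqP; rewrite eqr_div //; apply/eqP.
have k0 : (k`!%:R : R) != 0 by rewrite pnatr_eq0 -lt0n fact_gt0.
rewrite -e2; field.
by rewrite k0 p0 // addr_gt0.
Qed.

Lemma continuous_horner_comp (R : realType) (p : {poly R}) (f : R -> R) :
  continuous f -> continuous (fun t => p.[f t]).
Proof.
move=> cf x; apply: (@continuous_comp _ _ _ f (horner p)); first exact: cf.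
exact: continuous_horner.
Qed.

Lemma continuous_binomial_integrand (R : realType) (p : {poly R}) (e : nat) :
  continuous (fun t : R => sin t * cos t ^+ e * p.[cos t ^+ 2]).
Proof.
apply: continuous_mul; last first.
  exact/continuous_horner_comp/continuous_pow/continuous_cos.
apply: continuous_mul; first exact: continuous_sin.
exact/continuous_pow/continuous_cos.
Qed.

Lemma seg_sin_cos (R : realType) (u : R) (n : nat) : u <= pi / 2 ->
  seg R (fun t => sin t * cos t ^+ n) u (pi / 2) = cos u ^+ n.+1 / n.+1%:R.
Proof.
move=> u2; have n0 : n.+1%:R != 0 :> R by rewrite pnatr_eq0.
transitivity (- (n.+1%:R)^-1 * cos (pi / 2) ^+ n.+1 - - (n.+1%:R)^-1 * cos u ^+ n.+1);
  last by rewrite cos_pihalf expr0n /= mulr0 sub0r mulNr opprK mulrC.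
apply: (seg_FTC R (fun t => - (n.+1%:R)^-1 * cos t ^+ n.+1)) => //.
  move=> t; have := is_derive_funZ R (- (n.+1%:R)^-1) _ t _
    (is_derive_funX R _ t _ n.+1 (is_derive_cos t)).
  by move=> h; apply: (is_derive_eq h) => /=; field; rewrite addrC natr1.
apply: continuous_mul; first exact: continuous_sin.
exact/continuous_pow/continuous_cos.
Qed.

Lemma seg_binomial_poly (R : realType) (b u : R) (e n : nat) : (0 < e)%N ->
  u <= pi / 2 ->
  seg R (fun t => sin t * cos t ^+ e.-1 * (binomial_poly R b n).[cos t ^+ 2]) u (pi / 2) =
  cos u ^+ e / e%:R * \sum_(0 <= k < n)
    binomial_coef R b k * (e%:R / 2 / (e%:R / 2 + k%:R)) * (cos u ^+ 2) ^+ k.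
Proof.
move=> e0 u2; elim: n => [|n ih].
  rewrite big_geq // mulr0 (eq_seg R _ (fun=> 0)); first by rewrite seg_cst ?mul0r.
  by move=> t _; rewrite /binomial_poly big_geq // horner0 mulr0.
have term t : sin t * cos t ^+ e.-1 * (binomial_poly R b n.+1).[cos t ^+ 2] =
    sin t * cos t ^+ e.-1 * (binomial_poly R b n).[cos t ^+ 2] +
    binomial_coef R b n * (sin t * cos t ^+ (e.-1 + 2 * n)).
  rewrite /binomial_poly big_nat_recr //= hornerD hornerZ hornerXn exprD -exprM.
  by rewrite mulrDr; congr (_ + _); ring.
have c2 m : continuous (fun t : R => sin t * cos t ^+ m).
  apply: continuous_mul; first exact: continuous_sin.
  exact/continuous_pow/continuous_cos.
under eq_fun do rewrite term.
rewrite segD; first last.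
- by apply: continuous_mul => //; exact: cst_continuous.
- exact: continuous_binomial_integrand.
rewrite segZ // ih big_nat_recr //= mulrDr; congr (_ + _).
rewrite seg_sin_cos // -addSn prednK // exprD exprM.
rewrite -[(e + 2 * n)%:R]/(_) natrD natrM.
have e1 : (e%:R : R) != 0 by rewrite pnatr_eq0 -lt0n.
have e2 : (e%:R : R) + 2 * n%:R != 0.
  by rewrite gt_eqF // ltr_wpDr ?ltr0n // mulr_ge0.
by field; rewrite [n%:R * 2]mulrC e2 e1.
Qed.

Lemma nat_mul_expr_le (R : realType) (s : R) : 0 < s < 1 ->
  exists2 M : R, 0 <= M & forall n : nat, n%:R * s ^+ n <= M.
Proof.
move=> /andP[s0 s1]; pose h := s^-1 - 1.
have h0 : 0 < h by rewrite subr_gt0 invf_gt1.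
exists h^-1; first by rewrite invr_ge0 ltW.
move=> n; have := bernoulli_inequality R h n ltac:(lra).
rewrite /h addrCA subrr addr0 exprVn -/h => b.
have sn : 0 < s ^+ n by rewrite exprn_gt0.
rewrite -[leRHS]mul1r ler_pdivlMr // mulrAC.
have : (1 + n%:R * h) * s ^+ n <= 1 by rewrite -ler_pdivlMr // mul1r.
by rewrite mulrDl mul1r; move: (s ^+ n) (n%:R * h * _) sn => x y x0; lra.
Qed.

(** The polynomial truncates [(1 - cos^2 t)^(-1/2) = 1 / sin t]. The error is found by integrating
    the derivative of the product from [t] to [pi / 2], where the product equals 1. *)
Lemma binomial_poly_sin (R : realType) (u : R) : 0 < u < pi / 2 ->
  exists M : R, forall n t, (0 < n)%N -> u <= t <= pi / 2 ->
  `|1 - sin t * (binomial_poly R (1 / 2) n).[cos t ^+ 2]| <= M * cos u ^+ n.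
Proof.
move=> /andP[u0 u2].
pose s := cos u.
have s0 : 0 < s by apply: cos_gt0_pihalf; rewrite u2 andbT; lra.
have s1 : s < 1.
  by rewrite -(cos0 R) ltr_cos ?in_itv //=; apply/andP; split; lra.
have [M M0 hM] := nat_mul_expr_le R s ltac:(by rewrite s0).
exists (2 * M / s * 2) => n t n0 /andP[ut t2].
pose p := binomial_poly R (1 / 2) n.
(* By [binomial_poly_ode] at [b = 1/2], the derivative of [sin z p(cos^2 z)] reduces to this single
   term. *)
pose g (z : R) := cos z * (2 * (n%:R * binomial_coef R (1 / 2) n) * (cos z ^+ 2) ^+ n.-1).
have dG (z : R) : is_derive z (1 : R) (fun z => sin z * p.[cos z ^+ 2]) (g z).
  have dc := is_derive_funX R _ z _ 2%N (is_derive_cos z).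
  have dp := @is_derive1_comp R (horner p) _ z _ _ (is_derive_poly p _) dc.
  apply: (is_derive_eq (is_derive_funM R _ _ z _ _ (is_derive_sin z) dp)) => /=.
  have := congr1 (fun f : {poly R} => f.[cos z ^+ 2]) (binomial_poly_ode R (1 / 2) n).
  rewrite -/p hornerD hornerN !hornerZ hornerM hornerD hornerN -polyC1 hornerC hornerX hornerXn.
  rewrite /g -[2 * (_ * _) * _]mulrA => <-.
  have sc : sin z ^+ 2 = 1 - cos z ^+ 2 by rewrite -(cos2Dsin2 z) addrC addKr.
  by rewrite -sc expr1; field.
have cg : continuous g.
  apply: continuous_mul; first exact: continuous_cos.
  apply: continuous_mul; first exact: cst_continuous.
  exact/continuous_pow/continuous_pow/continuous_cos.
have p0 : p.[0] = 1.
  rewrite /p horner_binomial_poly big_ltn // expr0 mulr1 binomial_coef0.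
  by rewrite big_nat_cond big1 ?addr0 // => i /andP[/andP[i0 _] _];
    rewrite expr0n gtn_eqF // mulr0.
have e : 1 - sin t * p.[cos t ^+ 2] = seg R g t (pi / 2).
  rewrite (seg_FTC R _ g _ _ t2 dG cg) sin_pihalf cos_pihalf expr0n /= p0.
  by rewrite mulr1.
have /andP[c0 c1] : 0 <= binomial_coef R (1 / 2) n <= 1.
  by apply: binomial_coef_01; apply/andP; split; lra.
have gb (z : R) : t <= z <= pi / 2 -> 0 <= g z <= 2 * M / s * s ^+ n.
  move=> /andP[tz z2].
  have cz0 : 0 <= cos z by apply: cos_ge0_pihalf; apply/andP; split; lra.
  have czs : cos z <= s by apply: cos_le_pihalf; lra.
  have cc : 0 <= (cos z ^+ 2) ^+ n.-1 by apply: exprn_ge0; exact: exprn_ge0.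
  have nc : 0 <= n%:R * binomial_coef R (1 / 2) n by exact: mulr_ge0.
  have nc2 : 0 <= 2 * (n%:R * binomial_coef R (1 / 2) n) by exact: mulr_ge0.
  apply/andP; split; first exact: mulr_ge0 cz0 (mulr_ge0 nc2 cc).
  apply: (@le_trans _ _ (s * (2 * (n%:R * 1) * (s ^+ 2) ^+ n.-1))).
    apply: (ler_pM cz0 _ czs); first exact: mulr_ge0.
    apply: ler_pM => //.
      by apply: ler_wpM2l => //; apply: ler_wpM2l.
    have cs2 : cos z ^+ 2 <= s ^+ 2 by rewrite lerXn2r ?nnegrE // ltW.
    have cz2 : 0 <= cos z ^+ 2 by exact: exprn_ge0.
    by rewrite lerXn2r // nnegrE (le_trans cz2).
  (* Of the power [s^(2n-1)], one factor [s^n] absorbs the [n] in front through [M], and the other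
     provides the geometric decay. *)
  have -> : s * (2 * (n%:R * 1) * (s ^+ 2) ^+ n.-1) = 2 * (n%:R * s ^+ n) / s * s ^+ n.
    rewrite -[in X in _ = X](prednK n0) -[in X in X = _](prednK n0) /= -exprM.
    rewrite mul2n -addnn exprD !exprS; field.
    by rewrite gt_eqF.
  rewrite ler_wpM2r ?exprn_ge0 ?(ltW s0) // ler_wpM2r ?invr_ge0 ?(ltW s0) //.
  by rewrite ler_wpM2l.
rewrite -/p e ger0_norm; last first.
  by apply: Rintegral_ge0 => z /=; rewrite in_itv /= => /gb /andP[].
apply: (@le_trans _ _ (seg R (fun=> 2 * M / s * s ^+ n) t (pi / 2))).
  apply: le_seg => //; first exact: cst_continuous.
  by move=> z /gb /andP[].
rewrite seg_cst // -/s [leRHS]mulrAC; apply: ler_wpM2l.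
  by rewrite mulr_ge0 ?exprn_ge0 ?(ltW s0) // divr_ge0 ?(ltW s0) // mulr_ge0.
by have := pihalf_lt2 R; lra.
Qed.

(** Here [sin^(d-1) t = sin t (1 - cos^2 t)^(-b)] with [b] equal to [1/2], [0] or [-1]. In the last
    two cases the series terminates, with at most two terms, and the error is zero. *)
Lemma binomial_poly_kdim (R : realType) (K : kfield) (u : R) : 0 < u < pi / 2 ->
  exists M : R, forall n t, (1 < n)%N -> u <= t <= pi / 2 ->
  `|sin t ^+ (kdim K).-1 -
    sin t * (binomial_poly R (- (((kdim K)%:R - 2) / 2)) n).[cos t ^+ 2]| <=
    M * cos u ^+ n.
Proof.
move=> u02; case: K => /=.
- have [M hM] := binomial_poly_sin R u u02; exists M => n t n1 ut.
  have -> : - ((1 - 2) / 2) = 1 / 2 :> R by field.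
  by rewrite expr0; apply: hM => //; exact: ltnW.
- exists 0 => n t n1 ut; rewrite mul0r subrr mul0r oppr0 expr1.
  case: n n1 => // n _; rewrite horner_binomial_poly big_ltn // expr0 mulr1 binomial_coef0.
  rewrite big_nat_cond big1 ?addr0 ?mulr1 ?subrr ?normr0 // => i /andP[/andP[i0 _] _].
  case: i i0 => // i _; rewrite /binomial_coef /pochhammer big_ord_recl addr0.
  by rewrite !mul0r.
- exists 0 => n t n1 ut; rewrite mul0r.
  have -> : - ((4%:R - 2) / 2) = - 1 :> R by field.
  case: n n1 => [|[|n]] // _; rewrite horner_binomial_poly 2?big_ltn // expr0 mulr1 binomial_coef0.
  rewrite big_nat_cond big1 ?addr0 => [|i /andP[/andP[i0 _] _]]; last first.
    case: i i0 => [|[|i]] // _; rewrite /binomial_coef /pochhammer !big_ord_recl /=.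
    by rewrite addNr !(mul0r, mulr0).
  have -> : binomial_coef R (- 1) 1 = - 1.
    by rewrite /binomial_coef /pochhammer big_ord1 addr0 (_ : 1`! = 1%N) // divr1.
  have -> : sin t ^+ 3 = sin t * (1 - cos t ^+ 2).
    by rewrite exprS -(cos2Dsin2 t) addrC addKr.
  by rewrite expr1 mulN1r subrr normr0.
Qed.

(** The partial sums are, up to a factor, integrals over the cap with the truncated series in place
    of the power of sine. There [cos t <= cos u < 1], so the errors decay geometrically; this also
    establishes the convergence behind [limn]. *)
Lemma hyp2F1_trig (R : realType) (K : kfield) (e : nat) (u : R) :
  (0 < e)%N -> 0 < u < pi / 2 ->
  hyp2F1 R (- (((kdim K)%:R - 2) / 2)) (e%:R / 2) (e%:R / 2 + 1) (cos u ^+ 2) =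
  e%:R * trig_int R (kdim K) e u 1 / cos u ^+ e.
Proof.
move=> e0 u02; have /andP[u0 u2] := u02.
set d := kdim K; set b := - _.
set s := cos u.
have s0 : 0 < s by apply: cos_gt0_pihalf; rewrite u2 andbT; lra.
have s1 : s < 1.
  by rewrite -(cos0 R) ltr_cos ?in_itv //=; apply/andP; split; lra.
have a0 : 0 < e%:R / 2 :> R by rewrite divr_gt0 // ltr0n.
have er0 : 0 < e%:R :> R by rewrite ltr0n.
have [M hM] := binomial_poly_kdim R K u u02.
have se0 : 0 < s ^+ e by rewrite exprn_gt0.
pose F n := \sum_(0 <= k < n)
    binomial_coef R b k * (e%:R / 2 / (e%:R / 2 + k%:R)) * (s ^+ 2) ^+ k.
rewrite /hyp2F1.
rewrite (_ : (fun n => _) = F); last first.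
  by apply/funext => n; apply: eq_bigr => k _; rewrite hyp2F1_term.
apply/cvg_lim => //.
apply: (cvg_geometric_bound R _ _ (e%:R / s ^+ e * (`|M| * 2)) s 2); first by rewrite (ltW s0).
move=> n n2.
pose B t := sin t * cos t ^+ e.-1 * (binomial_poly R b n).[cos t ^+ 2].
have cB : continuous B by exact: continuous_binomial_integrand.
have BE : seg R B u (pi / 2) = s ^+ e / e%:R * F n.
  by rewrite /B seg_binomial_poly // ltW.
have -> : F n = e%:R / s ^+ e * seg R B u (pi / 2).
  by rewrite BE; field; rewrite gt_eqF //= gt_eqF.
have -> : e%:R * trig_int R d e u 1 / s ^+ e = e%:R / s ^+ e * trig_int R d e u 1.
  by rewrite mulrAC.
have es0 : 0 <= e%:R / s ^+ e := divr_ge0 (ltW er0) (ltW se0).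
rewrite -mulrBr normrM (ger0_norm es0) -[leRHS]mulrA.
apply: ler_wpM2l => //.
have cw := continuous_trig_weight R d e.
have cNw : continuous (fun t => -1 * trig_weight R d e t).
  by apply: continuous_mul => //; exact: cst_continuous.
pose D t := B t + -1 * trig_weight R d e t.
have cD : continuous D by move=> t; exact: cvgD (cB t) (cNw t).
have -> : seg R B u (pi / 2) - trig_int R d e u 1 = seg R D u (pi / 2).
  by rewrite segD // segZ // trig_int1E mulN1r.
have pu : u <= pi / 2 := ltW u2.
pose L := `|M| * s ^+ n.
have L0 : 0 <= L by rewrite mulr_ge0 // exprn_ge0 // ltW.
have DL t : u <= t <= pi / 2 -> `|D t| <= L.
  move=> ut; have h := hM n t n2 ut.
  have -> : D t = - (cos t ^+ e.-1 * (sin t ^+ d.-1 -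
      sin t * (binomial_poly R b n).[cos t ^+ 2])).
    by rewrite /D /B /trig_weight; ring.
  rewrite normrN normrM -[L]mul1r ler_pM //.
    by rewrite normrX exprn_ile1 // ler_norml cos_geN1 cos_le1.
  apply: (le_trans h); apply: ler_wpM2r; last exact: ler_norm.
  by rewrite exprn_ge0 // ltW.
have len : L * (pi / 2 - u) <= `|M| * 2 * s ^+ n.
  have -> : `|M| * 2 * s ^+ n = L * 2 by rewrite /L; ring.
  by apply: ler_wpM2l => //; have := pihalf_lt2 R; lra.
rewrite ler_norml; apply/andP; split.
  apply: (@le_trans _ _ (seg R (fun=> - L) u (pi / 2))).
    by rewrite seg_cst // mulNr lerN2.
  apply: le_seg => //; first exact: cst_continuous.
  by move=> t /DL; rewrite ler_norml => /andP[].
apply: (@le_trans _ _ (seg R (fun=> L) u (pi / 2))); last by rewrite seg_cst.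
apply: le_seg => //; first exact: cst_continuous.
by move=> t /DL; rewrite ler_norml => /andP[].
Qed.

(** * The Gamma function at half-integers *)

(** The intervals from [1 / (k + 1)] to [k + 1] exhaust the half-line and stay away from 0, where
    the Gamma integrand is singular for arguments below 1. *)
Definition lo_end (R : realType) (k : nat) : R := (k.+1%:R)^-1.
Definition hi_end (R : realType) (k : nat) : R := k.+1%:R.

(** The substitution [t = u ^ 2] turns the Gamma integral at [(n + 1) / 2] into twice this
    moment. *)
Definition gauss_moment (R : realType) (n k : nat) : R :=
  seg R (fun u => u ^+ n * gauss_fun u) (lo_end R k) (hi_end R k).

Lemma lo_hi_end (R : realType) (k : nat) :
  [/\ 0 < lo_end R k, lo_end R k <= 1 & 1 <= hi_end R k].
Proof.
rewrite /lo_end /hi_end invr_gt0 ltr0n; split=> //; last by rewrite ler1n.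
by rewrite invf_le1 ?ltr0n // ler1n.
Qed.

Lemma continuous_gauss_moment (R : realType) n :
  continuous (fun u : R => u ^+ n * gauss_fun u).
Proof.
apply: continuous_mul; last exact: continuous_gauss_fun.
by apply: (continuous_pow R id) => x; exact: cvg_id.
Qed.

Lemma is_derive_gauss_fun (R : realType) (u : R) :
  is_derive u (1 : R) (@gauss_fun R) (- 2 * u * gauss_fun u).
Proof.
have h := is_derive_funZ R (-1) _ u _ (is_derive_funX R id u 1 2%N (is_derive_id u 1)).
have := @is_derive1_comp R expR (fun u => -1 * u ^+ 2) u _ _ (is_derive_expR _) h.
rewrite (_ : expR \o _ = @gauss_fun R); last first.
  by apply/funext => x /=; rewrite mulN1r.
by move=> {}h; apply: (is_derive_eq h); rewrite /= /gauss_fun expr1 mulN1r; ring.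
Qed.

Lemma gauss_moment1 (R : realType) k :
  gauss_moment R 1 k = 2^-1 * (gauss_fun (lo_end R k) - gauss_fun (hi_end R k)).
Proof.
have [l0 l1 h1] := lo_hi_end R k.
transitivity (- 2^-1 * gauss_fun (hi_end R k) - - 2^-1 * gauss_fun (lo_end R k));
  last by ring.
apply: (seg_FTC R (fun u => - 2^-1 * gauss_fun u)); first exact: le_trans h1.
  move=> u; apply: (is_derive_eq (is_derive_funZ R (- 2^-1) _ u _ (is_derive_gauss_fun R u))).
  by field.
exact: continuous_gauss_moment.
Qed.

(** Integration by parts, with the antiderivative [- u^(n+1) exp (- u^2) / 2]. *)
Lemma gauss_momentSS (R : realType) n k :
  gauss_moment R n.+2 k = n.+1%:R / 2 * gauss_moment R n k +
    2^-1 * (lo_end R k ^+ n.+1 * gauss_fun (lo_end R k) -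
            hi_end R k ^+ n.+1 * gauss_fun (hi_end R k)).
Proof.
have [l0 l1 h1] := lo_hi_end R k.
have lh : lo_end R k <= hi_end R k by exact: le_trans h1.
pose F (u : R) := - 2^-1 * (u ^+ n.+1 * gauss_fun u).
have cg m := continuous_gauss_moment R m.
have cc : continuous (fun u : R => - (n.+1%:R / 2) * (u ^+ n * gauss_fun u)).
  by apply: continuous_mul => //; exact: cst_continuous.
have e : seg R (fun u => u ^+ n.+2 * gauss_fun u +
    - (n.+1%:R / 2) * (u ^+ n * gauss_fun u)) (lo_end R k) (hi_end R k) =
    F (hi_end R k) - F (lo_end R k).
  apply: seg_FTC => //.
    move=> u; apply: (is_derive_eq (is_derive_funZ R (- 2^-1) _ u _
      (is_derive_funM R _ _ u _ _ (is_derive_funX R id u 1 n.+1 (is_derive_id u 1))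
        (is_derive_gauss_fun R u)))).
    by rewrite /= !exprS; field.
  by move=> u; exact: cvgD (cg _ u) (cc u).
move: e; rewrite segD //.
rewrite segZ // -/(gauss_moment R n.+2 k) -/(gauss_moment R n k) => e.
rewrite -[LHS](addrK (- (n.+1%:R / 2) * gauss_moment R n k)) e /F; ring.
Qed.

Lemma pow_expR_bound (R : realType) (x : R) m : 0 <= x -> (0 < m)%N ->
  x ^+ m <= m%:R ^+ m * expR x.
Proof.
move=> x0 m0; have m1 : 0 < m%:R :> R by rewrite ltr0n.
have h : x / m%:R <= expR (x / m%:R).
  apply: le_trans (expR_ge1Dx _); first by rewrite lerDr.
have : (x / m%:R) ^+ m <= expR (x / m%:R) ^+ m.
  by rewrite lerXn2r ?nnegrE ?expR_ge0 // divr_ge0 // ltW.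
rewrite -expRM_natl -[m%:R * _]mulrC divfK ?gt_eqF // expr_div_n.
by rewrite ler_pdivrMr ?exprn_gt0 // mulrC.
Qed.

Lemma gauss_tail (R : realType) n k :
  hi_end R k ^+ n.+1 * gauss_fun (hi_end R k) <= n.+2%:R ^+ n.+2 * lo_end R k.
Proof.
have [l0 l1 h1] := lo_hi_end R k.
have h0 : 0 < hi_end R k by apply: lt_le_trans h1.
rewrite /lo_end -/(hi_end R k) ler_pdivlMr //.
(* Taking exponent [n + 2] at [hi_end ^ 2] gives a power of [hi_end] larger than required, which
   leaves the decay [1 / hi_end = lo_end]. *)
have b := pow_expR_bound R (hi_end R k ^+ 2) n.+2 (sqr_ge0 _) isT.
rewrite /gauss_fun expRN mulrAC ler_pdivrMr ?expR_gt0 //.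
apply: le_trans b; rewrite -exprSr -exprM ler_weXn2l //.
by rewrite mul2n -addnn addSn ltnS leq_addr.
Qed.

Lemma cvg_lo_end (R : realType) : lo_end R @ \oo --> (0 : R).
Proof. exact: cvg_harmonic. Qed.

Lemma cvg_boundary (R : realType) n :
  (fun k => 2^-1 * (lo_end R k ^+ n.+1 * gauss_fun (lo_end R k) -
            hi_end R k ^+ n.+1 * gauss_fun (hi_end R k))) @ \oo --> (0 : R).
Proof.
have C0 : 0 <= n.+2%:R ^+ n.+2 + 1 :> R by rewrite addr_ge0 // exprn_ge0.
have hz : (fun k => (n.+2%:R ^+ n.+2 + 1) * lo_end R k) @ \oo --> (0 : R).
  rewrite -[X in _ --> X](mulr0 (n.+2%:R ^+ n.+2 + 1)).
  by apply: cvgM; [exact: cvg_cst|exact: cvg_lo_end].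
have hNz : (fun k => - ((n.+2%:R ^+ n.+2 + 1) * lo_end R k)) @ \oo --> (0 : R).
  by rewrite -[X in _ --> X]oppr0; apply: cvgN.
apply: squeeze_cvgr hNz hz; near=> k.
have [l0 l1 h1] := lo_hi_end R k; have t := gauss_tail R n k.
have a0 : 0 <= lo_end R k ^+ n.+1 * gauss_fun (lo_end R k).
  by rewrite mulr_ge0 ?gauss_fun_ge0 // exprn_ge0 // ltW.
have a1 : lo_end R k ^+ n.+1 * gauss_fun (lo_end R k) <= lo_end R k.
  rewrite -[leRHS]mulr1 ler_pM ?gauss_fun_ge0 ?gauss_fun_le1 //.
    by rewrite exprn_ge0 // ltW.
  by rewrite exprS ler_piMr ?(ltW l0) // exprn_ile1 // ltW.
have b0 : 0 <= hi_end R k ^+ n.+1 * gauss_fun (hi_end R k).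
  by rewrite mulr_ge0 ?gauss_fun_ge0 // exprn_ge0 // (le_trans _ h1).
rewrite mulrDl mul1r.
move: (n.+2%:R ^+ _ * _) (lo_end R k ^+ _ * _) (hi_end R k ^+ _ * _) t a0 a1 b0.
by move=> x y z; clear -l0 => *; apply/andP; split; lra.
Unshelve. all: by end_near. Qed.

(* The limit [\int_0^oo u ^ n exp (- u ^ 2) du] of [gauss_moment]. *)
Fixpoint gauss_lim (R : realType) (n : nat) : R :=
  match n with
  | 0 => Num.sqrt pi / 2
  | 1 => 2^-1
  | S (S m) => (S m)%:R / 2 * gauss_lim R m
  end.

Lemma nondecreasing_exhaustion (R : realType) :
  nondecreasing_seq (fun k => [set` `[lo_end R k, hi_end R k]] : set R).
Proof.
move=> i j ij; apply/subsetPset => x /=; rewrite !in_itv /= => /andP[xl xh].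
apply/andP; split.
  apply: le_trans xl; rewrite /lo_end lef_pV2 ?posrE ?ltr0n //.
  by rewrite ler_nat ltnS.
by apply: le_trans xh _; rewrite /hi_end ler_nat ltnS.
Qed.

Lemma bigcup_exhaustion (R : realType) :
  \bigcup_k [set` `[lo_end R k, hi_end R k]] = `]0, +oo[%classic :> set R.
Proof.
apply/seteqP; split=> x /=.
  move=> [k _] /=; rewrite !in_itv /= andbT => /andP[xl _].
  by have [l0 _ _] := lo_hi_end R k; exact: lt_le_trans xl.
rewrite in_itv /= andbT => x0.
pose k := Num.bound (x + x^-1); exists k => //=.
have h : x + x^-1 < k%:R by apply: archi_boundP; rewrite addr_ge0 ?invr_ge0 // ltW.
have xi : 0 < x^-1 by rewrite invr_gt0.
rewrite in_itv /= /lo_end /hi_end; apply/andP; split.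
  rewrite -[leRHS]invrK lef_pV2 ?posrE ?ltr0n // -natr1.
  by move: (k%:R) (x^-1) h xi => y z; clear -x0 => *; lra.
rewrite -natr1.
by move: (k%:R) (x^-1) h xi => y z; clear -x0 => *; lra.
Qed.

(** Even moments start from the Gaussian integral, by monotone convergence, and odd ones from an
    explicit antiderivative; the recursion goes up by two and its boundary terms tend to 0. *)
Lemma cvg_gauss_moment (R : realType) n :
  gauss_moment R n @ \oo --> gauss_lim R n.
Proof.
elim/ltn_ind: n => -[|[|n]] ih.
- have := @ge0_nondecreasing_set_cvg_integral _ (measurableTypeR R) R
    (fun k => [set` `[lo_end R k, hi_end R k]]) (fun u => (gauss_fun u)%:E)
    (@lebesgue_measure R) (nondecreasing_exhaustion R).
  rewrite bigcup_exhaustion => /(_ (fun=> measurable_itv _)) h.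
  have mg : measurable_fun (setT : set R) (fun u : R => (gauss_fun u)%:E).
    by apply/measurable_EFinP; exact: measurable_gauss_fun.
  have {}h := h (fun=> measurable_funTS mg).
  have {}h := h (fun k u _ => ltac:(by rewrite lee_fin gauss_fun_ge0)).
  move: h; rewrite integral_itv_obnd_cbnd; last exact: measurable_funTS.
  rewrite integral0y_gauss => /fine_cvgP[_]; apply: cvg_trans.
  apply: near_eq_cvg; apply: nearW => k /=.
  by apply: eq_seg => x _; rewrite expr0 mul1r.
- rewrite (funext (fun k => gauss_moment1 R k)).
  rewrite [gauss_lim R 1](_ : _ = 2^-1 * (gauss_fun (0 : R) - 0)); last first.
    by rewrite /gauss_fun subr0 expr0n /= oppr0 expR0 mulr1.
  apply: cvgM; first exact: cvg_cst.
  apply: cvgB.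
    by apply: continuous_cvg; [exact: continuous_gauss_fun|exact: cvg_lo_end].
  have hz : (fun k => 2%:R ^+ 2 * lo_end R k) @ \oo --> (0 : R).
    rewrite -[X in _ --> X](mulr0 (2%:R ^+ 2)).
    by apply: cvgM; [exact: cvg_cst|exact: cvg_lo_end].
  apply: squeeze_cvgr (cvg_cst 0) hz; near=> k.
  have [_ _ h1] := lo_hi_end R k.
  rewrite gauss_fun_ge0 /=; apply: le_trans (gauss_tail R 0 k).
  by rewrite expr1 ler_peMl // gauss_fun_ge0.
- rewrite (funext (fun k => gauss_momentSS R n k)).
  rewrite -[gauss_lim R n.+2]addr0; apply: cvgD; last exact: cvg_boundary.
  by apply: cvgM; [exact: cvg_cst|exact: ih].
Unshelve. all: by end_near. Qed.

(** The substitution is made on the compact intervals [E k], where the integrand is continuous, and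
    monotone convergence passes to the half-line. *)
Lemma Gamma_half (R : realType) n : Gamma R (n.+1%:R / 2) = 2 * gauss_lim R n.
Proof.
pose G (t : R) := t `^ (n.+1%:R / 2 - 1) * expR (- t).
pose E k : set R := [set` `[lo_end R k ^+ 2, hi_end R k ^+ 2]].
have ndE : nondecreasing_seq E.
  move=> i j ij; apply/subsetPset => x; rewrite /E /= !in_itv /= => /andP[xl xh].
  have [l0 l1 h1] := lo_hi_end R j; have [l0' _ h1'] := lo_hi_end R i.
  apply/andP; split.
    apply: le_trans xl; rewrite lerXn2r ?nnegrE ?(ltW l0) ?(ltW l0') //.
    by rewrite /lo_end lef_pV2 ?posrE ?ltr0n // ler_nat ltnS.
  apply: le_trans xh _; rewrite lerXn2r ?nnegrE ?(le_trans ler01) //.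
  by rewrite /hi_end ler_nat ltnS.
have UE : \bigcup_k E k = `]0, +oo[%classic.
  apply/seteqP; split=> x.
    move=> [k _]; rewrite /E /= !in_itv /= andbT => /andP[xl _].
    by have [l0 _ _] := lo_hi_end R k; rewrite (lt_le_trans _ xl) // exprn_gt0.
  have -> : `]0, +oo[%classic x = (\bigcup_k [set` `[lo_end R k, hi_end R k]]) x.
    by rewrite bigcup_exhaustion.
  move=> [k _] /=; rewrite in_itv /= => /andP[xl xh]; exists k => //=.
  have [l0 l1 h1] := lo_hi_end R k.
  rewrite /E /= in_itv /=; apply/andP; split.
    by apply: le_trans xl; rewrite expr2 ler_piMr // ltW.
  by apply: le_trans xh _; rewrite expr2 ler_peMr // (le_trans ler01).
have mG : measurable_fun (setT : set R) (fun t : R => (G t)%:E).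
  apply/measurable_EFinP; apply: measurable_funM; first exact: measurable_powR.
  by apply: measurableT_comp => //; exact: measurableT_comp.
have G0 t : 0 <= G t by rewrite mulr_ge0 ?powR_ge0 ?expR_ge0.
have sub k : (\int[@lebesgue_measure R]_(t in E k) (G t)%:E)%E =
    (2 * gauss_moment R n k)%:E.
  have [l0 l1 h1] := lo_hi_end R k.
  have lh : lo_end R k <= hi_end R k by exact: le_trans h1.
  have dF (x : R) : is_derive x (1 : R) (fun u : R => u ^+ 2) (2 * x).
    by apply: (is_derive_eq (is_derive_funX R id x 1 2%N (is_derive_id x 1)));
      rewrite expr1 mulr1.
  have F' : (fun u : R => u ^+ 2)^`()%classic = fun x => 2 * x.
    by apply/funext => x; rewrite derive1E; exact: derive_val.
  have c2 : continuous (fun x : R => 2 * x).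
    by apply: continuous_mul => x; [exact: cvg_cst|exact: cvg_id].
  have cF : continuous (fun u : R => u ^+ 2) by move=> x; exact: exprn_continuous.
  rewrite /E (@integration_by_substitution_increasing R (fun u => u ^+ 2) G) //.
  - rewrite F' -segZ; last exact: continuous_gauss_moment.
    rewrite /seg /Rintegral fineK; last first.
      apply: integrable_fin_num => //; apply: seg_integrable.
      by apply: continuous_mul; [exact: cst_continuous|exact: continuous_gauss_moment].
    apply: eq_integral => u; rewrite inE /= in_itv /= => /andP[lu uh].
    have u0 : 0 < u := lt_le_trans l0 lu.
    congr EFin; transitivity (G (u ^+ 2) * (2 * u)) => //.
    rewrite /G /gauss_fun.
    rewrite -[u ^+ 2 in X in X `^ _]powR_mulrn ?(ltW u0) // -powRrM.
    have -> : 2%:R * (n.+1%:R / 2 - 1) = n%:R - 1 :> R by rewrite -natr1; field.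
    rewrite powRD; last by apply/implyP => _; rewrite gt_eqF.
    rewrite powR_mulrn ?(ltW u0) // powR_inv1 ?(ltW u0) //.
    by field; rewrite gt_eqF.
  - move=> x y; rewrite !in_itv /= => /andP[xl _] _ xy.
    by rewrite ltrXn2r // ?nnegrE ?(le_trans (ltW l0)) // ltW.
  - by rewrite F' => x _; exact: c2.
  - by rewrite F'; apply/cvg_ex; eexists; apply: cvg_at_right_filter; exact: c2.
  - by rewrite F'; apply/cvg_ex; eexists; apply: cvg_at_left_filter; exact: c2.
  - split; first by move=> x _; have [] := dF x.
      by apply: cvg_at_right_filter; exact: cF.
    by apply: cvg_at_left_filter; exact: cF.
  - apply: continuous_in_subspaceT => x; rewrite inE /= in_itv /= => /andP[lx _].
    have x0 : 0 < x by rewrite (lt_le_trans _ lx) // exprn_gt0.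
    have cp : {for x, continuous (fun t : R => t `^ (n.+1%:R / 2 - 1))}.
      apply: differentiable_continuous; apply/derivable1_diffP.
      by have [] := is_derive1_powR (n.+1%:R / 2 - 1) x0.
    have ce : {for x, continuous (fun t : R => expR (- t))}.
      apply: (@continuous_comp _ _ _ (fun t : R => - t) expR).
        by apply: cvgN; exact: cvg_id.
      exact: continuous_expR.
    exact: cvgM cp ce.
have := @ge0_nondecreasing_set_cvg_integral _ (measurableTypeR R) R E (fun t => (G t)%:E)
    (@lebesgue_measure R) ndE (fun=> measurable_itv _) (fun=> measurable_funTS mG)
    (fun k t _ => ltac:(by rewrite lee_fin G0)).
rewrite UE; under eq_fun do rewrite sub.
have lim2 : (fun k => (2 * gauss_moment R n k)%:E) @ \oo --> (2 * gauss_lim R n)%:E.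
  apply: cvg_EFin; first exact: nearW.
  by apply: cvgM; [exact: cvg_cst|exact: cvg_gauss_moment].
move=> h; have := cvg_unique _ h lim2; rewrite /Gamma /Rintegral => -> //.
Qed.

Lemma gauss_lim_gt0 (R : realType) n : 0 < gauss_lim R n.
Proof.
elim/ltn_ind: n => -[|[|n]] ih /=.
- by rewrite divr_gt0 // sqrtr_gt0 pi_gt0.
- by rewrite invr_gt0.
- by rewrite mulr_gt0 ?divr_gt0 ?ltr0n // ih.
Qed.

Lemma Gamma_half_gt0 (R : realType) n : 0 < Gamma R (n.+1%:R / 2).
Proof. by rewrite Gamma_half mulr_gt0 // gauss_lim_gt0. Qed.

Lemma Gamma_halfSS (R : realType) n :
  Gamma R (n.+3%:R / 2) = n.+1%:R / 2 * Gamma R (n.+1%:R / 2).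
Proof. by rewrite !Gamma_half /=; ring. Qed.

(** * The Beta integral at half-integers *)

Lemma jacobi_op_X (R : realType) (a b : R) :
  jacobi_op R a b 'X = b%:P - (a + b) *: 'X.
Proof. by rewrite /jacobi_op derivX -polyC1 derivC mulr0 add0r mulr1. Qed.

(** The integral of [L 'X] over the whole interval is zero, which relates the integrals of [1] and
    ['X]; raising the power of cosine by two inserts the factor [1 - 'X]. *)
Lemma trig_int_cosSS (R : realType) (d e : nat) :
  (d.+1%:R + e.+1%:R) * trig_int R d.+1 e.+3 0 1 = e.+1%:R * trig_int R d.+1 e.+1 0 1.
Proof.
have pp : (0 : R) <= pi / 2 by rewrite divr_ge0 // pi_ge0.
have h := trig_int_jacobi_op R d.+1 e.+1 0 'X isT isT pp.
rewrite sin0 (expr0n _ d.+1) /= mul0r mulr0 oppr0 jacobi_op_X in h.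
have -> : trig_int R d.+1 e.+3 0 1 = trig_int R d.+1 e.+1 0 (1 + (-1) *: 'X).
  apply: eq_seg => t _; rewrite /trig_weight /= hornerD hornerZ hornerX !hornerC.
  have c2 : cos t ^+ 2 = 1 - sin t ^+ 2 by rewrite -(cos2Dsin2 t) addrK.
  have -> : cos t ^+ e.+2 = cos t ^+ e * (1 - sin t ^+ 2) by rewrite -c2 -exprD addn2.
  by ring.
move: h; rewrite trig_intD -scaleN1r -alg_polyC scalerA !trig_intZ trig_intD trig_intZ.
move: (trig_int _ _ _ _ 1) (trig_int _ _ _ _ 'X) => x y h.
apply/eqP; rewrite -subr_eq0; apply/eqP.
transitivity (2 * (d.+1%:R / 2 * x + -1 * (e.+1%:R / 2 + d.+1%:R / 2) * y)).
  by field.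
by rewrite h mulr0.
Qed.

Lemma trig_int_sinSS (R : realType) (d e : nat) :
  (d.+1%:R + e.+1%:R) * trig_int R d.+3 e.+1 0 1 = d.+1%:R * trig_int R d.+1 e.+1 0 1.
Proof.
have pp : (0 : R) <= pi / 2 by rewrite divr_ge0 // pi_ge0.
have h := trig_int_jacobi_op R d.+1 e.+1 0 'X isT isT pp.
rewrite sin0 (expr0n _ d.+1) /= mul0r mulr0 oppr0 jacobi_op_X in h.
have -> : trig_int R d.+3 e.+1 0 1 = trig_int R d.+1 e.+1 0 'X.
  apply: eq_seg => t _; rewrite /trig_weight /= !exprS -polyC1 hornerX !hornerC.
  by rewrite expr0; ring.
move: h; rewrite trig_intD -scaleN1r -alg_polyC scalerA !trig_intZ.
move: (trig_int _ _ _ _ 1) (trig_int _ _ _ _ 'X) => x y h.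
apply/eqP; rewrite eq_sym -subr_eq0; apply/eqP.
transitivity (2 * (d.+1%:R / 2 * x + -1 * (e.+1%:R / 2 + d.+1%:R / 2) * y)).
  by field.
by rewrite h mulr0.
Qed.

Lemma beta_step (F : numFieldType) (D E G1 G2 G3 I : F) : D + E != 0 -> G3 != 0 ->
  (D + E) * I = E * (G1 * G2 / (2 * G3)) ->
  I = E / 2 * G1 * G2 / (2 * ((D + E) / 2 * G3)).
Proof.
move=> h1 h2 hI; rewrite -[LHS](mulKf h1) hI; field.
by rewrite h2 h1.
Qed.

(** Induction by steps of two in both exponents, from the four pairs with entries 1 or 2; the pair
    of two 1's brings in [pi]. Each step matches the recursion of [Gamma] through [beta_step]. *)
Lemma trig_int_Gamma (R : realType) (d e : nat) :
  trig_int R d.+1 e.+1 0 1 =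
  Gamma R (e.+1%:R / 2) * Gamma R (d.+1%:R / 2) / (2 * Gamma R ((e.+1 + d.+1)%:R / 2)).
Proof.
have pp : (0 : R) <= pi / 2 by rewrite divr_ge0 // pi_ge0.
have gn n : Gamma R (n.+1%:R / 2) != 0 by rewrite gt_eqF // Gamma_half_gt0.
have sn n : (n.+1%:R : R) != 0 by rewrite pnatr_eq0.
have sqpi : Num.sqrt pi * Num.sqrt pi = pi :> R by rewrite -expr2 sqr_sqrtr // pi_ge0.
elim/ltn_ind: d e => -[|[|d]] ihd.
- elim/ltn_ind => -[|[|e]] ihe.
  + rewrite trig_int1E (eq_seg R _ (fun=> 1)).
      rewrite seg_cst // mul1r subr0 addn1 !Gamma_half /=.
      transitivity (2 * (Num.sqrt pi * Num.sqrt pi) / (4 : R)); last by field.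
      by rewrite sqpi; field.
    by move=> t _; rewrite /trig_weight !expr0 mul1r.
  + rewrite trig_int1E (eq_seg R _ cos); last first.
      by move=> t _; rewrite /trig_weight expr0 expr1 mul1r.
    rewrite (seg_FTC R sin cos 0 (pi / 2) pp (fun x => is_derive_sin x) (@continuous_cos R)).
    rewrite sin_pihalf sin0 subr0 addn1 !Gamma_half /=.
    field; by rewrite gt_eqF // sqrtr_gt0 pi_gt0.
  + have de : (1%:R + e.+1%:R : R) != 0 by rewrite -natrD pnatr_eq0.
    have h := trig_int_cosSS R 0 e; rewrite (ihe e) // in h.
    rewrite -[(e.+3 + 1)%N]/((e + 1).+3) (Gamma_halfSS R e) (Gamma_halfSS R (e + 1)).
    by rewrite (beta_step _ _ _ _ _ _ _ de (gn (e + 1)%N) h) -natrD add1n addn1.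
- elim/ltn_ind => -[|[|e]] ihe.
  + rewrite trig_int1E (eq_seg R _ (fun t => sin t * cos t ^+ 0)) //.
    rewrite seg_sin_cos // cos0 expr1n add1n !Gamma_half /=.
    field; by rewrite gt_eqF // sqrtr_gt0 pi_gt0.
  + rewrite trig_int1E (eq_seg R _ (fun t => sin t * cos t ^+ 1)) //.
    rewrite seg_sin_cos // cos0 expr1n !Gamma_half /=; by field.
  + have de : (2%:R + e.+1%:R : R) != 0 by rewrite -natrD pnatr_eq0.
    have h := trig_int_cosSS R 1 e; rewrite (ihe e) // in h.
    rewrite -[(e.+3 + 2)%N]/((e + 2).+3) (Gamma_halfSS R e) (Gamma_halfSS R (e + 2)).
    by rewrite (beta_step _ _ _ _ _ _ _ de (gn (e + 2)%N) h) -natrD add2n addn2.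
- move=> e; have de : (d.+1%:R + e.+1%:R : R) != 0 by rewrite -natrD pnatr_eq0.
  have h := trig_int_sinSS R d e; rewrite (ihd d) // in h.
  (* Exchanging the two Gamma factors lets [beta_step], stated for the first of them, serve the sine
     recursion as well. *)
  rewrite (mulrC _ (Gamma R (d.+1%:R / 2))) [(e.+1 + _)%N]addnC in h.
  rewrite (mulrC _ (Gamma R (d.+3%:R / 2))) [(e.+1 + _)%N]addnC.
  rewrite [d.+1%:R + _]addrC in de h.
  rewrite -[(d.+3 + e.+1)%N]/((d + e.+1).+3) (Gamma_halfSS R d) (Gamma_halfSS R (d + e.+1)).
  by rewrite (beta_step _ _ _ _ _ _ _ de (gn (d + e.+1)%N) h) -natrD addnC.
Qed.

(** * The bound in terms of the largest root *)

Lemma root_jacobi01 (R : realType) (a b : R) (k : nat) (t : R) :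
  (jacobi01 R a b k).[t] = (jacobi R a b k).[2 * t - 1].
Proof.
by rewrite /jacobi01 horner_comp hornerD hornerN hornerZ hornerX hornerC.
Qed.

Lemma powR_inv_sqr_half (R : realType) (s : R) (e : nat) :
  0 < s -> ((s ^+ 2)^-1) `^ (e%:R / 2) = (s ^+ e)^-1.
Proof.
move=> s0; rewrite -exprVn -[X in X `^ _]powR_mulrn ?invr_ge0 ?(ltW s0) // -powRrM.
by rewrite mulrCA divff ?pnatr_eq0 // mulr1 powR_mulrn ?exprVn // invr_ge0 ltW.
Qed.

Theorem theorem4p1 (R : realType) (K : kfield) (m p : nat)
  (hm : (2 <= m)%N) (hp : ~~ odd p)
  (sigma : probability ((kdim K * m).-tuple R) R)
  (hsigma : normalized_rotation_invariant R (kdim K * m) sigma)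
  (xi : R)
  (hxi : root (jacobi R (((kdim K * (m - 1))%:R - 2) / 2 + 1)
                        (((kdim K)%:R - 2) / 2 + 1) p./2) xi)
  (hxi_max : forall t : R,
     root (jacobi R (((kdim K * (m - 1))%:R - 2) / 2 + 1)
                    (((kdim K)%:R - 2) / 2 + 1) p./2) t -> t <= xi)
  (n : nat) (x : 'I_n -> (kdim K * m).-tuple R) (rho : 'I_n -> R)
  (hcub : proj_cubature R K m p sigma n x rho) :
  let alpha : R := ((kdim K * (m - 1))%:R - 2) / 2 in
  let beta : R := ((kdim K)%:R - 2) / 2 in
  let eps : R := (1 - xi) / 2 in
  Gamma R (alpha + 2) * Gamma R (beta + 1)
    / (Gamma R (alpha + beta + 2) * hyp2F1 R (- beta) (alpha + 1) (alpha + 2) eps)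
    * (eps^-1) `^ ((kdim K * (m - 1))%:R / 2)
  <= n%:R.
Proof.
cbv zeta; set alpha : R := ((kdim K * (m - 1))%:R - 2) / 2.
set beta : R := ((kdim K)%:R - 2) / 2; set eps : R := (1 - xi) / 2.
have Ea : alpha + 1 = (kdim K * (m - 1))%:R / 2 by rewrite /alpha; field.
have Eb : beta + 1 = (kdim K)%:R / 2 by rewrite /beta; field.
rewrite -/alpha -/beta Ea Eb in hxi hxi_max.
clearbody alpha; set e := (kdim K * (m - 1))%N in Ea hxi hxi_max *.
have d0 := kdim_gt0 K.
have e0 : (0 < e)%N by rewrite muln_gt0 d0 subn_gt0.
pose k := p./2; rewrite -/k in hxi hxi_max.
have pk : p = (k * 2)%N by rewrite muln2 even_halfK.
pose c := (1 + xi) / 2.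
have Qc : (jacobi01 R (e%:R / 2) ((kdim K)%:R / 2) k).[c] = 0.
  rewrite root_jacobi01 (_ : 2 * c - 1 = xi); last by rewrite /c; field.
  exact/eqP.
have cmax t : (jacobi01 R (e%:R / 2) ((kdim K)%:R / 2) k).[t] = 0 -> t <= c.
  by rewrite root_jacobi01 => /eqP /hxi_max h; rewrite /c; lra.
have [/andP[c0 c1] _] := jacobi01_extremal R (e%:R / 2) ((kdim K)%:R / 2) k c
  ltac:(by rewrite divr_gt0 // ltr0n) ltac:(by rewrite divr_gt0 // ltr0n) Qc cmax.
(* The angle with [sin u ^ 2 = c] and [cos u ^ 2 = eps]; both lie strictly between 0 and 1, so [u]
   is interior to the quarter circle. *)
pose u := asin (Num.sqrt c).
have sc0 : 0 < Num.sqrt c by rewrite sqrtr_gt0.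
have sc1 : Num.sqrt c < 1 by rewrite -sqrtr1 ltr_sqrt.
have su : sin u = Num.sqrt c by rewrite asinK // in_itv /=; apply/andP; split; lra.
have su2 : sin u ^+ 2 = c by rewrite su sqr_sqrtr // ltW.
have u2 : u < pi / 2 by apply: asin_ltpi2; apply/andP; split; lra.
have u0 : 0 < u.
  rewrite ltNge; apply/negP => ule.
  have nu : - (pi / 2) < u by apply: asin_gtNpi2; apply/andP; split; lra.
  have : 0 <= sin (- u) by apply: sin_ge0_pi; apply/andP; split; have := pi_gt0 R; lra.
  by rewrite sinN su oppr_ge0 leNgt sc0.
have cu0 : 0 < cos u by apply: cos_gt0_pihalf; rewrite u2 andbT; lra.
have cu2 : cos u ^+ 2 = eps.
  by rewrite -[LHS](addrK (sin u ^+ 2)) cos2Dsin2 su2 /c /eps; field.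
rewrite -su2 in Qc cmax.
have key := cubature_cap_bound R K m k sigma n x rho u hm hsigma.
rewrite pk in hcub.
have {}key := key hcub Qc cmax ltac:(by rewrite ltW).
have tpos : 0 < trig_int R (kdim K) e u 1 by apply: trig_int_gt0; rewrite ltW.
have h21 : hyp2F1 R (- beta) (alpha + 1) (alpha + 2) eps =
    e%:R * trig_int R (kdim K) e u 1 / cos u ^+ e.
  have -> : alpha + 2 = e%:R / 2 + 1 by rewrite -Ea; ring.
  by rewrite Ea -cu2 hyp2F1_trig // u0.
have G2 : Gamma R (alpha + 2) = e%:R / 2 * Gamma R (e%:R / 2).
  case: (e) e0 Ea => // e' _ Ea; rewrite -Gamma_halfSS; congr (Gamma R _).
  by rewrite -[e'.+3]addn2 natrD mulrDl -Ea; field.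
have tot : trig_int R (kdim K) e 0 1 =
    Gamma R (e%:R / 2) * Gamma R (beta + 1) / (2 * Gamma R (alpha + beta + 2)).
  have := trig_int_Gamma R (kdim K).-1 e.-1; rewrite !prednK // => ->; rewrite Eb natrD.
  by congr (_ / (2 * Gamma R _)); rewrite mulrDl -Ea -Eb; ring.
have gt : 0 < Gamma R (alpha + beta + 2).
  rewrite (_ : alpha + beta + 2 = ((e + kdim K).-1.+1)%:R / 2) ?Gamma_half_gt0 //.
  by rewrite prednK ?addn_gt0 ?e0 // natrD mulrDl -Ea -Eb; ring.
rewrite h21 G2 -cu2 powR_inv_sqr_half // -/e.
have en : 0 < e%:R :> R by rewrite ltr0n.
(* The factors [cos u ^+ e] from [hyp2F1] and from the power of [1 / eps] cancel, so the bound is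
   exactly the total mass divided by the mass of the cap. *)
have -> : e%:R / 2 * Gamma R (e%:R / 2) * Gamma R (beta + 1) /
    (Gamma R (alpha + beta + 2) * (e%:R * trig_int R (kdim K) e u 1 / cos u ^+ e)) /
    cos u ^+ e = trig_int R (kdim K) e 0 1 / trig_int R (kdim K) e u 1.
  rewrite tot; move: (cos u ^+ e) (exprn_gt0 e cu0) tpos gt en.
  move: (trig_int R _ e u 1) (Gamma R (alpha + beta + 2)) (Gamma R (beta + 1)).
  move: (Gamma R (e%:R / 2)) (e%:R : R).
  move=> Ge E T Gde Gd C C0 T0 G0 E0.
  by field; rewrite !gt_eqF.
by rewrite ler_pdivrMr.
Qed.
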